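(* Let $n$ be an integer with $1\le n\le 5$, let $A_1,\dots,A_N\in\mathcal M_n$, let $\alpha_1,\dots,\alpha_N\in\mathbb D$ be pairwise distinct, and let $\varphi\in\mathrm{Hol}(\mathbb D,\mathbb G_n)$. For each $1\le j\le N$ let $\lambda_{j,1},\dots,\lambda_{j,s_j}$ be the distinct eigenvalues of $A_j$, with algebraic multiplicities $m_{j,1},\dots,m_{j,s_j}$, and let $B_{j,1},\dots,B_{j,s_j}$ be the corresponding blocks of the Jordan form of $A_j$ ($B_{j,i}\in\mathcal M_{m_{j,i}}$ and $\mathrm{Sp}(B_{j,i})=\{\lambda_{j,i}\}$). Then there exists $\Phi\in\mathrm{Hol}(\mathbb D,\Omega_n)$ satisfying $\varphi=\pi\circ\Phi$ and $\Phi(\alpha_j)=A_j$ for $j=1,\dots,N$ if and only if for every $1\le j\le N$, every $1\le i\le s_j$ and every $0\le k\le m_{j,i}-1$, $$\frac{d^kP_{[\varphi(\zeta)]}}{dt^k}(\lambda_{j,i})=O\big((\zeta-\alpha_j)^{d_{m_{j,i}-k}(B_{j,i})}\big)\quad\text{as }\zeta\to\alpha_j .$$ Furthermore, the values $\Phi(\zeta)$ may be chosen to be cyclic matrices when $\zeta\in\mathbb D\setminus\{\alpha_1,\dots,\alpha_N\}$.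
   Context: $\mathbb D=\{z\in\mathbb C:|z|<1\}$; $\mathrm{Hol}(X,Y)$ is the set of holomorphic maps from $X$ to $Y$. $\mathcal M_n$ is the set of $n\times n$ complex matrices, $\mathrm{Sp}(A)$ the spectrum of $A$, and $\Omega_n=\{A\in\mathcal M_n:\max_{\lambda\in \mathrm{Sp}(A)}|\lambda|<1\}$ is the spectral ball. The map $\pi=(\sigma_1,\dots,\sigma_n):\mathcal M_n\to\mathbb C^n$ is defined by $\det(tI_n-A)=t^n+\sum_{j=1}^n(-1)^j\sigma_j(A)t^{n-j}$, so $\sigma_k(A)$ is the $k$-th elementary symmetric function of the eigenvalues of $A$. The symmetrized polydisc is $\mathbb G_n=\pi(\Omega_n)$. For $v=(v_1,\dots,v_n)\in\mathbb C^n$, $P_{[v]}(t)=t^n+\sum_{j=1}^n(-1)^jv_jt^{n-j}$. The derivatives $d^k/dt^k$ are taken with respect to the indeterminate $t$ of the polynomial. A matrix $A\in\mathcal M_n$ is cyclic if there is $v\in\mathbb C^n$ such that $\{A^kv:k\ge0\}$ spans $\mathbb C^n$. Definition of $d_i(B)$: let $B=(b_{i,j})\in\mathcal M_m$ be a matrix with a single eigenvalue $\lambda$ in upper triangular Jordan form (that is, $b_{jj}=\lambda$, $b_{j-1,j}\in\{0,1\}$, all other entries $0$), with the Jordan blocks arranged along the diagonal in non-decreasing order of size. Let $r$ be the rank of $B-\lambda I_m$ and write $\{j\in\{2,\dots,m\}:b_{j-1,j}=0\}=\{b_2<\dots<b_{m-r}\}$ (possibly empty). For $1\le i\le m$, $d_i(B)=1+\#\{k: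 m-i+2\le b_k\le m\}$. All Jordan forms are understood with this ordering of Jordan blocks within each eigenvalue. *)

(* Defs.v *)
From HB Require Import structures.
From mathcomp Require Import all_boot all_order all_algebra.
From mathcomp Require Import complex.
From mathcomp Require Import all_classical all_reals all_analysis.
Set Implicit Arguments.
Unset Strict Implicit.
Unset Printing Implicit Defensive.
Import Order.TTheory GRing.Theory Num.Theory.
Import numFieldNormedType.Exports.
Local Open Scope classical_set_scope.
Local Open Scope ring_scope.

(* The field R[i] packaged as a structure, from which the library infers its
   norm, topology and normed module structure over itself. *)
Definition CC (R : realType) : numClosedFieldType := R[i].

Section ComplexAnalysis.
Variable R : realType.

Definition unit_disc : set (CC R) := [set z | `|z| < 1].

(* Maps are total functions, constrained only on the disc.  The scalar field of
   [derivable] is CC R, so this is complex differentiability. *)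
Definition Hol_disc (V : normedModType (CC R)) (X : set V) (f : CC R -> V) :=
  forall z, unit_disc z -> derivable f z 1 /\ X (f z).

Variable n : nat.

Definition spectral_ball : set 'M[CC R]_n :=
  [set A | forall a, eigenvalue A a -> `|a| < 1].

(* Coordinates are numbered from 0: entry j is sigma_(j+1). *)
Definition sym_map (A : 'M[CC R]_n) : 'rV[CC R]_n :=
  \row_(j < n) ((-1) ^+ j.+1 * (char_poly A)`_(n - j.+1)).

Definition sym_polydisc : set 'rV[CC R]_n := sym_map @` spectral_ball.

Definition Pvec (v : 'rV[CC R]_n) : {poly (CC R)} :=
  'X^n + \sum_(j < n) ((-1) ^+ j.+1 * v ord0 j) *: 'X^(n - j.+1).

(* The equation defining the coordinates of sym_map. *)
Lemma char_poly_sym_map (A : 'M[CC R]_n) : char_poly A = Pvec (sym_map A).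
Proof.
have sz := size_char_poly A.
have mon := char_poly_monic A.
rewrite -[LHS]coefK sz poly_def big_ord_recr /= addrC; congr (_ + _).
  by move: mon; rewrite monicE lead_coefE sz /= => /eqP ->; rewrite scale1r.
rewrite (reindex_inj rev_ord_inj) /=; apply: eq_bigr => j _.
by rewrite mxE mulrA -exprD -signr_odd oddD addbb expr0 mul1r.
Qed.

Definition cyclic_mx (A : 'M[CC R]_n) : Prop :=
  exists v : 'cV[CC R]_n, forall w : 'cV[CC R]_n,
    exists p (c : 'I_p -> (CC R)), w = \sum_(k < p) c k *: (A ^+ k *m v).

End ComplexAnalysis.

Section Jordan.
Variable F : fieldType.

(* The entries of the set {j in 2..m : b_(j-1,j) = 0}, shifted to 0-based
   column indices: l here stands for the column j = l + 1. *)
Definition superdiag_zeros m (B : 'M[F]_m) : {set 'I_m} :=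
  [set l : 'I_m | [exists p : 'I_m, (p.+1 == l :> nat) && (B p l == 0)]].

(* The Jordan blocks of B start at row 0 and at the rows in superdiag_zeros B;
   [enum] lists these in increasing order. *)
Definition jordan_sizes m (B : 'M[F]_m) : seq nat :=
  pairmap (fun a b => b - a)%N 0%N
    (rcons [seq val l | l <- enum (superdiag_zeros B)] m).

Definition single_jordan_form m (a : F) (B : 'M[F]_m) : Prop :=
  (forall p q : 'I_m,
     if p == q then B p q = a
     else if p.+1 == q :> nat then B p q = 0 \/ B p q = 1
     else B p q = 0)
  /\ sorted leq (jordan_sizes B).

(* The bound m - i + 2 <= b_k reads m - i + 1 <= l for b_k = l + 1. *)
Definition jordan_d m (B : 'M[F]_m) (i : nat) : nat :=
  (1 + #|[set l in superdiag_zeros B | (m - i < l)%N]|)%N.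

(* lam lists the distinct eigenvalues of A, m their algebraic multiplicities,
   and B the corresponding blocks of a Jordan form of A.  The two base change
   matrices are inverse to each other, which forces \sum_i m i = n. *)
Definition jordan_data n (A : 'M[F]_n) s (lam : 'I_s -> F) (m : 'I_s -> nat)
    (B : forall i, 'M[F]_(m i)) : Prop :=
  [/\ injective lam,
      forall a, eigenvalue A a <-> exists i, lam i = a,
      forall i, m i = mup (lam i) (char_poly A),
      forall i, single_jordan_form (lam i) (B i)
    & exists (P : 'M[F]_(n, \sum_i m i)) (Q : 'M[F]_(\sum_i m i, n)),
        [/\ P *m Q = 1%:M, Q *m P = 1%:M & A = P *m (\mxdiag_i B i) *m Q]].

End Jordan.

(* Main.v *)
(* The companion matrix of [Pvec (phi z)] is multiplication by t on polynomials
   of degree < n.  In the coordinates f |-> f^(k)(lam)/k!, with lam an eigenvalue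
   of A_j and k less than its multiplicity, it is a matrix with one Jordan block
   per eigenvalue, minus a rank one matrix: a constant column times the row of the
   P^(k)(lam)/k! for P = [Pvec (phi z)].  Let these coordinates vanish at alpha_j
   to order #{starts of Jordan blocks of A_j after k}: the growth conditions say
   that the resulting lattice is stable under multiplication by t and that the
   induced matrix at alpha_j is the Jordan form of A_j.  Interpolating in SL_n
   gives a polynomial matrix G whose rows span these lattices at all alpha_j at
   once, and G C G^-1, for C the companion matrix, is the lifting: it is
   holomorphic across the alpha_j because zeros of holomorphic functions can be
   divided out.

   That division property comes from Cauchy's formula on a square.  Midpoint sums
   over dyadic subdivisions are additive under bisection, so Goursat's argument
   applies to them directly, and an ultrafilter limit plays the role of the
   contour integral.

   Conversely, expand det (x + lam - Phi z) over permutations: in the terms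
   contributing to x^k, every Jordan block with a diagonal place where x is not
   chosen provides an entry that vanishes at alpha_j. *)

Require Import Defs.
From HB Require Import structures.
From mathcomp Require Import all_boot all_order all_algebra.
From mathcomp Require Import perm complex ring lra zify.
From mathcomp Require Import all_classical all_reals all_analysis.
Set Implicit Arguments.
Unset Strict Implicit.
Unset Printing Implicit Defensive.
Import Order.TTheory GRing.Theory Num.Theory.
Import numFieldNormedType.Exports.
Local Open Scope classical_set_scope.
Local Open Scope ring_scope.

(** * Midpoint sums and Goursat's theorem *)

(** The offset 1 in [jordan_d] is what removes the rank one term. Put x = z - alpha_j and let w a be
    the number of block starts after coordinate a, so that the growth condition for a has exponent w
    a + 1. Conjugation by diag (x ^ w) multiplies entry (a, b) by x ^ (w a - w b). The weight drops
    by one exactly where a Jordan block of A_j ends and stays constant inside it, so at x = 0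
    precisely the unwanted superdiagonal entries disappear; the rank one term, divisible by x ^ (w b
    + 1) in column b, comes out with a factor x ^ (w a + 1) and disappears too.

    G has to be invertible at every other point, a global constraint on its determinant. Working
    with determinant 1 meets it, and the n-th roots needed to normalize prescribed values are
    invisible to conjugation.

    No integral is ever evaluated: of the contour functional only linearity, a bound, vanishing on
    difference quotients and non-vanishing on 1 / z are used.

    The order of the blocks matters for the converse: a set of k places where x is chosen leaves the
    fewest vanishing entries if it fills the smallest blocks, and these come first. *)

Section DyadicIntegral.
Variable F : numFieldType.
Implicit Types (f g : F -> F) (p q r a b c M : F) (n : nat) (K : set F).

Definition midpoint p q := (p + q) / 2.

(** A dyadic sum evaluates its function only at iterated midpoints of its end points, so this weak
    form of convexity suffices to stay inside K. *)
Definition midconvex K := forall p q, K p -> K q -> K (midpoint p q).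

Fixpoint dyadic_sum f n p q :=
  if n is n'.+1 then
    dyadic_sum f n' p (midpoint p q) + dyadic_sum f n' (midpoint p q) q
  else (q - p) * f (midpoint p q).

Lemma midpointC p q : midpoint p q = midpoint q p.
Proof. by rewrite /midpoint addrC. Qed.

Lemma dyadic_sumC f n p q : dyadic_sum f n q p = - dyadic_sum f n p q.
Proof.
elim: n p q => [|n IH] p q /=; first by rewrite midpointC -mulNr opprB.
by rewrite (midpointC q p) IH (IH p) opprD addrC.
Qed.

Lemma eq_dyadic_sum K f g n p q : midconvex K -> K p -> K q ->
  (forall z, K z -> f z = g z) -> dyadic_sum f n p q = dyadic_sum g n p q.
Proof.
move=> Kc + + fg; elim: n p q => [|n IH] p q Kp Kq /=.
  by rewrite fg //; apply: Kc.
by rewrite !IH //; apply: Kc.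
Qed.

Lemma dyadic_sumD f g n p q :
  dyadic_sum (fun z => f z + g z) n p q
  = dyadic_sum f n p q + dyadic_sum g n p q.
Proof.
elim: n p q => [|n IH] p q /=; first by rewrite mulrDr.
by rewrite !IH addrACA.
Qed.

Lemma dyadic_sumZ a f n p q :
  dyadic_sum (fun z => a * f z) n p q = a * dyadic_sum f n p q.
Proof.
elim: n p q => [|n IH] p q /=; first by rewrite mulrCA.
by rewrite !IH mulrDr.
Qed.

(** The midpoint rule integrates affine functions exactly, and the exact values add up under
    bisection. *)
Lemma dyadic_sum_affine a b n p q :
  dyadic_sum (fun z => a + b * z) n p q
  = a * (q - p) + b / 2 * (q ^+ 2 - p ^+ 2).
Proof.
elim: n p q => [|n IH] p q /=; rewrite /midpoint; first by field.
by rewrite !IH /midpoint; field.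
Qed.

Lemma dyadic_sum_bound K f n p q M : midconvex K -> K p -> K q ->
  (forall z, K z -> `|f z| <= M) -> `|dyadic_sum f n p q| <= M * `|q - p|.
Proof.
move=> Kc + + fM; elim: n p q => [|n IH] p q Kp Kq /=.
  by rewrite normrM mulrC ler_wpM2r //; apply/fM/Kc.
have h2 : (0 : F) <= 2^-1 by rewrite invr_ge0.
have -> : M * `|q - p|
    = M * `|midpoint p q - p| + M * `|q - midpoint p q|.
  rewrite [midpoint p q - p](_ : _ = 2^-1 * (q - p)); last first.
    by rewrite /midpoint; field.
  rewrite [q - midpoint p q](_ : _ = 2^-1 * (q - p)); last first.
    by rewrite /midpoint; field.
  by rewrite normrM (ger0_norm h2); field.
apply: le_trans (ler_normD _ _) _.
by apply: lerD; apply: IH => //; exact: Kc.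
Qed.

Lemma dyadic_sum_scale f n p q c :
  dyadic_sum f n (c * p) (c * q) = dyadic_sum (fun z => c * f (c * z)) n p q.
Proof.
have mE x y : midpoint (c * x) (c * y) = c * midpoint x y.
  by rewrite /midpoint -mulrDr mulrA.
elim: n p q => [|n IH] p q /=; rewrite mE; last by rewrite !IH.
by rewrite -mulrBr -mulrA mulrCA.
Qed.

Definition triangle_sum f n p q r :=
  dyadic_sum f n p q + dyadic_sum f n q r + dyadic_sum f n r p.

(** Each half side of level n comes from bisecting a side of level n + 1; the edges of the medial
    triangle occur once in each direction and cancel. *)
Lemma triangle_sum_split f n p q r :
  triangle_sum f n.+1 p q r
  = triangle_sum f n p (midpoint p q) (midpoint r p)
  + triangle_sum f n (midpoint p q) q (midpoint q r)
  + triangle_sum f n (midpoint r p) (midpoint q r) r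
  + triangle_sum f n (midpoint p q) (midpoint q r) (midpoint r p).
Proof.
rewrite /triangle_sum /=.
rewrite (dyadic_sumC f n (midpoint p q) (midpoint q r)).
rewrite (dyadic_sumC f n (midpoint q r) (midpoint r p)).
rewrite (dyadic_sumC f n (midpoint r p) (midpoint p q)).
by ring.
Qed.

Lemma triangle_sum_affine a b n p q r :
  triangle_sum (fun z => a + b * z) n p q r = 0.
Proof. by rewrite /triangle_sum !dyadic_sum_affine; field. Qed.

Lemma triangle_sumD f g n p q r :
  triangle_sum (fun z => f z + g z) n p q r
  = triangle_sum f n p q r + triangle_sum g n p q r.
Proof. by rewrite /triangle_sum !dyadic_sumD; ring. Qed.

Lemma triangle_sum_bound K f n p q r M : midconvex K -> K p -> K q -> K r ->
  (forall z, K z -> `|f z| <= M) ->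
  `|triangle_sum f n p q r| <= M * (`|q - p| + `|r - q| + `|p - r|).
Proof.
move=> Kc Kp Kq Kr fM; rewrite !mulrDr.
apply: le_trans (ler_normD _ _) _; apply: lerD; last exact: dyadic_sum_bound fM.
by apply: le_trans (ler_normD _ _) _; apply: lerD; apply: dyadic_sum_bound fM.
Qed.

End DyadicIntegral.

Section ComplexLimits.
Variable R : realType.
Local Notation C := (CC R).
Implicit Types z w : C.

Definition Cre z : R := complex.Re z.
Definition Cim z : R := complex.Im z.
Definition Cmk (a b : R) : C := Complex a b.

Lemma CreD z w : Cre (z + w) = Cre z + Cre w.
Proof. by case: z w => [a b] [c d]. Qed.
Lemma CimD z w : Cim (z + w) = Cim z + Cim w.
Proof. by case: z w => [a b] [c d]. Qed.
Lemma CreN z : Cre (- z) = - Cre z. Proof. by case: z. Qed.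
Lemma CimN z : Cim (- z) = - Cim z. Proof. by case: z. Qed.
Lemma CreM z w : Cre (z * w) = Cre z * Cre w - Cim z * Cim w.
Proof. by case: z w => [a b] [c d]. Qed.
Lemma CimM z w : Cim (z * w) = Cre z * Cim w + Cim z * Cre w.
Proof. by case: z w => [a b] [c d]. Qed.
Lemma Cext z w : Cre z = Cre w -> Cim z = Cim w -> z = w.
Proof. by case: z w => [a b] [c d] /= -> ->. Qed.

Lemma CleE z w : (z <= w) = (Cim w == Cim z) && (Cre z <= Cre w).
Proof. exact: lecE. Qed.

Lemma CnormE z : `|z| = Cmk (Num.sqrt (Cre z ^+ 2 + Cim z ^+ 2)) 0.
Proof. exact: normc_def. Qed.

Lemma Cnorm_ler z (a : R) :
  (`|z| <= Cmk a 0) = (Num.sqrt (Cre z ^+ 2 + Cim z ^+ 2) <= a).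
Proof. by rewrite CnormE CleE /Cre /Cim /= eqxx. Qed.

Lemma Cre_le z w : z <= w -> Cre z <= Cre w.
Proof. by rewrite CleE => /andP[]. Qed.

Lemma Cre_lt z w : z < w -> Cre z < Cre w.
Proof.
rewrite lt_def CleE => /andP[/eqP wz /andP[/eqP i r]].
by rewrite lt_def r andbT; apply/eqP => e; apply: wz; apply: Cext.
Qed.

Lemma Cmk_gt0 (a : R) : 0 < a -> 0 < Cmk a 0.
Proof.
move=> a0; rewrite lt_def; apply/andP; split.
  by apply/eqP => -[ee]; rewrite ee ltxx in a0.
by rewrite CleE; apply/andP; split; [exact/eqP | exact: ltW].
Qed.

Lemma Cge0E z : 0 <= z -> z = Cmk (Cre z) 0.
Proof. by rewrite CleE => /andP[/eqP h _]; apply: Cext. Qed.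

Lemma Cre_norm z : `|Cre z| <= Cre `|z|.
Proof.
rewrite CnormE /= -sqrtr_sqr; apply: ler_wsqrtr.
by rewrite lerDl sqr_ge0.
Qed.

Lemma Cim_norm z : `|Cim z| <= Cre `|z|.
Proof.
rewrite CnormE /= -sqrtr_sqr; apply: ler_wsqrtr.
by rewrite lerDr sqr_ge0.
Qed.

Lemma Cnorm_le z (a : R) : `|Cre z| + `|Cim z| <= a -> `|z| <= Cmk a 0.
Proof.
move=> h; rewrite Cnorm_ler; apply: le_trans h.
rewrite -[leRHS]ger0_norm ?addr_ge0 // -sqrtr_sqr; apply: ler_wsqrtr.
rewrite -(real_normK (num_real (Cre z))) -(real_normK (num_real (Cim z))).
by rewrite sqrrD lerD2r lerDl mulrn_wge0 // mulr_ge0.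
Qed.

(** The intervals of centre u k and radius 2 d / 2 ^ k are nested, since the radius shrinks by d / 2
    ^ k at step k. The limit is the supremum of their left ends. *)
Lemma geometric_cauchy_real (u : nat -> R) d :
  (forall k, `|u k.+1 - u k| <= d / 2 ^+ k) ->
  exists l, forall k, `|u k - l| <= 2 * d / 2 ^+ k.
Proof.
move=> hu; pose t k : R := 2 * d / 2 ^+ k.
have tS k : t k = t k.+1 + d / 2 ^+ k.
  by rewrite /t exprS; field; rewrite expf_neq0.
have am : {homo (fun k => u k - t k) : i j / (i <= j)%N >-> i <= j}.
  apply: homo_leq => [||k]; [exact: lexx | exact: le_trans |].
  by have /ler_normlP[] := hu k; rewrite (tS k); lra.
have bm : {homo (fun k => u k + t k) : i j / (i <= j)%N >-> j <= i}.
  apply: homo_leq => [||k]; [exact: lexx | by move=> y x z xy yz; apply: le_trans yz xy |].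
  by have /ler_normlP[] := hu k; rewrite (tS k); lra.
have t0 k : 0 <= t k.
  have d0 : 0 <= d by apply: le_trans (normr_ge0 _) _; apply: le_trans (hu 0%N) _; rewrite expr0 divr1.
  by rewrite /t !mulr_ge0 // invr_ge0 exprn_ge0.
have ab i j : u i - t i <= u j + t j.
  apply: le_trans (am i (maxn i j) (leq_maxl _ _)) _.
  apply: le_trans (bm j (maxn i j) (leq_maxr _ _)).
  by have := t0 (maxn i j); lra.
have S0 : has_sup (range (fun k => u k - t k)).
  split; first by exists (u 0%N - t 0%N), 0%N.
  by exists (u 0%N + t 0%N) => _ [i _ <-].
exists (sup (range (fun k => u k - t k))) => k.
have h1 : u k - t k <= sup (range (fun k => u k - t k)).
  by apply: (ub_le_sup S0.2); exists k.
have h2 : sup (range (fun k => u k - t k)) <= u k + t k.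
  by apply: ge_sup; [exact: S0.1 | move=> _ [i _ <-]].
rewrite -/(t k); apply/ler_normlP; split; lra.
Qed.

(** The constant 4 is 2 + 2, one contribution from the real part and one from the imaginary part.
    The hypothesis at k = 0 forces d to be a nonnegative real. *)
Lemma geometric_cauchy (u : nat -> C) (d : C) :
  (forall k, `|u k.+1 - u k| <= d / 2 ^+ k) ->
  exists l, forall k, `|u k - l| <= 4 * d / 2 ^+ k.
Proof.
move=> hu.
have d0 : 0 <= d by apply: le_trans (normr_ge0 _) _; apply: le_trans (hu 0%N) _; rewrite expr0 divr1.
have two k : (2 ^+ k : C)^-1 = Cmk (2 ^- k) 0.
  have E j : Cmk 2 0 ^+ j = Cmk (2 ^+ j) 0.
    elim: j => [|j IH] //; rewrite !exprS IH.
    by apply: Cext; rewrite /Cre /Cim /=; ring.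
  have -> : (2 : C) = Cmk 2 0 by apply: Cext; rewrite /Cre /Cim /= ?addr0.
  apply: (mulfI (x := Cmk 2 0 ^+ k)).
    by rewrite expf_neq0 //; apply/eqP => /(congr1 Cre); rewrite /Cre /=; lra.
  rewrite divff; last first.
    by rewrite expf_neq0 //; apply/eqP => /(congr1 Cre); rewrite /Cre /=; lra.
  rewrite E; apply: Cext; rewrite /Cre /Cim /=; last by ring.
  by rewrite mulr0 subr0 divff // expf_neq0.
have dk a k : a * d / 2 ^+ k = Cmk (Cre a * Cre d / 2 ^+ k) (Cim a * Cre d / 2 ^+ k).
  rewrite two (Cge0E d0) /Cmk; apply: Cext; rewrite !(CreM, CimM) /Cre /Cim /=.
    by rewrite !mulr0 !subr0.
  by rewrite !mulr0 !add0r.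
have hR k : `|Cre (u k.+1) - Cre (u k)| <= Cre d / 2 ^+ k.
  rewrite -CreN -CreD; apply: le_trans (Cre_norm _) _.
  have := hu k; rewrite -[d in X in X -> _]mul1r dk CleE => /andP[_ h].
  by apply: le_trans h _; rewrite /Cre /= mul1r.
have hI k : `|Cim (u k.+1) - Cim (u k)| <= Cre d / 2 ^+ k.
  rewrite -CimN -CimD; apply: le_trans (Cim_norm _) _.
  have := hu k; rewrite -[d in X in X -> _]mul1r dk CleE => /andP[_ h].
  by apply: le_trans h _; rewrite /Cre /= mul1r.
have [x hx] := geometric_cauchy_real hR.
have [y hy] := geometric_cauchy_real hI.
exists (Cmk x y) => k; rewrite dk.
have -> : Cim 4 = 0 by rewrite /Cim /= !addr0.
rewrite !mul0r; apply: Cnorm_le.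
rewrite CreD CimD CreN CimN; apply: le_trans (lerD (hx k) (hy k)) _.
have -> : Cre 4 = 4 by rewrite /Cre /=; ring.
by rewrite -mulrDl; apply: ler_wpM2r; [rewrite invr_ge0 exprn_ge0 | lra].
Qed.

Lemma Cnat k : k%:R = Cmk k%:R 0 :> C.
Proof.
elim: k => [|k IH]; first exact: Cext.
by rewrite !mulrS IH; apply: Cext; rewrite /Cre /Cim /= ?addr0.
Qed.

Lemma Cre_natV k : Cre k.+1%:R^-1 = k.+1%:R^-1.
Proof.
have : Cre (k.+1%:R * k.+1%:R^-1) = 1 by rewrite divff ?pnatr_eq0.
rewrite CreM Cnat [Cre (Cmk _ _)]/Cre [Cim (Cmk _ _)]/Cim /= mul0r subr0 => h.
by apply: (mulfI (x := k.+1%:R)); rewrite ?pnatr_eq0 // h divff ?pnatr_eq0.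
Qed.

Lemma natV_le_norm k z : (k.+1%:R^-1 <= `|z|) = (k.+1%:R^-1 <= Cre `|z|).
Proof.
rewrite CleE Cre_natV.
by rewrite [in X in X && _](Cge0E (normr_ge0 z)) [in X in X && _](@Cge0E k.+1%:R^-1) ?invr_ge0 // eqxx.
Qed.

(** By the Archimedean property a < d k for some k, and k < 2 ^ k. *)
Lemma geometric_small (a d : C) : 0 <= a -> 0 < d ->
  exists k0, forall k, (k0 <= k)%N -> a / 2 ^+ k < d.
Proof.
move=> a0 d0.
have Cd : 0 < Cre d by apply: Cre_lt d0.
have [k hk] : exists k : nat, Cre a < Cre d * k%:R.
  exists (Num.bound (Cre a / Cre d)).
  rewrite mulrC -ltr_pdivrMr //; apply: archi_boundP.
  by move: a0; rewrite CleE => /andP[_ a0]; rewrite divr_ge0 // ltW.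
exists k => k' kk'; apply: (@le_lt_trans _ _ (a / 2 ^+ k)).
  by rewrite ler_wpM2l // lef_pV2 ?posrE ?exprn_gt0 // ler_weXn2l ?ler1n.
rewrite ltr_pdivrMr ?exprn_gt0 //.
apply: (@lt_le_trans _ _ (d * k%:R)); last first.
  by rewrite ler_pM2l // -natrX ler_nat ltnW // ltn_expl.
rewrite (Cge0E a0) (Cge0E (ltW d0)) Cnat lt_def CleE !CreM !CimM /Cre /Cim /=.
rewrite !(mul0r, mulr0, addr0, subr0) eqxx ltW // !andbT.
by apply/eqP => -[e]; move: hk; rewrite /Cre => hk; lra.
Qed.

End ComplexLimits.

Section Epsilon.
Variable R : realType.
Local Notation C := (CC R).
Implicit Types (z w a : C) (f g : C -> C).

Lemma near_dnbhs_ball (P : C -> Prop) a :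
  (\forall z \near a^', P z)
  <-> exists2 d : C, 0 < d & forall z, `|z - a| < d -> z != a -> P z.
Proof.
split=> [/nbhs_ballP[d /= d0 h]|[d d0 h]].
  by exists d => // z zd; apply: h; rewrite /ball /= distrC.
by apply/nbhs_ballP; exists d => // z; rewrite /ball /= distrC => /h.
Qed.

Lemma near_nbhs_ball (P : C -> Prop) a :
  (\forall z \near a, P z)
  <-> exists2 d : C, 0 < d & forall z, `|z - a| < d -> P z.
Proof.
split=> [/nbhs_ballP[d /= d0 h]|[d d0 h]].
  by exists d => // z zd; apply: h; rewrite /ball /= distrC.
by apply/nbhs_ballP; exists d => // z; rewrite /ball /= distrC => /h.
Qed.

Lemma Ccvg_distP (T : Type) (F : set_system T) (FF : Filter F) (f : T -> C) l :
  f x @[x --> F] --> l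
  <-> forall e : C, 0 < e -> \forall x \near F, `|l - f x| <= e.
Proof.
exact: (cvgrPdist_le (V := CC R : pseudoMetricNormedZmodType (CC R))).
Qed.

(** Multiplying the difference quotient by z - a gives an inequality that is trivially true at z =
    a, so no punctured neighbourhood remains. *)
Lemma derivable_epsP f a : derivable f a 1 <->
  exists l, forall e, 0 < e -> exists2 d, 0 < d &
    forall z, `|z - a| < d -> `|f z - f a - l * (z - a)| <= e * `|z - a|.
Proof.
split.
  move=> /cvg_ex[/= l /Ccvg_distP hl]; exists l => e e0.
  have /near_dnbhs_ball[d d0 hd] := hl e e0; exists d => // z zd.
  have [->|za] := eqVneq z a; first by rewrite !subrr mulr0 subrr normr0 mulr0.
  have z0 : z - a != 0 by rewrite subr_eq0.
  have := hd (z - a); rewrite subr0 => /(_ zd z0).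
  rewrite -[(z - a) *: 1]/((z - a) * 1) mulr1 subrK.
  rewrite -[_ *: _]/((z - a)^-1 * (f z - f a)) => h.
  have -> : f z - f a - l * (z - a)
      = - ((l - (z - a)^-1 * (f z - f a)) * (z - a)).
    by field.
  by rewrite normrN normrM ler_wpM2r.
case=> l hl; apply/cvg_ex; exists l; apply/Ccvg_distP => e e0.
have [d d0 hd] := hl e e0; apply/near_dnbhs_ball; exists d => // h.
rewrite subr0 => hh h0.
have := hd (h + a); rewrite addrK => /(_ hh) {}hd.
rewrite -[h *: 1]/(h * 1) mulr1 -[_ *: _]/(h^-1 * (f (h + a) - f a)).
have -> : l - h^-1 * (f (h + a) - f a)
   = - (h^-1 * (f (h + a) - f a - l * h)) by field.
rewrite normrN normrM normfV ler_pdivrMl ?normr_gt0 //.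
by rewrite [leRHS]mulrC.
Qed.

Lemma CderivableD f g z : derivable f z 1 -> derivable g z 1 ->
  derivable (fun y => f y + g y) z 1.
Proof. move=> df dg. exact: (derivableD df dg). Qed.
Lemma CderivableB f g z : derivable f z 1 -> derivable g z 1 ->
  derivable (fun y => f y - g y) z 1.
Proof. move=> df dg. exact: (derivableB df dg). Qed.
Lemma CderivableM f g z : derivable f z 1 -> derivable g z 1 ->
  derivable (fun y => f y * g y) z 1.
Proof. move=> df dg. exact: (derivableM df dg). Qed.
Lemma CderivableV f z : f z != 0 -> derivable f z 1 ->
  derivable (fun y => (f y)^-1) z 1.
Proof. move=> df dg. exact: (derivableV df dg). Qed.
Lemma Cderivable_cst c z : derivable (fun _ : C => c : C) z 1.
Proof. exact: (@derivable_cst (CC R) (CC R) (CC R) c z 1). Qed.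
Lemma Cderivable_id z : derivable (fun y : C => y) z 1.
Proof. exact: (@derivable_id (CC R) (CC R) z 1). Qed.

End Epsilon.

Section Goursat.
Variable R : realType.
Local Notation C := (CC R).
Implicit Types (z w p q r e d : C) (K : set C) (f : C -> C).

Definition adherent K z := forall e, 0 < e -> exists2 y, K y & `|y - z| <= e.

(** Applied to sums indexed by their subdivision level, this replaces the statement that an integral
    has modulus at most e, without any limit being taken. *)
Definition eventually_small (u : nat -> C) e :=
  exists n0, forall n, (n0 <= n)%N -> `|u n| <= e.

Definition triangle := (C * C * C)%type.
Definition tsum f n (t : triangle) := triangle_sum f n t.1.1 t.1.2 t.2.

Definition subtriangles (t : triangle) : seq triangle :=
  let: (p, q, r) := t in
  [:: (p, midpoint p q, midpoint r p); (midpoint p q, q, midpoint q r);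
      (midpoint r p, midpoint q r, r);
      (midpoint p q, midpoint q r, midpoint r p)].

Definition triangle_in K (t : triangle) := [/\ K t.1.1, K t.1.2 & K t.2].
Definition triangle_diam_le d (t : triangle) :=
  [/\ `|t.1.2 - t.1.1| <= d, `|t.2 - t.1.2| <= d & `|t.1.1 - t.2| <= d].

Lemma subtriangles_in K t t' : midconvex K -> triangle_in K t ->
  t' \in subtriangles t -> triangle_in K t'.
Proof.
case: t => [[p q] r] Kc [/= Kp Kq Kr]; rewrite !inE.
by case/or4P => /eqP ->; split => //=; apply: Kc.
Qed.

Lemma subtriangles_diam d t t' : triangle_diam_le d t -> t' \in subtriangles t ->
  triangle_diam_le (d / 2) t' /\ `|t'.1.1 - t.1.1| <= d / 2.
Proof.
case: t => [[p q] r] [/= hp hq hr].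
have h2 z : `|z| <= d -> `|2^-1 * z| <= d / 2.
  by move=> h; rewrite normrM normfV normr_nat mulrC ler_wpM2r // invr_ge0.
have h2' z w : w = 2^-1 * z -> `|z| <= d -> `|w| <= d / 2.
  by move=> -> /h2.
have n1 : `|p - q| <= d by rewrite distrC.
have n2 : `|q - r| <= d by rewrite distrC.
have n3 : `|r - p| <= d by rewrite distrC.
have d0 : `|0 : C| <= d by rewrite normr0; apply: le_trans hp.
rewrite !inE; case/or4P => /eqP -> /=; (split; first split => /=).
- by apply: (h2' (q - p)) => //; rewrite /midpoint; field.
- by apply: (h2' (r - q)) => //; rewrite /midpoint; field.
- by apply: (h2' (p - r)) => //; rewrite /midpoint; field.
- by apply: (h2' 0) => //; rewrite subrr mulr0.
- by apply: (h2' (q - p)) => //; rewrite /midpoint; field.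
- by apply: (h2' (r - q)) => //; rewrite /midpoint; field.
- by apply: (h2' (p - r)) => //; rewrite /midpoint; field.
- by apply: (h2' (q - p)) => //; rewrite /midpoint; field.
- by apply: (h2' (q - p)) => //; rewrite /midpoint; field.
- by apply: (h2' (r - q)) => //; rewrite /midpoint; field.
- by apply: (h2' (p - r)) => //; rewrite /midpoint; field.
- by apply: (h2' (r - p)) => //; rewrite /midpoint; field.
- by apply: (h2' (r - p)) => //; rewrite /midpoint; field.
- by apply: (h2' (p - q)) => //; rewrite /midpoint; field.
- by apply: (h2' (q - r)) => //; rewrite /midpoint; field.
- by apply: (h2' (q - p)) => //; rewrite /midpoint; field.
Qed.

Lemma tsum_split f n t :
  tsum f n.+1 t = \sum_(t' <- subtriangles t) tsum f n t'.
Proof.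
case: t => [[p q] r].
by rewrite /tsum triangle_sum_split !big_cons big_nil addr0 !addrA.
Qed.

Lemma eventually_small_split f t e :
  (forall t', t' \in subtriangles t -> eventually_small (tsum f ^~ t') (e / 4)) ->
  eventually_small (tsum f ^~ t) e.
Proof.
case: t => [[p q] r] h.
have [n1 h1] := h _ (mem_nth (p, q, r) (isT : 0 < size (subtriangles (p, q, r)))%N).
have [n2 h2] := h _ (mem_nth (p, q, r) (isT : 1 < size (subtriangles (p, q, r)))%N).
have [n3 h3] := h _ (mem_nth (p, q, r) (isT : 2 < size (subtriangles (p, q, r)))%N).
have [n4 h4] := h _ (mem_nth (p, q, r) (isT : 3 < size (subtriangles (p, q, r)))%N).
exists (n1 + n2 + n3 + n4).+1 => -[//|n] hn.
rewrite tsum_split !big_cons big_nil addr0.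
have -> : e = e / 4 + (e / 4 + (e / 4 + e / 4)) by field.
apply: le_trans (ler_normD _ _) (lerD _ _); first by apply: h1; move: hn; clear; lia.
apply: le_trans (ler_normD _ _) (lerD _ _); first by apply: h2; move: hn; clear; lia.
apply: le_trans (ler_normD _ _) (lerD _ _); first by apply: h3; move: hn; clear; lia.
by apply: h4; move: hn; clear; lia.
Qed.

Lemma midconvex_ball z d : midconvex [set y | `|y - z| <= d].
Proof.
move=> p q /= hp hq.
have -> : midpoint p q - z = 2^-1 * ((p - z) + (q - z)).
  by rewrite /midpoint; field.
rewrite normrM normfV normr_nat ler_pdivrMl // mulr_natl mulr2n.
exact: le_trans (ler_normD _ _) (lerD hp hq).
Qed.

Lemma midconvexI K K' : midconvex K -> midconvex K' -> midconvex (K `&` K').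
Proof. by move=> h h' p q [? ?] [? ?]; split; [apply: h|apply: h']. Qed.

(** If t is bad for e, one of its four subtriangles is bad for e / 4, and so on; the nested bad
    triangles shrink to a point of K, where the linear approximation of f contradicts badness. *)
Theorem goursat K f t e : midconvex K -> (forall z, adherent K z -> K z) ->
  (forall z, K z -> derivable f z 1) -> triangle_in K t -> 0 < e ->
  eventually_small (tsum f ^~ t) e.
Proof.
move=> Kc Kcl fK tK e0; apply: contrapT => bad0.
pose D := `|t.1.2 - t.1.1| + `|t.2 - t.1.2| + `|t.1.1 - t.2|.
pose bad n (t : triangle) := ~ eventually_small (tsum f ^~ t) (e / 4 ^+ n).
have step n t' : bad n t' -> exists2 t'', t'' \in subtriangles t' & bad n.+1 t''.
  move=> hb; apply: contrapT => hn; apply: hb; apply: eventually_small_split.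
  move=> t'' ht''; apply: contrapT => hb; apply: hn; exists t'' => //.
  by rewrite /bad exprSr invfM mulrA.
pose nxt n t' := if pselect (bad n t') is left h then projT1 (cid2 (step n t' h)) else t'.
pose T := fix T n := if n is n'.+1 then nxt n' (T n') else t.
have Tbad n : bad n (T n).
  elim: n => [|n IH] /=; first by rewrite /bad expr0 divr1.
  by rewrite /nxt; case: pselect => // h; case: cid2.
have Tsub n : T n.+1 \in subtriangles (T n).
  by rewrite /= /nxt; case: pselect => [h|/(_ (Tbad n))//]; case: cid2.
have TK n : triangle_in K (T n).
  by elim: n => // n IH; apply: subtriangles_in (Tsub n).
have Td n : triangle_diam_le (D / 2 ^+ n) (T n).
  elim: n => [|n IH].
    by rewrite expr0 divr1; split; rewrite /D ?lerDr ?lerDl ?addr_ge0 //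
      -?addrA ?lerDl ?addr_ge0 // addrCA lerDl addr_ge0.
  have [+ _] := subtriangles_diam IH (Tsub n).
  by rewrite exprSr invfM mulrA.
have [z hz] : exists z, forall k, `|(T k).1.1 - z| <= 4 * D / 2 ^+ k.
  apply: geometric_cauchy => k.
  have [_ h] := subtriangles_diam (Td k) (Tsub k).
  apply: le_trans h _; rewrite ler_pdivrMr // ler_peMr ?ler1n //.
  by rewrite mulr_ge0 ?invr_ge0 ?exprn_ge0 // /D !addr_ge0.
have D0 : 0 <= D by rewrite /D !addr_ge0.
(* 5 = 4 + 1: the first vertex of [T k] is within 4 D / 2 ^ k of z, and the sides are at most D / 2
   ^ k. *)
have small d : 0 < d -> exists k, 5 * D / 2 ^+ k < d.
  move=> d0; have [|k0 hk] := @geometric_small R (5 * D) d _ d0.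
    by rewrite mulr_ge0.
  by exists k0; apply: hk.
have Kz : K z.
  apply: Kcl => d d0; have [k hk] := small d d0; exists (T k).1.1.
    by have [] := TK k.
  apply: le_trans (hz k) _; apply: le_trans (ltW hk).
  by rewrite ler_wpM2r ?invr_ge0 ?exprn_ge0 // ler_wpM2r // ler_nat.
have /derivable_epsP[l hl] := fK z Kz.
(* 15 is 5 times 3, the distance to z times the perimeter, in units of D / 2 ^ k; adding 1 keeps the
   denominator positive when D = 0. *)
pose e1 := e / (15 * (D * D) + 1).
have e10 : 0 < e1 by rewrite divr_gt0 // ltr_wpDl // !mulr_ge0.
have [d d0 hd] := hl e1 e10.
have [k hk] := small d d0.
(* The estimate below holds at every level n, so the threshold is 0. *)
apply: (Tbad k); exists 0%N => n _.
pose B := K `&` [set y | `|y - z| <= 5 * D / 2 ^+ k].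
pose g y := f y - f z - l * (y - z).
have Bc : midconvex B by apply: midconvexI => //; apply: midconvex_ball.
have TB : triangle_in B (T k).
  have [h1 h2 h3] := Td k; have [k1 k2 k3] := TK k.
  have E : 5 * D / 2 ^+ k = D / 2 ^+ k + 4 * D / 2 ^+ k by ring.
  have P : 0 <= D / 2 ^+ k by rewrite mulr_ge0 ?invr_ge0 ?exprn_ge0.
  split; split => //=; rewrite E.
  - by rewrite -[leLHS]add0r lerD.
  - by rewrite -(subrK (T k).1.1 (T k).1.2) -addrA (le_trans (ler_normD _ _)) // lerD.
  - by rewrite -(subrK (T k).1.1 (T k).2) -addrA (le_trans (ler_normD _ _)) // lerD // distrC.
have gB y : B y -> `|g y| <= e1 * (5 * D / 2 ^+ k).
  move=> [_ /= hy]; apply: le_trans (hd _ (le_lt_trans hy hk)) _.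
  by rewrite ler_wpM2l // ltW.
(* f and its remainder g differ by an affine function, whose triangle sums are 0 at every level. *)
have -> : tsum f n (T k) = tsum g n (T k).
  have fE y : f y = g y + ((f z - l * z) + l * y) by rewrite /g; ring.
  rewrite /tsum -[RHS]addr0.
  rewrite -(triangle_sum_affine (f z - l * z) l n (T k).1.1 (T k).1.2 (T k).2).
  rewrite -triangle_sumD; congr (triangle_sum _ _ _ _ _).
  by apply/funext => y; apply: fE.
have [b1 b2 b3] := TB; have [h1 h2 h3] := Td k.
apply: le_trans (triangle_sum_bound n Bc b1 b2 b3 gB) _.
apply: (@le_trans _ _ (e1 * (5 * D / 2 ^+ k) * (3 * D / 2 ^+ k))).
  apply: ler_wpM2l.
    by apply: mulr_ge0; [exact: ltW | rewrite !mulr_ge0 ?invr_ge0 ?exprn_ge0].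
  apply: (@le_trans _ _ (D / 2 ^+ k + D / 2 ^+ k + D / 2 ^+ k)).
    by rewrite !lerD.
  by rewrite le_eqVlt; apply/orP; left; apply/eqP; ring.
have -> : e1 * (5 * D / 2 ^+ k) * (3 * D / 2 ^+ k) = e1 * (15 * (D * D)) / 4 ^+ k.
  have -> : (4 : C) = 2 * 2 by rewrite -natrM.
  by rewrite exprMn; field; rewrite expf_neq0.
rewrite ler_wpM2r ?invr_ge0 ?exprn_ge0 // /e1 mulrAC.
have X0 : 0 < 15 * (D * D) + 1 by rewrite ltr_wpDl // !mulr_ge0.
by rewrite ler_pdivrMr // ler_wpM2l ?lerDl // ltW.
Qed.

End Goursat.

(** * Cauchy's formula and division *)

Section BanachLimit.
Variable R : realType.
Local Notation C := (CC R).

Definition bounded_seq (u : nat -> C) := exists M : C, forall n, `|u n| <= M.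

(** A bounded sequence converges along an ultrafilter because [-M, M] is compact. The ultrafilter
    refines \oo, so lower bounds that hold eventually pass to the limit. *)
Lemma banach_limit_real : exists L : (nat -> R) -> R,
  [/\ forall u v a b M, (forall n, `|u n| <= M) -> (forall n, `|v n| <= M) ->
        L (fun n => a * u n + b * v n) = a * L u + b * L v
    & forall u M, (forall n, `|u n| <= M) ->
        forall x, (exists n0, forall n, (n0 <= n)%N -> x <= u n) -> x <= L u].
Proof.
have [G [GU sG]] := @ultraFilterLemma nat \oo _.
exists (fun u => lim (u @ G)).
have Gcv (u : nat -> R) M : (forall n, `|u n| <= M) -> cvg (u @ G).
  move=> uM; have uA : (u @ G) [set` `[- M, M]].
    by change (G (u @^-1` [set` `[- M, M]])); apply: filterE => n /=; rewrite in_itv /= -ler_norml.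
  have [l [_ ul]] := segment_compact (fmap_proper_filter u _) uA.
  apply/cvg_ex; exists l => B lB.
  have [//|GB] := in_ultra_setVsetC (u @^-1` B) GU.
  by have [x []] := ul (~` B) B GB lB.
split=> [u v a b M uM vM | u M uM x [n0 hx]].
  apply: cvg_lim => //; apply: cvgD; apply: cvgM;
    [exact: cvg_cst | exact: Gcv uM | exact: cvg_cst | exact: Gcv vM].
apply: limr_ge; first exact: Gcv uM.
by apply: sG; exists n0.
Qed.

(** Real and imaginary parts are treated separately, whence the factor 2 in the bound. The last
    clause serves to show that the functional does not vanish on 1 / z. *)
Lemma banach_limit : exists L : (nat -> C) -> C,
  [/\ forall u v a b, bounded_seq u -> bounded_seq v ->
        L (fun n => a * u n + b * v n) = a * L u + b * L v,
      forall u M, (forall n, `|u n| <= M) -> `|L u| <= 2 * M,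
      forall u, (forall e, 0 < e -> eventually_small u e) -> bounded_seq u ->
        L u = 0
    & forall u x, bounded_seq u -> (forall n, x <= Cim (u n)) -> x <= Cim (L u)].
Proof.
have [L [Llin Lge]] := banach_limit_real.
have bRe (u : nat -> C) (M : C) : (forall n, `|u n| <= M) -> forall n, `|Cre (u n)| <= Cre M.
  move=> h n; apply: le_trans (Cre_norm _) _.
  exact: Cre_le (h n).
have bIm (u : nat -> C) (M : C) : (forall n, `|u n| <= M) -> forall n, `|Cim (u n)| <= Cre M.
  move=> h n; apply: le_trans (Cim_norm _) _.
  exact: Cre_le (h n).
have LN u M : (forall n, `|u n| <= M) -> L (fun n => - u n) = - L u.
  move=> h; have := Llin u u (-1) 0 M h h.
  by rewrite mul0r addr0 mulN1r => <-; congr L; apply/funext => n; ring.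
have Labs u M N : (forall n, `|u n| <= M) ->
    (exists n0, forall n, (n0 <= n)%N -> `|u n| <= N) -> `|L u| <= N.
  move=> h [n0 hN]; have hn n : `|- u n| <= M by rewrite normrN.
  rewrite ler_norml; apply/andP; split.
    by apply: Lge h _ _; exists n0 => n /hN; rewrite ler_norml => /andP[].
  rewrite -[L u]opprK lerNl -(LN _ _ h); apply: Lge hn _ _.
  by exists n0 => n /hN; rewrite ler_norml lerN2 => /andP[].
exists (fun u => Cmk (L (@Cre R \o u)) (L (@Cim R \o u))); split.
- move=> u v a b [M1 h1] [M2 h2].
  pose M := Num.max (Cre M1) (Cre M2).
  have uR n : `|Cre (u n)| <= M by rewrite le_max (bRe u M1).
  have uI n : `|Cim (u n)| <= M by rewrite le_max (bIm u M1).
  have vR n : `|Cre (v n)| <= M by rewrite le_max (bRe v M2) ?orbT.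
  have vI n : `|Cim (v n)| <= M by rewrite le_max (bIm v M2) ?orbT.
  have bL (x y : nat -> R) s t : (forall n, `|x n| <= M) -> (forall n, `|y n| <= M) ->
      forall n, `|s * x n + t * y n| <= (`|s| + `|t|) * M.
    move=> hx hy n; rewrite mulrDl; apply: le_trans (ler_normD _ _) _.
    by rewrite !normrM lerD // ler_wpM2l.
  pose N := Num.max ((`|Cre a| + `|- Cim a|) * M)
     (Num.max ((`|Cre b| + `|- Cim b|) * M)
        (Num.max ((`|Cre a| + `|Cim a|) * M) ((`|Cre b| + `|Cim b|) * M))).
  have L4 (x1 x2 y1 y2 : nat -> R) s1 s2 t1 t2 :
      (forall n, `|x1 n| <= M) -> (forall n, `|x2 n| <= M) ->
      (forall n, `|y1 n| <= M) -> (forall n, `|y2 n| <= M) ->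
      L (fun n => (s1 * x1 n + s2 * x2 n) + (t1 * y1 n + t2 * y2 n))
      = (s1 * L x1 + s2 * L x2) + (t1 * L y1 + t2 * L y2).
    move=> a1 a2 a3 a4.
    pose N' := Num.max ((`|s1| + `|s2|) * M) ((`|t1| + `|t2|) * M).
    rewrite -(Llin _ _ _ _ _ a1 a2) -(Llin _ _ _ _ _ a3 a4).
    have b1 n : `|s1 * x1 n + s2 * x2 n| <= N' by rewrite le_max bL.
    have b2 n : `|t1 * y1 n + t2 * y2 n| <= N' by rewrite le_max bL ?orbT.
    have := Llin _ _ 1 1 _ b1 b2; rewrite !mul1r => <-.
    by congr L; apply/funext => n; rewrite !mul1r.
  apply: Cext.
    rewrite CreD !CreM [LHS]/Cre [Cre (Cmk _ _)]/Cre [Cim (Cmk _ _)]/Cim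
      [Cre (Cmk _ _)]/Cre [Cim (Cmk _ _)]/Cim /=.
    rewrite -!mulNr -L4 //; congr L; apply/funext => n /=.
    by rewrite CreD !CreM !mulNr.
  rewrite CimD !CimM [LHS]/Cim [Cre (Cmk _ _)]/Cre [Cim (Cmk _ _)]/Cim
      [Cre (Cmk _ _)]/Cre [Cim (Cmk _ _)]/Cim /=.
  rewrite -L4 //; congr L; apply/funext => n /=.
  by rewrite CimD !CimM.
- move=> u M h.
  have M0 : 0 <= M by apply: le_trans (h 0%N).
  have -> : 2 * M = Cmk (Cre M + Cre M) 0.
    by rewrite {1}(Cge0E M0) mulr_natl mulr2n; apply: Cext; rewrite /Cre /Cim /= ?addr0.
  apply: Cnorm_le; apply: lerD.
    by apply: Labs (bRe u M h) _; exists 0%N => n _; exact: bRe.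
  by apply: Labs (bIm u M h) _; exists 0%N => n _; exact: bIm.
- move=> u h [M hM].
  have z0 (x : R) : (forall e, 0 < e -> `|x| <= e) -> x = 0.
    move=> hx; apply/eqP; rewrite -normr_le0; apply/ler_addgt0Pr => e e0.
    by rewrite add0r hx.
  apply: Cext; apply: z0 => e e0.
    apply: Labs (bRe u M hM) _; have [n0 h0] := h _ (Cmk_gt0 e0).
    exists n0 => n /h0 /Cre_le h1.
    exact: le_trans (Cre_norm _) h1.
  apply: Labs (bIm u M hM) _; have [n0 h0] := h _ (Cmk_gt0 e0).
  exists n0 => n /h0 /Cre_le h1.
  exact: le_trans (Cim_norm _) h1.
- move=> u x [M hM] h; apply: Lge (bIm u M hM) _ _.
  by exists 0%N => n _; apply: h.
Qed.

End BanachLimit.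

(** * Goursat's theorem for a triangle with one singular vertex *)

Section Wedge.
Variable R : realType.
Local Notation C := (CC R).
Implicit Types (z w p q u e : C) (K : set C) (f g h : C -> C).

(** For s > 0 it excludes w, so that Goursat's theorem applies inside it to functions singular at w.
    With s = 1 and w = 0 it bounds the sides of the square below. *)
Definition half_plane u (s : R) w : set C := [set z | s <= Cre (u * (z - w))].
Definition unit_ball : set C := [set z | `|z| <= 1].

Lemma Cre_half z : Cre (2^-1 * z) = 2^-1 * Cre z.
Proof.
have {2}-> : z = 2^-1 * z + 2^-1 * z by field.
by rewrite CreD; field.
Qed.

Lemma midconvex_half_plane u s w : midconvex (half_plane u s w).
Proof.
move=> p q; rewrite /half_plane /= => hp hq.
have -> : u * (midpoint p q - w)
    = 2^-1 * (u * (p - w)) + 2^-1 * (u * (q - w)).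
  by rewrite /midpoint; field.
by rewrite CreD !Cre_half; lra.
Qed.

Lemma half_plane_closed u s w z :
  adherent (half_plane u s w) z -> half_plane u s w z.
Proof.
rewrite /half_plane /= => ad; rewrite leNgt; apply/negP => hs.
pose r := s - Cre (u * (z - w)).
have r0 : (0 : C) < Cmk r 0 by apply: Cmk_gt0; rewrite /r; lra.
have u0 : 0 < `|u| + 1 by rewrite ltr_wpDl.
have [y /= hy hyz] := ad (Cmk r 0 / (`|u| + 1)) (divr_gt0 r0 u0).
have : `|u * (y - z)| < Cmk r 0.
  rewrite normrM; apply: le_lt_trans (ler_wpM2l (normr_ge0 u) hyz) _.
  by rewrite mulrCA gtr_pMr // ltr_pdivrMr // mul1r ltrDl.
move=> /Cre_lt hr; have := le_trans (ler_norm _) (Cre_norm (u * (y - z))).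
have e : u * (y - w) = u * (y - z) + u * (z - w) by ring.
move: hy; rewrite e CreD; move: hr; rewrite [X in _ < X]/Cre /= /r; lra.
Qed.

Lemma midconvex_unit_ball : midconvex unit_ball.
Proof.
move=> p q hp hq; have := @midconvex_ball R 0 1 p q.
by rewrite /= !subr0; apply.
Qed.

Lemma unit_ball_closed z : adherent unit_ball z -> unit_ball z.
Proof.
rewrite /unit_ball /= => ad; apply: contrapT => /negP.
rewrite real_leNgt ?normr_real ?real1 // negbK => z1.
have e0 : 0 < (`|z| - 1) / 2 by rewrite divr_gt0 // subr_gt0.
have [y /= hy hyz] := ad _ e0.
have : `|z| <= 1 + (`|z| - 1) / 2.
  have {1}-> : z = y - (y - z) by ring.
  exact: le_trans (ler_normB _ _) (lerD hy hyz).
rewrite -subr_ge0 => h.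
have : (`|z| - 1) / 2 <= 0.
  rewrite -oppr_ge0; apply: le_trans h _.
  by rewrite le_eqVlt; apply/orP; left; apply/eqP; field.
by move=> /(lt_le_trans e0); rewrite ltxx.
Qed.

Lemma eventually_small_le (v : nat -> C) e e' :
  e <= e' -> eventually_small v e -> eventually_small v e'.
Proof. by move=> ee [n0 h]; exists n0 => n /h /le_trans; apply. Qed.

(* The only singular vertex is w: bisecting the triangle repeatedly confines w to
   a triangle of arbitrarily small perimeter, on which h is bounded. *)
Lemma wedge_small h w p q u M d e :
  unit_ball w -> unit_ball p -> unit_ball q ->
  (forall z, unit_ball z -> z != w -> derivable h z 1) ->
  0 < d -> (forall z, `|z - w| <= d -> `|h z| <= M) ->
  0 < Cre (u * (p - w)) -> 0 < Cre (u * (q - w)) -> 0 < e ->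
  eventually_small (fun n => triangle_sum h n w p q) e.
Proof.
move=> bw bp bq hd d0 hM up uq e0.
have away s t e1 : 0 < s -> triangle_in (unit_ball `&` half_plane u s w) t -> 0 < e1 ->
    eventually_small (tsum h ^~ t) e1.
  move=> s0 tinK e10; apply: goursat tinK e10.
  - by apply: midconvexI; [exact: midconvex_unit_ball|exact: midconvex_half_plane].
  - move=> z hz; split.
      by apply: unit_ball_closed => x /hz[y [? ?] ?]; exists y.
    by apply: half_plane_closed => x /hz[y [? ?] ?]; exists y.
  - move=> z [bz hz]; apply: hd => //; apply/eqP => zw.
    by move: hz; rewrite /half_plane /= zw subrr mulr0 /Cre /=; lra.
have halves x y : midpoint x y - w = 2^-1 * ((x - w) + (y - w)).
  by rewrite /midpoint; field.
have CreMh x y : Cre (u * (midpoint x y - w))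
    = 2^-1 * (Cre (u * (x - w)) + Cre (u * (y - w))).
  by rewrite halves mulrCA Cre_half mulrDr CreD.
have Crew : Cre (u * (w - w)) = 0 by rewrite subrr mulr0.
(* One bisection: of the four subtriangles only the one at w is singular. The other three lie in a
   half plane away from w and each costs at most (e2 - e1) / 3. *)
have step p' q' e1 e2 : unit_ball p' -> unit_ball q' ->
    0 < Cre (u * (p' - w)) -> 0 < Cre (u * (q' - w)) -> e1 < e2 ->
    eventually_small (fun n => triangle_sum h n w (midpoint w p') (midpoint q' w)) e1 ->
    eventually_small (fun n => triangle_sum h n w p' q') e2.
  move=> bp' bq' up' uq' e12 [n0 h0].
  pose s := Num.min (2^-1 * Cre (u * (p' - w))) (2^-1 * Cre (u * (q' - w))).
  have s0 : 0 < s by rewrite lt_min !mulr_gt0 ?invr_gt0.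
  have sp : s <= 2^-1 * Cre (u * (p' - w)) by rewrite ge_min lexx.
  have sq : s <= 2^-1 * Cre (u * (q' - w)) by rewrite ge_min lexx orbT.
  pose KK := unit_ball `&` half_plane u s w.
  have K1 : KK p' by split => //; rewrite /half_plane /=; lra.
  have K2 : KK q' by split => //; rewrite /half_plane /=; lra.
  have K3 : KK (midpoint w p').
    by split; [exact: midconvex_unit_ball|rewrite /half_plane /= CreMh Crew; lra].
  have K4 : KK (midpoint q' w).
    by split; [exact: midconvex_unit_ball|rewrite /half_plane /= CreMh Crew; lra].
  have K5 : KK (midpoint p' q').
    by split; [exact: midconvex_unit_ball|rewrite /half_plane /= CreMh; lra].
  have e3 : 0 < (e2 - e1) / 3 by rewrite divr_gt0 // subr_gt0.
  have [n1 h1] := away s (midpoint w p', p', midpoint p' q') _ s0 (And3 K3 K1 K5) e3.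
  have [n2 h2] := away s (midpoint q' w, midpoint p' q', q') _ s0 (And3 K4 K5 K2) e3.
  have [n3 h3] := away s (midpoint w p', midpoint p' q', midpoint q' w) _ s0 (And3 K3 K5 K4) e3.
  exists (n0 + n1 + n2 + n3).+1 => -[//|n] hn.
  have -> : e2 = e1 + (e2 - e1) / 3 + (e2 - e1) / 3 + (e2 - e1) / 3 by field.
  rewrite triangle_sum_split.
  apply: le_trans (ler_normD _ _) (lerD _ _); last by apply: h3; move: hn; clear; lia.
  apply: le_trans (ler_normD _ _) (lerD _ _); last by apply: h2; move: hn; clear; lia.
  apply: le_trans (ler_normD _ _) (lerD _ _); last by apply: h1; move: hn; clear; lia.
  by apply: h0; move: hn; clear; lia.
have main k p' q' e1 e2 : unit_ball p' -> unit_ball q' ->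
    0 < Cre (u * (p' - w)) -> 0 < Cre (u * (q' - w)) -> e1 < e2 ->
    eventually_small (fun n => triangle_sum h n w
       (w + (p' - w) / 2 ^+ k) (w + (q' - w) / 2 ^+ k)) e1 ->
    eventually_small (fun n => triangle_sum h n w p' q') e2.
  elim: k p' q' e1 e2 => [|k IH] p' q' e1 e2 bp' bq' up' uq' e12.
    rewrite expr0 !divr1 ![w + _]addrC !subrK; apply: eventually_small_le.
    exact: ltW.
  have -> : w + (p' - w) / 2 ^+ k.+1 = w + (midpoint w p' - w) / 2 ^+ k.
    by rewrite halves exprS invfM; ring.
  have -> : w + (q' - w) / 2 ^+ k.+1 = w + (midpoint q' w - w) / 2 ^+ k.
    by rewrite halves exprS invfM; ring.
  (* Each bisection needs a strict increase of the error, hence the midpoint of e1 and e2. *)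
  move=> h1; apply: (step p' q' ((e1 + e2) / 2)) => //.
    by rewrite ltr_pdivrMr // mulr_natr mulr2n ltrD2r.
  apply: IH h1.
  - exact: midconvex_unit_ball.
  - exact: midconvex_unit_ball.
  - by rewrite CreMh Crew; lra.
  - by rewrite CreMh Crew; lra.
  - by rewrite ltr_pdivlMr // mulr_natr mulr2n ltrD2l.
have M0 : 0 <= M by apply: le_trans (normr_ge0 (h w)) _; apply: hM; rewrite subrr normr0 ltW.
have e20 : 0 < e / 2 by rewrite divr_gt0.
(* The original perimeter is at most 6, three sides of length at most 2 in the unit ball. k1 makes M
   times the shrunken perimeter small, k2 brings the shrunken triangle within d of w. *)
have [k1 hk1] := @geometric_small R (M * 6) (e / 2) (mulr_ge0 M0 (ler0n _ _)) e20.
have [k2 hk2] := @geometric_small R 2 d (ler0n _ _) d0.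
have two x y : unit_ball x -> unit_ball y -> `|x - y| <= 2.
  move=> hx hy; apply: le_trans (ler_normB _ _) _.
  by rewrite -[2]/(1 + 1); apply: lerD.
have p2 x y k : unit_ball x -> unit_ball y -> `|(x - y) / 2 ^+ k| <= 2 / 2 ^+ k.
  move=> hx hy; rewrite normrM normfV normrX normr_nat.
  by apply: ler_wpM2r; [rewrite invr_ge0 exprn_ge0 | exact: two].
pose k := maxn k1 k2.
apply: (main k p q (e / 2)) => //.
  by rewrite ltr_pdivrMr // mulr_natr mulr2n ltrDl.
exists 0%N => n _.
have Bc : midconvex [set y | `|y - w| <= d] by apply: midconvex_ball.
have ww : [set y | `|y - w| <= d] w by rewrite /= subrr normr0 ltW.
have small x : unit_ball x -> [set y | `|y - w| <= d] (w + (x - w) / 2 ^+ k).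
  move=> bx; rewrite /= addrAC subrr add0r; apply: le_trans (p2 _ _ _ bx bw) _.
  by apply: ltW; apply: hk2; rewrite /k leq_maxr.
apply: le_trans (triangle_sum_bound n Bc ww (small p bp) (small q bq) hM) _.
apply: le_trans (ltW (hk1 k _)); last by rewrite /k leq_maxl.
rewrite -mulrA ler_wpM2l //.
have -> : 6 / 2 ^+ k = 2 / 2 ^+ k + 2 / 2 ^+ k + 2 / 2 ^+ k :> C by ring.
apply: lerD; first apply: lerD.
- by rewrite addrAC subrr add0r p2.
- have -> : w + (q - w) / 2 ^+ k - (w + (p - w) / 2 ^+ k) = (q - p) / 2 ^+ k by ring.
  exact: p2.
- have -> : w - (w + (q - w) / 2 ^+ k) = (w - q) / 2 ^+ k by ring.
  exact: p2.
Qed.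

End Wedge.

(** * Contour sums over the square with vertices 1, i, -1, -i *)

Section Contour.
Variable R : realType.
Local Notation C := (CC R).
Implicit Types (z w p q u e B M : C) (K : set C) (f g h : C -> C) (n : nat).

Let I : C := Cmk 0 1.

Definition contour h n := dyadic_sum h n 1 I + dyadic_sum h n I (-1)
  + dyadic_sum h n (-1) (- I) + dyadic_sum h n (- I) 1.

(** Larger than the boundary of the square: it contains everything between the sides and the unit
    circle. Each side then lies in a convex circular segment [edge], on which dyadic sums can be
    bounded and compared. *)
Definition on_square : set C :=
  [set z | unit_ball z /\ 1 <= `|Cre z| + `|Cim z|].

Definition edge u : set C := @unit_ball R `&` half_plane u 1 0.

Definition bounded_on_square h := exists B, forall z, on_square z -> `|h z| <= B.

Lemma midconvex_edge u : midconvex (edge u).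
Proof.
by apply: midconvexI; [exact: midconvex_unit_ball|exact: midconvex_half_plane].
Qed.

Let norm_unit (a b : R) : a ^+ 2 + b ^+ 2 = 1 -> unit_ball (Cmk a b).
Proof.
move=> ab; rewrite /unit_ball /= CnormE /Cre /Cim /= ab sqrtr1.
by rewrite CleE; apply/andP; split.
Qed.

Let ball1 : unit_ball (1 : C).
Proof. by rewrite /unit_ball /= normr1. Qed.
Let ballI : unit_ball I. Proof. by apply: norm_unit; ring. Qed.
Let ballN1 : unit_ball (-1 : C).
Proof. by rewrite /unit_ball /= normrN1. Qed.
Let ballNI : unit_ball (- I).
Proof. by rewrite /unit_ball /= normrN; exact: ballI. Qed.

Lemma edge_on_square (s t : R) z : s ^+ 2 = 1 -> t ^+ 2 = 1 ->
  edge (Cmk s t) z -> on_square z.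
Proof.
move=> s1 t1 [bz]; rewrite /half_plane /= subr0 CreM /= => h; split => //.
have n1 x : x ^+ 2 = 1 :> R -> `|x| = 1.
  by move=> /eqP; rewrite sqrf_eq1 => /orP[] /eqP->; rewrite ?normrN normr1.
apply: le_trans h _; apply: le_trans (ler_norm _) _.
apply: le_trans (ler_normB _ _) _.
by rewrite !normrM /Cre /Cim /= (n1 s s1) (n1 t t1) !mul1r.
Qed.

Lemma edges : [/\ edge (Cmk 1 (-1)) 1 /\ edge (Cmk 1 (-1)) I,
   edge (Cmk (-1) (-1)) I /\ edge (Cmk (-1) (-1)) (-1),
   edge (Cmk (-1) 1) (-1) /\ edge (Cmk (-1) 1) (- I)
 & edge (Cmk 1 1) (- I) /\ edge (Cmk 1 1) 1].
Proof.
have hE u z : half_plane u 1 0 z = (1 <= Cre (u * z)) by rewrite /half_plane /= subr0.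
by split; split; (split=> //); rewrite hE CreM /Cre /Cim /=; lra.
Qed.

Lemma eq_contour h g n : (forall z, on_square z -> h z = g z) ->
  contour h n = contour g n.
Proof.
move=> hg; have [[e1 e2] [e3 e4] [e5 e6] [e7 e8]] := edges.
have ext s t p q : s ^+ 2 = 1 -> t ^+ 2 = 1 -> edge (Cmk s t) p ->
    edge (Cmk s t) q -> dyadic_sum h n p q = dyadic_sum g n p q.
  move=> s1 t1 ep eq_; apply: eq_dyadic_sum (@midconvex_edge _) ep eq_ _ => z ez.
  exact/hg/(edge_on_square s1 t1 ez).
rewrite /contour; congr (_ + _ + _ + _).
- by apply: ext e1 e2; ring.
- by apply: ext e3 e4; ring.
- by apply: ext e5 e6; ring.
- by apply: ext e7 e8; ring.
Qed.

Lemma contour_bound h n B : (forall z, on_square z -> `|h z| <= B) ->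
  `|contour h n| <= 8 * B.
Proof.
move=> hB; have [[e1 e2] [e3 e4] [e5 e6] [e7 e8]] := edges.
have B0 : 0 <= B.
  apply: le_trans (normr_ge0 (h 1)) _; apply: hB.
  by apply: edge_on_square e1; ring.
have ext s t p q : s ^+ 2 = 1 -> t ^+ 2 = 1 -> edge (Cmk s t) p ->
    edge (Cmk s t) q -> `|dyadic_sum h n p q| <= B * 2.
  move=> s1 t1 ep eq_.
  apply: le_trans (dyadic_sum_bound (M := B) n (@midconvex_edge _) ep eq_ _) _.
    by move=> z ez; exact/hB/(edge_on_square s1 t1 ez).
  apply: ler_wpM2l => //; apply: le_trans (ler_normB _ _) _.
  by rewrite -[2]/(1 + 1); apply: lerD; [case: eq_ | case: ep].
have -> : 8 * B = B * 2 + B * 2 + B * 2 + B * 2 by ring.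
apply: le_trans (ler_normD _ _) (lerD _ _); last by apply: ext e7 e8; ring.
apply: le_trans (ler_normD _ _) (lerD _ _); last by apply: ext e5 e6; ring.
apply: le_trans (ler_normD _ _) (lerD _ _); last by apply: ext e3 e4; ring.
by apply: ext e1 e2; ring.
Qed.

Lemma contour_fan h n w : contour h n = triangle_sum h n w 1 I
  + triangle_sum h n w I (-1) + triangle_sum h n w (-1) (- I)
  + triangle_sum h n w (- I) 1.
Proof.
rewrite /contour /triangle_sum (dyadic_sumC h n w 1) (dyadic_sumC h n w I).
by rewrite (dyadic_sumC h n w (-1)) (dyadic_sumC h n w (- I)); ring.
Qed.

(** Multiplication by i permutes the sides and dz / z is invariant under it, so the four sides
    contribute equally. On the side (1 - s) + s i, a piece from s to t with midpoint m contributes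
    imaginary part (t - s) / ((1 - m) ^ 2 + m ^ 2), and this denominator is at most 1. *)
Lemma contour_inv n : 4 <= Cim (contour (fun z => z^-1) n).
Proof.
have I2 : I * I = -1 by apply: Cext; rewrite /Cre /Cim /=; ring.
have I0 : I != 0 by apply/eqP => /(congr1 (@Cim R)); rewrite /Cim /=; lra.
have scl c p q : c != 0 ->
    dyadic_sum (fun z => z^-1) n (c * p) (c * q) = dyadic_sum (fun z => z^-1) n p q.
  move=> c0; rewrite dyadic_sum_scale; congr dyadic_sum; apply/funext => z.
  by rewrite invfM mulrA divff // mul1r.
have -> : contour (fun z => z^-1) n = dyadic_sum (fun z => z^-1) n 1 I
    + dyadic_sum (fun z => z^-1) n 1 I + dyadic_sum (fun z => z^-1) n 1 I
    + dyadic_sum (fun z => z^-1) n 1 I.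
  rewrite /contour; congr (_ + _ + _ + _).
  - by rewrite -(scl I 1 I I0) mulr1 I2.
  - by rewrite -(scl (-1) 1 I) ?oppr_eq0 ?oner_eq0 // mulr1 mulN1r.
  - by rewrite -(scl (- I) 1 I) ?oppr_eq0 // mulr1 mulNr I2 opprK.
rewrite !CimD; suff : 1 <= Cim (dyadic_sum (fun z => z^-1) n 1 I) by lra.
pose P s : C := Cmk (1 - s) s.
have mid s t : midpoint (P s) (P t) = P ((s + t) / 2).
  have -> : P ((s + t) / 2) = 2^-1 * (P s + P t).
    have h2 : P s + P t = P ((s + t) / 2) + P ((s + t) / 2).
      by apply: Cext; rewrite /Cre /Cim /=; field.
    by rewrite h2; field.
  by rewrite /midpoint; field.
have main k s t : 0 <= s -> s <= t -> t <= 1 ->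
    t - s <= Cim (dyadic_sum (fun z => z^-1) k (P s) (P t)).
  elim: k s t => [|k IH] s t s0 st t1; last first.
    rewrite -[dyadic_sum _ _ _ _]/(dyadic_sum _ k _ (midpoint _ _) + dyadic_sum _ k _ _) mid.
    have := IH s ((s + t) / 2); have := IH ((s + t) / 2) t; rewrite CimD; lra.
  rewrite -[dyadic_sum _ _ _ _]/((P t - P s) * (midpoint (P s) (P t))^-1) mid.
  set m := (s + t) / 2; have m0 : 0 <= m by rewrite /m; lra.
  have m1 : m <= 1 by rewrite /m; lra.
  have E : (P m)^-1 = Cmk ((1 - m) / ((1 - m) ^+ 2 + m ^+ 2))
     (- m / ((1 - m) ^+ 2 + m ^+ 2)).
    by apply: Cext; rewrite /Cre /Cim /= ?mulNr.
  have D0 : 0 < (1 - m) ^+ 2 + m ^+ 2 by nra.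
  rewrite E CimM CreD CimD CreN CimN /Cre /Cim /=.
  set D := _ + m ^+ 2 in D0 *.
  have -> : (1 - t - (1 - s)) * (- m / D) + (t - s) * ((1 - m) / D) = (t - s) / D.
    by field; rewrite gt_eqF.
  rewrite ler_pdivlMr // ler_piMr ?subr_ge0 // /D; nra.
have := main n 0 1 (lexx _) ler01 (lexx _); rewrite subr0.
have -> : P 0 = 1 by apply: Cext; rewrite /Cre /Cim /=; ring.
by have -> : P 1 = I by apply: Cext; rewrite /Cre /Cim /=; ring.
Qed.

(** 1 <= |Re z| + |Im z| <= 2 |z - w| + 2 / 8, which even gives 3 / 8. *)
Lemma square_dist w z : `|w| <= 8^-1 -> on_square z -> 4^-1 <= `|z - w|.
Proof.
move=> /Cre_le; rewrite Cre_natV natV_le_norm => hw [_ hz].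
have := Cre_norm (z - w); have := Cim_norm (z - w).
have := Cre_norm w; have := Cim_norm w; rewrite CreD CimD CreN CimN.
have := lerB_dist (Cre z) (Cre w); have := lerB_dist (Cim z) (Cim w).
lra.
Qed.

End Contour.

Section CauchyFormula.
Variable R : realType.
Local Notation C := (CC R).
Implicit Types (z w a e d B M : C) (f g h : C -> C) (n : nat).

(** The substitute for the contour integral, and all that is used of it. The constant 16 is 8, for
    four sides of length at most 2, times the 2 of [banach_limit]. *)
Lemma contour_functional : exists L : (C -> C) -> C,
  [/\ forall h g a b, bounded_on_square h -> bounded_on_square g ->
        L (fun z => a * h z + b * g z) = a * L h + b * L g,
      forall h B, (forall z, on_square z -> `|h z| <= B) -> `|L h| <= 16 * B,
      forall h g, (forall z, on_square z -> h z = g z) -> L h = L g,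
      forall h, (forall e, 0 < e -> eventually_small (contour h) e) ->
        bounded_on_square h -> L h = 0
    & L (fun z => z^-1) != 0].
Proof.
have [L [Llin Lb Ls Lim]] := banach_limit R.
have bb h : bounded_on_square h -> bounded_seq (contour h).
  by move=> [B hB]; exists (8 * B) => n; apply: contour_bound.
exists (fun h => L (contour h)); split.
- move=> h g a b bh bg; rewrite -(Llin _ _ _ _ (bb _ bh) (bb _ bg)); congr L.
  apply/funext => n; rewrite /contour !dyadic_sumD !dyadic_sumZ; ring.
- move=> h B hB; apply: le_trans (Lb _ (8 * B) _) _.
    by move=> n; apply: contour_bound.
  by rewrite mulrA -natrM.
- by move=> h g hg; congr L; apply/funext => n; apply: eq_contour.
- by move=> h hs /bb; apply: Ls.
- apply/eqP => L0.
  have bi : bounded_on_square (fun z : C => z^-1).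
    exists 4 => z hz; have h1 : `|0 : C| <= 8^-1 by rewrite normr0 invr_ge0.
    have := square_dist h1 hz; rewrite subr0 => h4.
    have z0 : 0 < `|z| by apply: lt_le_trans h4; rewrite invr_gt0.
    by rewrite normfV -[4]invrK lef_pV2 ?posrE ?invr_gt0.
  have := Lim _ 4 (bb _ bi) (@contour_inv R); rewrite L0 /Cim /=; lra.
Qed.

Lemma derivable_lip f a : derivable f a 1 ->
  exists M d, [/\ 0 < M, 0 < d &
    forall z, `|z - a| < d -> `|f z - f a| <= M * `|z - a|].
Proof.
move=> /derivable_epsP[l /(_ 1 ltr01)[d d0 hd]].
exists (`|l| + 1), d; split; [by rewrite ltr_wpDl | by [] |].
move=> z /hd h; rewrite -(subrK (l * (z - a)) (f z - f a)) addrC mulrDl.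
by apply: le_trans (ler_normD _ _) _; apply: lerD => //; rewrite normrM.
Qed.

(** The order of the complex numbers is partial, but positive elements are real and therefore
    comparable. *)
Lemma pos_min2 d e : 0 < d -> 0 < e -> exists2 c, 0 < c & c <= d /\ c <= e.
Proof.
move=> d0 e0; have /orP[h|h] := real_leVge (gtr0_real d0) (gtr0_real e0).
  by exists d.
by exists e.
Qed.

Lemma derivable_near_neq0 f a : derivable f a 1 -> f a != 0 ->
  exists2 d, 0 < d & forall z, `|z - a| < d -> f z != 0.
Proof.
move=> /derivable_lip[M [d [M0 d0 h]]] fa.
have fa0 : 0 < `|f a| / M by rewrite divr_gt0 ?normr_gt0.
have [c c0 [cd cM]] := pos_min2 d0 fa0; exists c => // z zc.
apply/eqP => fz; have := h z (lt_le_trans zc cd).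
rewrite fz sub0r normrN mulrC -ler_pdivrMr // => h1.
by have := le_lt_trans h1 (lt_le_trans zc cM); rewrite ltxx.
Qed.

Lemma derivable_slope f w z : derivable f z 1 -> z != w ->
  derivable (fun y => (f y - f w) * (y - w)^-1) z 1.
Proof.
move=> df zw.
have d1 : derivable (fun y => f y - f w) z 1.
  exact: (CderivableB df (@Cderivable_cst R (f w) z)).
have d2 : derivable (fun y : C => y - w) z 1.
  exact: (CderivableB (@Cderivable_id R z) (@Cderivable_cst R w z)).
have zw0 : z - w != 0 by rewrite subr_eq0.
exact: (CderivableM d1 (CderivableV (f := fun y : C => y - w) zw0 d2)).
Qed.

Lemma derivable_near_eq f g a d : 0 < d ->
  (forall z, `|z - a| < d -> f z = g z) -> derivable f a 1 -> derivable g a 1.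
Proof.
by move=> d0 fg; apply: near_eq_derivable; apply/near_nbhs_ball; exists d.
Qed.

(** The square is the union of four triangles with common vertex w, the only point where the
    quotient may fail to be differentiable; near w it is bounded because f is locally Lipschitz
    there. Since |w| <= 1 / 8, each side is strictly on one side of w, as [wedge_small] requires. *)
Lemma slope_small f w e : (forall z, unit_ball z -> derivable f z 1) ->
  `|w| <= 8^-1 -> 0 < e -> eventually_small
    (contour (fun z => if z == w then 0 else (f z - f w) * (z - w)^-1)) e.
Proof.
move=> fd hw e0; set h := fun z => _.
have bw : unit_ball w by apply: le_trans hw _; rewrite invf_le1 ?ler1n.
have hd z : unit_ball z -> z != w -> derivable h z 1.
  move=> bz zw; have zw0 : 0 < `|z - w| by rewrite normr_gt0 subr_eq0.
  apply: (derivable_near_eq zw0 _ (derivable_slope (fd z bz) zw)) => y yz; rewrite /h ifN //; apply/eqP => yw; move: yz.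
  by rewrite yw distrC ltxx.
have [M [d [M0 d0 hM]]] := derivable_lip (fd w bw).
have hb z : `|z - w| <= d / 2 -> `|h z| <= M.
  move=> zd; rewrite /h; case: eqVneq => [_|zw]; first by rewrite normr0 ltW.
  rewrite normrM normfV ler_pdivrMr ?normr_gt0 ?subr_eq0 //; apply: hM.
  by apply: le_lt_trans zd _; rewrite ltr_pdivrMr // mulr_natr mulr2n ltrDl.
have d20 : 0 < d / 2 by rewrite divr_gt0.
have Cw : `|Cre w| <= 8^-1 /\ `|Cim w| <= 8^-1.
  have := Cre_le hw; rewrite Cre_natV.
  by split; [apply: le_trans (Cre_norm w) _|apply: le_trans (Cim_norm w) _].
have half s t p : s ^+ 2 = 1 -> t ^+ 2 = 1 -> edge (Cmk s t) p ->
    0 < Cre (Cmk s t * (p - w)).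
  move=> /eqP s1 /eqP t1 [_]; rewrite /half_plane /= subr0 mulrBr CreD CreN.
  rewrite [Cre (_ * w)]CreM [Cre (Cmk _ _)]/Cre [Cim (Cmk _ _)]/Cim /=.
  have [/ler_normlP[? ?] /ler_normlP[? ?]] := Cw.
  by move: s1 t1; rewrite !sqrf_eq1 => /orP[]/eqP-> /orP[]/eqP->; lra.
have e4 : 0 < e / 4 by rewrite divr_gt0.
have tri s t p q : s ^+ 2 = 1 -> t ^+ 2 = 1 -> edge (Cmk s t) p ->
    edge (Cmk s t) q -> eventually_small (fun n => triangle_sum h n w p q) (e / 4).
  move=> s1 t1 ep eq_; apply: (wedge_small bw _ _ hd d20 hb _ _ e4).
  - by case: ep.
  - by case: eq_.
  - exact: half s1 t1 ep.
  - exact: half s1 t1 eq_.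
have [[e1 e2] [e3 e4'] [e5 e6] [e7 e8]] := edges R.
have q1 : 1 ^+ 2 = 1 :> R by ring.
have q2 : (-1) ^+ 2 = 1 :> R by ring.
have [n1 h1] := tri _ _ _ _ q1 q2 e1 e2.
have [n2 h2] := tri _ _ _ _ q2 q2 e3 e4'.
have [n3 h3] := tri _ _ _ _ q2 q1 e5 e6.
have [n4 h4] := tri _ _ _ _ q1 q1 e7 e8.
exists (n1 + n2 + n3 + n4)%N => n hn; rewrite (contour_fan h n w).
have -> : e = e / 4 + e / 4 + e / 4 + e / 4 by field.
apply: le_trans (ler_normD _ _) (lerD _ _); last by apply: h4; move: hn; clear; lia.
apply: le_trans (ler_normD _ _) (lerD _ _); last by apply: h3; move: hn; clear; lia.
apply: le_trans (ler_normD _ _) (lerD _ _); last by apply: h2; move: hn; clear; lia.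
by apply: h1; move: hn; clear; lia.
Qed.

(* With c w the ultrafilter limit of the contour sums of 1 / (z - w), Cauchy's
   formula reads f w * c w = F w, where F and c are differentiable at 0.  Only
   c 0 != 0 is needed about c. *)
Theorem local_division f M : (forall z, unit_ball z -> derivable f z 1) ->
  (forall z, unit_ball z -> `|f z| <= M) ->
  exists2 g : C -> C, derivable g 0 1 &
    exists2 d, 0 < d & forall w, `|w| < d -> f w = f 0 + w * g w.
Proof.
move=> fd fM; have [L [Llin Lb Leq L0 Lne]] := contour_functional.
pose k w z : C := (z - w)^-1.
have e80 : 0 < 8^-1 :> C by rewrite invr_gt0.
have z8 : `|0 : C| <= 8^-1 by rewrite normr0 ltW.
have kb w z : `|w| <= 8^-1 -> on_square z -> `|k w z| <= 4.
  move=> hw hz; have h4 := square_dist hw hz.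
  have z0 : 0 < `|z - w| by apply: lt_le_trans h4; rewrite invr_gt0.
  by rewrite normfV -[4]invrK lef_pV2 ?posrE ?invr_gt0.
have kn w z : `|w| <= 8^-1 -> on_square z -> z - w != 0.
  move=> hw hz; rewrite -normr_gt0; apply: lt_le_trans (square_dist hw hz).
  by rewrite invr_gt0.
have bk w : `|w| <= 8^-1 -> bounded_on_square (k w).
  by move=> hw; exists 4 => z; apply: kb.
have bf : bounded_on_square f by exists M => z [bz _]; apply: fM.
have bM h g : bounded_on_square h -> bounded_on_square g ->
    bounded_on_square (fun z => h z * g z).
  move=> [B hB] [B' hB']; exists (B * B') => z hz; rewrite normrM.
  by apply: ler_pM => //; [apply: hB|apply: hB'].
have bC (c : C) : bounded_on_square (fun _ => c) by exists `|c| => z _.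
(* On the square, the difference quotient of [slope_small] is f k_w - f(w) k_w, and L is 0 on it. *)
have cauchy w : `|w| <= 8^-1 -> L (fun z => f z * k w z) = f w * L (k w).
  move=> hw; apply/eqP; rewrite -subr_eq0; apply/eqP.
  have E z : on_square z -> (if z == w then 0 else (f z - f w) * (z - w)^-1)
      = 1 * (f z * k w z) + (- f w) * k w z.
    move=> hz; have := kn w z hw hz; rewrite subr_eq0 => zw.
    by rewrite (negPf zw) /k; ring.
  have bfk := bM f (k w) bf (bk w hw).
  have := Llin (fun z => f z * k w z) (k w) 1 (- f w) bfk (bk w hw).
  rewrite mul1r mulNr => <-; rewrite -(Leq _ _ E); apply: L0 => [e e0|]; first exact: slope_small.
  have [B hB] := bfk.
  exists (B + `|f w| * 4) => z hz; rewrite (E z hz) mul1r.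
  apply: le_trans (ler_normD _ _) _; apply: lerD; first exact: hB.
  by rewrite normrM normrN ler_wpM2l // kb.
have Kd h : bounded_on_square h -> derivable (fun w => L (fun z => h z * k w z)) 0 1.
  move=> bh; apply/derivable_epsP; exists (L (fun z => h z * k 0 z * k 0 z)) => e e0.
  have b0 := bk 0 z8.
  have b2 : bounded_on_square (fun z => h z * k 0 z * k 0 z) by exact: (bM _ (k 0) (bM h (k 0) bh b0) b0).
  have [B hB] := b2; pose N := 16 * (B * 4) + 1.
  have B0 : 0 <= B.
    have [[e1 _] _ _ _] := edges R.
    apply: le_trans (normr_ge0 _) (hB 1 _); apply: edge_on_square e1; ring.
  have N0 : 0 < N by rewrite /N ltr_wpDl // !mulr_ge0.
  have [d d0 [de d8]] := pos_min2 (divr_gt0 e0 N0) e80.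
  exists d => // w; rewrite !subr0 => wd.
  have w8 : `|w| <= 8^-1 by apply: le_trans (ltW wd) d8.
  (* The identity k_w = k_0 + w k_0 ^ 2 + w ^ 2 k_0 ^ 2 k_w: the middle term carries the derivative
     at 0, and L of the last one is O(w ^ 2). *)
  have E z : on_square z -> h z * k w z = 1 * (1 * (h z * k 0 z)
      + w * (h z * k 0 z * k 0 z)) + w ^+ 2 * (h z * k 0 z * k 0 z * k w z).
    move=> hz; have n1 := kn 0 z z8 hz; have n2 := kn w z w8 hz.
    rewrite /k; rewrite subr0 in n1 *; field.
    by rewrite n1 n2.
  have b1 : bounded_on_square (fun z => h z * k 0 z) by exact: (bM h (k 0) bh b0).
  have b3 := bM _ _ b2 (bk w w8).
  have b4 : bounded_on_square (fun z => 1 * (h z * k 0 z) + w * (h z * k 0 z * k 0 z)).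
    have [B1 h1] := b1; exists (B1 + `|w| * B) => z hz; rewrite mul1r.
    apply: le_trans (ler_normD _ _) _; apply: lerD; first exact: h1.
    by rewrite normrM ler_wpM2l // hB.
  rewrite (Leq _ _ E) (Llin _ _ 1 (w ^+ 2) b4 b3) (Llin _ _ 1 w b1 b2).
  rewrite [X in `|X|](_ : _ = w ^+ 2 * L (fun z => h z * k 0 z * k 0 z * k w z)); last by ring.
  rewrite normrM normrX expr2 -mulrA mulrC; apply: ler_wpM2r => //.
  apply: (@le_trans _ _ (`|w| * N)).
    apply: ler_wpM2l => //; rewrite /N; apply: ler_wpDr => //; apply: Lb => z hz.
    by rewrite normrM; apply: ler_pM => //; [apply: hB | apply: kb].
  by rewrite -ler_pdivlMr //; apply: le_trans (ltW wd) de.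
have Lk w : L (k w) = L (fun z => 1 * k w z).
  by apply: Leq => z _; rewrite mul1r.
have cd : derivable (fun w => L (k w)) 0 1.
  have := Kd _ (bC 1); apply: (derivable_near_eq ltr01) => w _; by rewrite Lk.
have c0 : L (k 0) != 0.
  by rewrite (Leq _ (fun z => z^-1)) // => z _; rewrite /k subr0.
pose h z := (f z - f 0) * k 0 z.
have bfC : bounded_on_square (fun z => f z - f 0).
  have [B hB] := bf; exists (B + `|f 0|) => z hz.
  by apply: le_trans (ler_normB _ _) _; rewrite lerD // hB.
have bh : bounded_on_square h by exact: (bM _ (k 0) bfC (bk 0 z8)).
exists (fun w => L (fun z => h z * k w z) * (L (k w))^-1).
  exact: (CderivableM (Kd _ bh) (CderivableV (f := fun w => L (k w)) c0 cd)).
have [d1 d10 hd1] := derivable_near_neq0 cd c0.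
have [d d0 [dd1 d8]] := pos_min2 d10 e80.
exists d => // w wd.
have w8 : `|w| <= 8^-1 by apply: le_trans (ltW wd) d8.
have cw : L (k w) != 0 by apply: hd1; rewrite subr0; apply: lt_le_trans wd dd1.
have split_ v : `|v| <= 8^-1 -> L (fun z => (f z - f 0) * k v z) = (f v - f 0) * L (k v).
  move=> v8; rewrite (Leq _ (fun z => 1 * (f z * k v z) + (- f 0) * k v z)); last first.
    by move=> z _; ring.
  rewrite (Llin _ _ 1 (- f 0) (bM f (k v) bf (bk v v8)) (bk v v8)).
  by rewrite cauchy //; ring.
(* Since k_w = k_0 + w k_0 k_w, the left side is L ((f - f 0) k_0) + w L (h k_w), and the first term
   is 0 by Cauchy's formula at 0. *)
have main : (f w - f 0) * L (k w) = w * L (fun z => h z * k w z).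
  rewrite -split_ //.
  rewrite (Leq _ (fun z => 1 * ((f z - f 0) * k 0 z) + w * (h z * k w z))).
    rewrite (Llin _ _ 1 w (bM _ (k 0) bfC (bk 0 z8)) (bM h (k w) bh (bk w w8))).
    by rewrite split_ // subrr mul0r mulr0 add0r.
  move=> z hz; have n1 := kn 0 z z8 hz; have n2 := kn w z w8 hz.
  rewrite /h /k; rewrite subr0 in n1 *; field.
  by rewrite n1 n2.
by rewrite mulrA -main mulfK // addrC subrK.
Qed.

End CauchyFormula.

(** * Dividing out zeros of holomorphic functions on the disc *)

Section Division.
Variable R : realType.
Local Notation C := (CC R).
Implicit Types (z w a e d M r : C) (f g h : C -> C) (m n : nat).

Definition vanishes_to m a f := exists M d,
  0 < d /\ forall z, `|z - a| < d -> z != a -> `|f z| <= M * `|z - a| ^+ m.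

Lemma bigO_vanishes f m a :
  (f =O_ (a^') (fun z : C => (z - a) ^+ m)) <-> vanishes_to m a f.
Proof.
split.
  move=> /eqO_exP[M M0 /near_dnbhs_ball[d d0 h]]; exists M, d; split=> // z zd za.
  by have := h z zd za; rewrite normrX.
move=> [M [d [d0 h]]]; apply/eqO_exP; exists (`|M| + 1); first by rewrite ltr_wpDl.
apply/near_dnbhs_ball; exists d => // z zd za; rewrite normrX.
apply: le_trans (real_ler_norm _) _; first by rewrite normr_real.
rewrite normr_id.
have h1 := h z zd za.
have M0 : 0 <= M.
  have : 0 <= M * `|z - a| ^+ m by apply: le_trans h1.
  by rewrite pmulr_lge0 // exprn_gt0 // normr_gt0 subr_eq0.
apply: le_trans h1 _; apply: ler_wpM2r; first by rewrite exprn_ge0.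
by rewrite ger0_norm // lerDl.
Qed.

Lemma derivable_affine f a r z : derivable f (a + r * z) 1 ->
  derivable (fun y => f (a + r * y)) z 1.
Proof.
move=> /derivable_epsP[l hl]; apply/derivable_epsP; exists (r * l) => e e0.
have r0 : 0 < `|r| + 1 by rewrite ltr_wpDl.
have [d d0 hd] := hl (e / (`|r| + 1)) (divr_gt0 e0 r0).
exists (d / (`|r| + 1)) => [|y]; first exact: divr_gt0.
rewrite ltr_pdivlMr // => yz.
have E : a + r * y - (a + r * z) = r * (y - z) by ring.
have rr : `|r| * `|y - z| <= `|y - z| * (`|r| + 1).
  by rewrite mulrC ler_wpM2l // lerDl.
have := hd (a + r * y); rewrite E normrM => /(_ (le_lt_trans rr yz)) h.
have -> : r * l * (y - z) = l * (r * (y - z)) by ring.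
apply: le_trans h _; rewrite mulrAC -mulrA.
apply: ler_wpM2l; first exact: ltW.
by rewrite ler_pdivrMr.
Qed.

(** Away from a the quotient is explicit. At a, a disc of radius r is rescaled to the unit ball,
    with r so small that it stays in the unit disc and in the region where the Lipschitz estimate at
    a bounds f, as [local_division] requires. *)
Lemma hol_division f a :
  (forall z, unit_disc z -> derivable f z 1) -> unit_disc a ->
  exists g : C -> C, (forall z, unit_disc z -> derivable g z 1) /\
    forall z, f z = f a + (z - a) * g z.
Proof.
move=> fd aD; have [M [d1 [M0 d10 hM]]] := derivable_lip (fd a aD).
have a1 : 0 < 1 - `|a| by rewrite subr_gt0.
have [d d0 [dd1 da]] := pos_min2 d10 a1.
pose r := d / 2; have r0 : 0 < r by rewrite divr_gt0.
have rd : r < d by rewrite ltr_pdivrMr // mulr_natr mulr2n ltrDl.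
have nr z : unit_ball z -> `|a + r * z - a| <= r.
  by move=> z1; rewrite addrAC subrr add0r normrM gtr0_norm // ler_piMr // ltW.
have Fd z : unit_ball z -> derivable (fun y => f (a + r * y)) z 1.
  move=> z1; apply/derivable_affine/fd; rewrite /unit_disc /=.
  rewrite -(subrK a (a + r * z)); apply: le_lt_trans (ler_normD _ _) _.
  rewrite -ltrBrDr; apply: le_lt_trans (nr z z1) _; exact: lt_le_trans rd da.
have Fb z : unit_ball z -> `|f (a + r * z)| <= `|f a| + M * r.
  move=> z1; rewrite -(subrK (f a) (f (a + r * z))) addrC.
  apply: le_trans (ler_normD _ _) _; apply: lerD => //.
  apply: le_trans (hM _ _) _; last by apply: ler_wpM2l (nr z z1); exact: ltW.
  by apply: le_lt_trans (nr z z1) _; apply: lt_le_trans rd dd1.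
have [G Gd [e e0 hG]] := local_division Fd Fb.
exists (fun z => if z == a then G 0 / r else (f z - f a) * (z - a)^-1); split; last first.
  move=> z; case: eqVneq => [->|za]; first by rewrite subrr mul0r addr0.
  by rewrite mulrCA divff ?subr_eq0 // mulr1 addrC subrK.
move=> z zD; have [->{z zD}|za] := eqVneq z a; last first.
  have zw0 : 0 < `|z - a| by rewrite normr_gt0 subr_eq0.
  apply: (derivable_near_eq zw0 _ (derivable_slope (fd z zD) za)) => y yz.
  by rewrite ifN //; apply/eqP => yw; move: yz; rewrite yw distrC ltxx.
have rn : r != 0 by rewrite gt_eqF.
have g2 : derivable (fun y => G (- a / r + r^-1 * y)) a 1.
  apply: derivable_affine.
  by have -> : - a / r + r^-1 * a = 0 by field.
have g3 := CderivableM g2 (@Cderivable_cst R r^-1 a).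
apply: (derivable_near_eq (mulr_gt0 e0 r0) _ g3) => y yz /=.
have -> : - a / r + r^-1 * y = (y - a) / r by field.
case: eqVneq => [->|ya]; first by rewrite subrr mul0r.
have := hG ((y - a) / r); rewrite mulr0 addr0.
have -> : a + r * ((y - a) / r) = y by field.
rewrite normrM normfV (gtr0_norm r0) ltr_pdivrMr // => /(_ yz) ->.
by field; rewrite subr_eq0 ya rn.
Qed.

Lemma vanishes_to_le m n a f : (m <= n)%N -> vanishes_to n a f -> vanishes_to m a f.
Proof.
move=> mn [M [d [d0 h]]].
have [c c0 [cd c1]] := pos_min2 d0 (@ltr01 C).
exists M, c; split => // z zc za; have h1 := h z (lt_le_trans zc cd) za.
have z0 : 0 < `|z - a| by rewrite normr_gt0 subr_eq0.
have M0 : 0 <= M.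
  have : 0 <= M * `|z - a| ^+ n by apply: le_trans h1.
  by rewrite pmulr_lge0 // exprn_gt0.
apply: le_trans h1 _; apply: ler_wpM2l => //.
by apply: ler_wiXn2l => //; apply: ltW; apply: lt_le_trans zc c1.
Qed.

Lemma hol_factor m f a :
  (forall z, unit_disc z -> derivable f z 1) -> unit_disc a ->
  vanishes_to m a f ->
  exists g : C -> C, (forall z, unit_disc z -> derivable g z 1) /\
    forall z, f z = (z - a) ^+ m * g z.
Proof.
elim: m f => [|m IH] f fd aD fv.
  by exists f; split => // z; rewrite expr0 mul1r.
(* The growth bound says nothing at a itself; the value there follows by continuity, comparing it
   with the value at a + e / 2. *)
have fa : f a = 0.
  have [N [d1 [d10 h1]]] := vanishes_to_le (isT : (1 <= m.+1)%N) fv.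
  have [M [d2 [M0 d20 h2]]] := derivable_lip (fd a aD).
  apply/eqP; rewrite -normr_eq0; apply: contraT => fa0.
  have {}fa0 : 0 < `|f a| by rewrite lt_def fa0 normr_ge0.
  have [c c0 [c1 c2]] := pos_min2 d10 d20.
  (* With e <= |f a| / (2 (|N| + M)), the two bounds at a + e / 2 would give |f a| <= (|N| + M) e /
     2 < |f a|. *)
  have K0 : 0 < 2 * (`|N| + M) by rewrite mulr_gt0 // ltr_wpDl.
  have [e e0 [ec eK]] := pos_min2 c0 (divr_gt0 fa0 K0).
  have e2 : `|e / 2| = e / 2 by rewrite gtr0_norm // divr_gt0.
  have ee : `|a + e / 2 - a| = e / 2 by rewrite addrAC subrr add0r.
  have el : e / 2 < e by rewrite ltr_pdivrMr // mulr_natr mulr2n ltrDl.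
  have ea : a + e / 2 != a by rewrite -subr_eq0 -normr_eq0 ee gt_eqF // divr_gt0.
  have b1 : `|f (a + e / 2)| <= N * (e / 2).
    have := h1 (a + e / 2); rewrite ee expr1; apply => //.
    by apply: lt_le_trans el _; apply: le_trans ec c1.
  have b2 : `|f (a + e / 2) - f a| <= M * (e / 2).
    have := h2 (a + e / 2); rewrite ee; apply.
    by apply: lt_le_trans el _; apply: le_trans ec c2.
  have : `|f a| <= (`|N| + M) * (e / 2).
    rewrite -[X in `|X|](subKr (f (a + e / 2))) mulrDl.
    apply: le_trans (ler_normB _ _) _; apply: lerD => //.
    apply: (le_trans b1); rewrite -[X in _ <= _ * X]e2 -normrM.
    by apply/real_ler_norm/ger0_real/(le_trans (normr_ge0 _) b1).
  have : (`|N| + M) * (e / 2) < `|f a|.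
    apply: (@lt_le_trans _ _ ((`|N| + M) * e)).
      by rewrite ltr_pM2l // ltr_wpDl.
    apply: (@le_trans _ _ ((`|N| + M) * (`|f a| / (2 * (`|N| + M))))).
      by apply: ler_wpM2l => //; apply: ltW; rewrite ltr_wpDl.
    have NM : `|N| + M != 0 by rewrite gt_eqF // ltr_wpDl.
    have -> : (`|N| + M) * (`|f a| / (2 * (`|N| + M))) = `|f a| / 2 by field.
    by rewrite ler_pdivrMr // mulr_natr mulr2n lerDl.
  by move=> h3 h4; have := le_lt_trans h4 h3; rewrite ltxx.
have [g [gd fg]] := hol_division fd aD.
have [M [d [d0 hM]]] := fv.
have gv : vanishes_to m a g.
  exists M, d; split => // z zd za.
  have z0 : 0 < `|z - a| by rewrite normr_gt0 subr_eq0.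
  have := hM z zd za; rewrite fg fa add0r normrM exprSr mulrA.
  by rewrite [leLHS]mulrC ler_pM2r.
have [h [hd gh]] := IH g gd aD gv.
by exists h; split => // z; rewrite fg fa add0r gh exprS mulrA.
Qed.

End Division.

(** * Interpolation in SL_n *)

Section SLInterpolation.
Variable F : fieldType.
Implicit Types (p q d : {poly F}) (n : nat).

(* Paths are polynomial, so that substituting a polynomial equal to 1 modulo a
   power of 'X - alpha_j and to 0 modulo the others localizes them at alpha_j. *)
Definition sl_path n (T : 'M[F]_n) := exists P : 'M[{poly F}]_n,
  [/\ \det P = 1, map_mx (horner_eval 0) P = 1%:M & map_mx (horner_eval 1) P = T].

Lemma sl_pathM n (S T : 'M[F]_n) : sl_path S -> sl_path T -> sl_path (S *m T).
Proof.
move=> [P [dP P0 P1]] [Q [dQ Q0 Q1]]; exists (P *m Q).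
by rewrite det_mulmx dP dQ mulr1 !map_mxM P0 Q0 P1 Q1 mulmx1.
Qed.

Let lift_mx m n (v : 'M[F]_(m, n)) : 'M[{poly F}]_(m, n) :=
  'X *: map_mx polyC v.

Let lift_mxE m n (v : 'M[F]_(m, n)) x :
  map_mx (horner_eval x) (lift_mx v) = x *: v.
Proof. by apply/matrixP => i j; rewrite !mxE /horner_eval !hornerE. Qed.

Lemma sl_path_ublock n (v : 'rV[F]_n) : sl_path (block_mx (1%:M : 'M[F]_1) v 0 1%:M).
Proof.
exists (block_mx 1%:M (lift_mx v) 0 1%:M).
by rewrite det_ublock !det1 mulr1 !map_block_mx !lift_mxE !map_mx1 !map_mx0 scale0r
  scale1r -scalar_mx_block.
Qed.

Lemma sl_path_lblock n (v : 'cV[F]_n) : sl_path (block_mx (1%:M : 'M[F]_1) 0 v 1%:M).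
Proof.
exists (block_mx 1%:M 0 (lift_mx v) 1%:M).
by rewrite det_lblock !det1 mulr1 !map_block_mx !lift_mxE !map_mx1 !map_mx0 scale0r
  scale1r -scalar_mx_block.
Qed.

Lemma sl_path_dblock n (T : 'M[F]_n) : sl_path T ->
  sl_path (block_mx (1%:M : 'M[F]_1) 0 0 T).
Proof.
move=> [P [dP P0 P1]]; exists (block_mx 1%:M 0 0 P).
by rewrite det_ublock det1 dP mulr1 !map_block_mx !map_mx1 !map_mx0 P0 P1
  -scalar_mx_block.
Qed.

(* Row operations reduce to the upper left entry 1, then induct on the size. *)
Lemma det1_sl_path n (T : 'M[F]_n) : \det T = 1 -> sl_path T.
Proof.
elim: n T => [|n IH] T dT.
  by exists 1%:M; rewrite det1 !map_mx1; split => //; apply/matrixP => -[].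
have corner1 (b : 'rV[F]_n) (c : 'cV[F]_n) (D : 'M[F]_n) :
    \det (block_mx (1%:M : 'M[F]_1) b c D) = 1 -> sl_path (block_mx (1%:M : 'M[F]_1) b c D).
  (* Block LU factorization: the Schur complement D - c b has determinant 1 and is subject to the
     induction hypothesis. *)
  have E : block_mx (1%:M : 'M[F]_1) b c D = block_mx (1%:M : 'M[F]_1) 0 c 1%:M *m
      (block_mx (1%:M : 'M[F]_1) 0 0 (D - c *m b) *m block_mx (1%:M : 'M[F]_1) b 0 1%:M).
    rewrite !mulmx_block !(mulmx1, mul1mx, mulmx0, mul0mx, addr0, add0r).
    by rewrite addrC subrK.
  rewrite E !det_mulmx det_lblock !det_ublock !det1 !mul1r mulr1 => /IH h.
  apply: sl_pathM (sl_path_lblock _) _; apply: sl_pathM (sl_path_ublock _).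
  exact: sl_path_dblock.
have cornerc (a : 'M[F]_1) (b : 'rV[F]_n) (c : 'cV[F]_n) (D : 'M[F]_n) : c != 0 ->
    \det (block_mx a b c D) = 1 -> sl_path (block_mx a b c D).
  move=> c0; have [i ci] : exists i, c i 0 != 0.
    apply/existsP; apply: contraNT c0 => /existsPn h; apply/eqP/matrixP => i j.
    by rewrite ord1 mxE; apply/eqP; have := h i; rewrite negbK.
  pose v : 'rV[F]_n := ((1 - a 0 0) / c i 0) *: delta_mx 0 i.
  have vc : a + v *m c = 1%:M.
    apply/matrixP => x y; rewrite !ord1 /v -scalemxAl -rowE !mxE eqxx /=.
    by rewrite divfK // addrC subrK.
  have E : block_mx a b c D = block_mx (1%:M : 'M[F]_1) (- v) 0 1%:M *m
     block_mx (1%:M : 'M[F]_1) (b + v *m D) c D.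
    rewrite mulmx_block !(mulmx1, mul1mx, mul0mx, add0r) -vc !mulNmx addrK.
    by rewrite addrK.
  rewrite E det_mulmx det_ublock !det1 !mul1r => /corner1 h.
  exact: sl_pathM (sl_path_ublock _) h.
change 'M[F]_(1 + n) in T; rewrite -(submxK T) in dT *.
change (\det (block_mx (ulsubmx T) (ursubmx T) (dlsubmx T) (drsubmx T)
  : 'M[F]_(1 + n)) = 1) in dT.
move: (ulsubmx _) (ursubmx _) (dlsubmx _) (drsubmx _) dT => {T} a b c D dT.
have [c0|] := eqVneq c 0; last by move/cornerc; apply.
subst c; case: n => [|n] in IH corner1 cornerc b D dT *.
  have a1 : a = 1%:M.
    move: dT; rewrite det_ublock det_mx00 mulr1 det_mx11 => a1.
    by apply/matrixP => i j; rewrite !ord1 a1 mxE eqxx.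
  by rewrite a1 in dT *; apply: corner1.
have a0 : a 0 0 != 0.
  move: dT; rewrite det_ublock det_mx11 => /eqP; apply: contraTneq => ->.
  by rewrite mul0r eq_sym oner_eq0.
(* With c = 0 the corner a is invertible; adding the top row to every row below makes the first
   column nonzero under the corner. *)
pose w : 'cV[F]_n.+1 := const_mx 1.
have E : block_mx a b 0 D = block_mx (1%:M : 'M[F]_1) 0 (- w) 1%:M *m
   block_mx a b (w *m a) (w *m b + D).
  rewrite mulmx_block !(mulmx1, mul1mx, mul0mx, addr0) !mulNmx.
  by rewrite addNr addKr.
rewrite E in dT *; move: dT; rewrite det_mulmx det_lblock !det1 !mul1r => dT.
apply: sl_pathM (sl_path_lblock _) _; apply: cornerc dT.
apply/eqP => /matrixP/(_ 0 0); rewrite !mxE big_ord1 !mxE mul1r => h.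
by rewrite h eqxx in a0.
Qed.

Definition eqmod_mx d n (A B : 'M[{poly F}]_n) := exists Z, A = B + d *: Z.

Lemma eqmod_mxM d n (A B A' B' : 'M[{poly F}]_n) :
  eqmod_mx d A B -> eqmod_mx d A' B' -> eqmod_mx d (A *m A') (B *m B').
Proof.
move=> [Z ->] [Z' ->]; exists (B *m Z' + Z *m B' + Z *m (d *: Z')).
by rewrite mulmxDl !mulmxDr !scalerDr -!scalemxAl -!scalemxAr !addrA.
Qed.

Lemma comp_poly_eqmod d q c p : d %| q - c%:P -> d %| (p \Po q) - p.[c]%:P.
Proof.
move=> dq; have : 'X - c%:P %| p - p.[c]%:P by rewrite dvdp_XsubCl rootE !hornerE subrr.
move=> /dvdpP[r /(congr1 (fun u => u \Po q))].
rewrite comp_polyB comp_polyC comp_polyM comp_polyB comp_polyX comp_polyC => ->.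
exact: dvdp_mull.
Qed.

Lemma map_comp_poly_eqmod d q c n (P : 'M[{poly F}]_n) : d %| q - c%:P ->
  eqmod_mx d (map_mx (comp_poly q) P) (map_mx polyC (map_mx (horner_eval c) P)).
Proof.
move=> dq; exists (\matrix_(i, j) (((P i j \Po q) - (P i j).[c]%:P) %/ d)).
apply/matrixP => i j; rewrite !mxE /horner_eval mulrC divpK ?comp_poly_eqmod //.
by rewrite addrC subrK.
Qed.

(** In a Bezout relation between the j-th power and the product v of the others, the multiple of v,
    normalized, is the required idempotent. *)
Lemma crt_idempotents N (alpha : 'I_N -> F) M : injective alpha ->
  exists chi : 'I_N -> {poly F}, forall j k,
    ('X - (alpha k)%:P) ^+ M %| chi j - ((k == j)%:R)%:P.
Proof.
move=> inj; suff H j : exists q : {poly F}, forall k,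
    ('X - (alpha k)%:P) ^+ M %| q - ((k == j)%:R)%:P.
  by exists (fun j => sval (cid (H j))) => j; case: cid.
pose u := ('X - (alpha j)%:P) ^+ M.
pose v := \prod_(k | k != j) ('X - (alpha k)%:P) ^+ M.
have uv : coprimep u v.
  apply: (big_ind (fun v => coprimep u v)) => [|x y ux uy|k kj].
  - exact: coprimep1.
  - by rewrite coprimepMr ux uy.
  apply/coprimep_expl/coprimep_expr; rewrite coprimep_XsubC root_XsubC.
  by apply: contra kj => /eqP/inj ->.
have [[a b] /= h] := Bezout_coprimepP u v uv.
have [c c0 hc] : exists2 c : F, c != 0 & a * u + b * v = c%:P.
  move: h; rewrite eqp_sym => /eqpP[[x y] /= /andP[x0 y0] e].
  exists (x / y); first by rewrite mulf_neq0 ?invr_eq0.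
  apply: (scalerI y0); rewrite -e -[LHS]mul_polyC mulr1 -[RHS]mul_polyC -polyCM.
  by rewrite [y * _]mulrC divfK.
exists (c^-1 *: (b * v)) => k; have [->|kj] := eqVneq k j.
  have -> : c^-1 *: (b * v) - 1%:R%:P = - (c^-1 *: (a * u)).
    have -> : b * v = c%:P - a * u by rewrite -hc addrC addKr.
    by rewrite scalerBr -mul_polyC -polyCM mulVf // addrAC subrr add0r.
  by rewrite dvdpNr dvdpZr ?invr_eq0 // dvdp_mull.
rewrite mulr0n subr0 dvdpZr ?invr_eq0 // dvdp_mull // /v (bigD1 k) //=.
exact: dvdp_mulr.
Qed.

(** Q is the product over k of the paths to T k, evaluated at the k-th idempotent. Modulo the j-th
    power every factor but the j-th is 1, and each factor keeps determinant 1. *)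
Lemma sl_interpolation N n (alpha : 'I_N -> F) M (T : 'I_N -> 'M[F]_n) :
  injective alpha -> (forall j, \det (T j) = 1) ->
  exists2 Q : 'M[{poly F}]_n, \det Q = 1 &
    forall j, eqmod_mx (('X - (alpha j)%:P) ^+ M) Q (map_mx polyC (T j)).
Proof.
move=> inj dT; have [chi hchi] := crt_idempotents M inj.
suff H (s : seq 'I_N) : uniq s -> exists2 Q : 'M[{poly F}]_n, \det Q = 1 &
    forall j, eqmod_mx (('X - (alpha j)%:P) ^+ M) Q
      (map_mx polyC (if j \in s then T j else 1%:M)).
  have [Q dQ hQ] := H (enum 'I_N) (enum_uniq _).
  by exists Q => // j; have := hQ j; rewrite mem_enum.
elim: s => [_|k s IH /= /andP[ks us]].
  by exists 1%:M => [|j]; [rewrite det1 | exists 0; rewrite scaler0 addr0 map_mx1].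
have [Q dQ hQ] := IH us; have [P [dP P0 P1]] := det1_sl_path (dT k).
exists (map_mx (comp_poly (chi k)) P *m Q) => [|j].
  by rewrite det_mulmx dQ det_map_mx dP rmorph1 mulr1.
rewrite inE; have [->|jk] /= := eqVneq j k.
  rewrite -[T k]mulmx1 map_mxM -P1; apply: eqmod_mxM.
    by apply: map_comp_poly_eqmod; have := hchi k k; rewrite eqxx.
  by have := hQ k; rewrite (negPf ks).
have e0 : eqmod_mx (('X - (alpha j)%:P) ^+ M) (map_mx (comp_poly (chi k)) P) (map_mx polyC 1%:M).
  by rewrite -P0; apply: map_comp_poly_eqmod; have := hchi k j; rewrite (negPf jk).
by have := eqmod_mxM e0 (hQ j); rewrite -map_mxM mul1mx.
Qed.

End SLInterpolation.

(** * Jordan coordinates of a companion matrix *)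

Section ConfluentVandermonde.
Variable F : fieldType.
Implicit Types (p q P : {poly F}) (x c : F).

Lemma char_poly_similar n (V A B : 'M[F]_n) : V \in unitmx ->
  V *m A = B *m V -> char_poly A = char_poly B.
Proof.
rewrite unitmxE unitfE => V0 VA.
have VA' : map_mx polyC V *m char_poly_mx A = char_poly_mx B *m map_mx polyC V.
  by rewrite mulmxBr mulmxBl -!map_mxM VA scalar_mxC.
have := congr1 determinant VA'; rewrite !det_mulmx det_map_mx mulrC.
by apply: mulIf; rewrite polyC_eq0.
Qed.

(** G = U D E^-1 and D (E^-1 C E) D^-1 = L. With D the diagonal of powers of z - alpha_j, this
    identifies the global formula G C G^-1 with one that makes sense at alpha_j. *)
Lemma conj_factor n (G C U D E L : 'M[F]_n) :
  G \in unitmx -> U \in unitmx -> E \in unitmx -> G *m E = U *m D ->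
  L *m D = D *m (invmx E *m C *m E) ->
  U *m L *m invmx U = G *m C *m invmx G.
Proof.
move=> Gu Uu Eu GE LD; apply: (can_inj (mulmxK Gu)); apply: (can_inj (mulmxK Eu)).
rewrite mulmxKV // -[_ *m G *m E]mulmxA GE mulmxA mulmxKV // -mulmxA LD.
by rewrite mulmxA -GE !mulmxA mulmxK.
Qed.

Lemma conj_scale n (c : F) (S J : 'M[F]_n) : c != 0 -> S \in unitmx ->
  (c *: S) *m J *m invmx (c *: S) = S *m J *m invmx S.
Proof.
move=> c0 Su; have cS : c *: S \in unitmx by rewrite unitmxZ ?unitfE.
apply: (can_inj (mulmxK cS)); rewrite mulmxKV //.
by rewrite -scalemxAr mulmxKV // scalemxAl.
Qed.

Definition taylor_coef x k p := (p^`N(k)).[x].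

Lemma taylor_coef_sum (I : Type) (r : seq I) (f : I -> F) (p : I -> {poly F}) x k :
  taylor_coef x k (\sum_(i <- r) f i *: p i)
  = \sum_(i <- r) f i * taylor_coef x k (p i).
Proof.
rewrite /taylor_coef; elim: r => [|i r IH]; first by rewrite !big_nil raddf0 horner0.
by rewrite !big_cons nderivnD hornerD nderivnZ hornerZ IH.
Qed.

Lemma taylor_coefMX x k p : taylor_coef x k (p * 'X)
  = x * taylor_coef x k p + (if k is k'.+1 then taylor_coef x k' p else 0).
Proof.
case: k => [|k]; rewrite /taylor_coef.
  by rewrite !nderivn0 addr0 hornerMX mulrC.
have := nderivnMXaddC k p 0; rewrite addr0 => ->.
by rewrite hornerD hornerMX addrC mulrC.
Qed.

Lemma taylor_coefMXsub x k q : taylor_coef x k (q * ('X - x%:P))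
  = if k is k'.+1 then taylor_coef x k' q else 0.
Proof.
rewrite mulrBr [q * x%:P]mulrC mul_polyC.
rewrite [LHS]/taylor_coef nderivnB nderivnZ hornerD hornerN hornerZ.
by have := taylor_coefMX x k q; rewrite {1}/taylor_coef => ->; rewrite addrAC subrr add0r.
Qed.

Lemma taylor_coef_dvdP x m p :
  ('X - x%:P) ^+ m %| p <-> forall k, (k < m)%N -> taylor_coef x k p = 0.
Proof.
split.
  elim: m p => [//|m IH] p /dvdpP[q ->] k km.
  rewrite exprSr mulrA taylor_coefMXsub; case: k km => [//|k km].
  exact: IH (dvdp_mull _ (dvdpp _)) _ km.
elim: m p => [|m IH] p h; first by rewrite expr0 dvd1p.
have : 'X - x%:P %| p.
  by rewrite dvdp_XsubCl rootE -[p in p.[_]]nderivn0; apply/eqP/(h 0%N).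
move=> /dvdpP[q pq]; rewrite pq exprSr dvdp_mul // IH // => k km.
by have := h k.+1 km; rewrite pq taylor_coefMXsub.
Qed.

(** Multiplication by t modulo P, acting on coefficient rows from the right. *)
Definition companion n P : 'M[F]_n :=
  \matrix_(i, j) (if i == n.-1 :> nat then - P`_j else (i.+1 == j :> nat)%:R).

Lemma char_poly_companion n P : P \is monic -> size P = n.+1 ->
  char_poly (companion n P) = P.
Proof.
move=> Pm sP; have e : n = (size P).-1 by rewrite sP.
by subst n; exact: companionmxK Pm.
Qed.

Variables (s : nat) (lam : 'I_s -> F) (m : 'I_s -> nat).
Hypothesis lam_inj : injective lam.
Local Notation n := (\sum_i m i)%N.

Definition blk (a : 'I_n) : 'I_s := tagnat.sig1 a.
Definition pos (a : 'I_n) : nat := tagnat.sig2 a.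

Lemma pos_lt a : (pos a < m (blk a))%N. Proof. exact: ltn_ord. Qed.

Lemma blk_Rank i (p : 'I_(m i)) : blk (tagnat.Rank i p) = i.
Proof. exact: tagnat.Rank1K. Qed.

Lemma pos_Rank i (p : 'I_(m i)) : pos (tagnat.Rank i p) = p.
Proof. by rewrite /pos tagnat.Rank2K. Qed.

Lemma Rank_surj (a : 'I_n) : exists i (p : 'I_(m i)), a = tagnat.Rank i p.
Proof. by exists (tagnat.sig1 a), (tagnat.sig2 a); rewrite tagnat.sig2K. Qed.

Lemma blk_pos_inj a b : blk a = blk b -> pos a = pos b -> a = b.
Proof.
have [i [p ->]] := Rank_surj a; have [j [q ->]] := Rank_surj b.
rewrite !blk_Rank => e; subst j; rewrite !pos_Rank => pq.
by congr (tagnat.Rank _ _); apply: val_inj.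
Qed.

(** The confluent Vandermonde matrix: it sends a coefficient row to the row of Taylor coefficients
    at the eigenvalues. *)
Definition hermite_mx : 'M[F]_n :=
  \matrix_(x, a) taylor_coef (lam (blk a)) (pos a) 'X^x.

(** A row in the kernel is a polynomial of degree < n divisible by every (X - lam i) ^ m i, hence by
    their product, which has degree n. *)
Lemma hermite_mx_unit : hermite_mx \in unitmx.
Proof.
rewrite -row_free_unit -kermx_eq0; apply/eqP/row_matrixP => r.
rewrite row0; set f := row r _.
have fE : f *m hermite_mx = 0.
  by rewrite -row_mul mulmx_ker row0.
pose p := rVpoly f.
have pE : p = \sum_(x < n) f 0 x *: 'X^x by rewrite /p /rVpoly poly_def; apply: eq_bigr => x _; rewrite insubT ?ltn_ord //= => h; congr (f _ _ *: _); apply: val_inj.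
have tp a : taylor_coef (lam (blk a)) (pos a) p = 0.
  move: fE => /matrixP/(_ 0 a); rewrite [LHS]mxE [RHS]mxE => <-.
  by rewrite pE taylor_coef_sum; apply: eq_bigr => x _; rewrite [hermite_mx _ _]mxE.
have dv i : ('X - (lam i)%:P) ^+ m i %| p.
  apply/taylor_coef_dvdP => k km; have := tp (tagnat.Rank i (Ordinal km)).
  by rewrite blk_Rank pos_Rank.
have dvP : \prod_i ('X - (lam i)%:P) ^+ m i %| p.
  rewrite -big_enum /=; elim: (enum _) (enum_uniq 'I_s) => [_|i l IH /= /andP[il ul]].
    by rewrite big_nil dvd1p.
  rewrite big_cons Gauss_dvdp ?dv ?IH // big_seq.
  apply: (big_ind (fun v => coprimep _ v)) => [|x y ux uy|k kl].
  - exact: coprimep1.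
  - by rewrite coprimepMr ux uy.
  - apply/coprimep_expl/coprimep_expr; rewrite coprimep_XsubC root_XsubC.
    by apply: contra il => /eqP/lam_inj <-.
have p0 : p = 0.
  apply: contraTeq dvP => pn0; apply/negP => /(dvdp_leq pn0).
  rewrite size_prod => [|i _]; last by rewrite expf_neq0 // polyXsubC_eq0.
  have -> : (\sum_(i < s) size (('X - (lam i)%:P) ^+ m i) = n + s)%N.
    rewrite [in RHS](_ : (n + s = n + \sum_(i < s) 1)%N); last first.
      by rewrite sum1_card card_ord.
    rewrite -big_split /=; apply: eq_bigr => i _.
    by rewrite size_exp_XsubC addn1.
  rewrite cardT size_enum_ord -addSn addnK.
  by rewrite leqNgt ltnS size_poly.
by have := congr1 (poly_rV (d := n)) p0; rewrite rVpolyK linear0.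
Qed.

(* One Jordan block per eigenvalue, whatever the block structure of [B]. *)
Definition full_jordan : 'M[F]_n := \matrix_(a, b)
  if blk a == blk b then
    if pos a == pos b then lam (blk a) else ((pos a).+1 == pos b)%:R
  else 0.

(** Row x of the companion matrix is t t^x, except that the last row is t^n - P. Multiplication by t
    acts on Taylor coefficients c_k by lam c_k + c_(k-1), which is [full_jordan]. *)
Lemma companion_hermite P : P \is monic -> size P = n.+1 -> forall x b : 'I_n,
  (companion n P *m hermite_mx) x b
  = (hermite_mx *m full_jordan) x b
    - (x == n.-1 :> nat)%:R * taylor_coef (lam (blk b)) (pos b) P.
Proof.
move=> Pm sP x b; set t := taylor_coef _ _.
have n0 : (0 < n)%N by case: (n) x => [[]|].
have -> : (hermite_mx *m full_jordan) x b = t ('X^x * 'X).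
  rewrite /t taylor_coefMX mxE.
  rewrite (bigD1 b) //= !mxE !eqxx [_ * lam _]mulrC; congr (_ + _).
  case E : (pos b) => [|k].
    apply: big1 => a ab; rewrite !mxE; case: eqP => [e|]; last by rewrite mulr0.
    case: eqP => [ep|_]; last by rewrite E mulr0.
    by rewrite (blk_pos_inj e ep) eqxx in ab.
  have km : (k < m (blk b))%N by apply: ltn_trans (pos_lt b); rewrite E.
  pose c := tagnat.Rank (blk b) (Ordinal km).
  have cb : c != b.
    by apply/eqP => /(congr1 pos); rewrite pos_Rank E /= => /n_Sn.
  rewrite (bigD1 c) //= !mxE blk_Rank pos_Rank eqxx /= E.
  rewrite (ltn_eqF (ltnSn k)) eqxx mulr1 [X in _ + X]big1 ?addr0 // => a /andP[ab ac].
  rewrite !mxE; case: eqP => [e|]; last by rewrite mulr0.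
  case: eqP => [ep|_].
    by rewrite (blk_pos_inj e ep) eqxx in ab.
  case: eqP => [[ep]|_]; last by rewrite mulr0.
  move: ac; rewrite (@blk_pos_inj a c) ?eqxx ?blk_Rank ?pos_Rank //.
  by move: ep; rewrite E => -[].
rewrite mxE; have [xn|xn] := eqVneq (x : nat) n.-1.
  have PE : P = 1 *: 'X^n + \sum_(y < n) P`_y *: 'X^y.
    rewrite -[LHS]coefK sP poly_def big_ord_recr /= addrC; congr (_ *: _ + _).
    by move: Pm; rewrite monicE lead_coefE sP => /eqP.
  have tP : t P = t 'X^n + \sum_(y < n) P`_y * t 'X^y.
    rewrite {1}PE -[RHS]addr0 /t /taylor_coef nderivnD hornerD nderivnZ hornerZ mul1r addr0.
    by congr (_ + _); exact: taylor_coef_sum.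
  rewrite mul1r tP -exprSr xn prednK // opprD addrA subrr add0r.
  rewrite -sumrN; apply: eq_bigr => y _.
  by rewrite !mxE xn eqxx mulNr.
rewrite mul0r subr0.
have xs : (x.+1 < n)%N.
  have xl := ltn_ord x; rewrite ltn_neqAle xl andbT; apply/eqP => e.
  by move/eqP: xn; apply; exact: (congr1 predn e).
rewrite (bigD1 (Ordinal xs)) //= !mxE (negPf xn) eqxx mul1r exprSr [X in _ + X]big1 ?addr0 // => y yx.
rewrite !mxE (negPf xn); case: eqP => [e|]; last by rewrite mul0r.
by move: yx; rewrite -(inj_eq val_inj) /= -e eqxx.
Qed.

Variable (B : forall i, 'M[F]_(m i)).
Hypothesis BJ : forall i, single_jordan_form (lam i) (B i).

Definition starts_after i (k : nat) : nat :=
  #|[set l in superdiag_zeros (B i) | (k < l)%N]|.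
Definition weight (a : 'I_n) := starts_after (blk a) (pos a).

Lemma jordan_dE i k : (k < m i)%N ->
  jordan_d (B i) (m i - k) = (starts_after i k).+1.
Proof. by move=> km; rewrite /jordan_d add1n subKn // ltnW. Qed.

Lemma mxdiag_Rank i (p q : 'I_(m i)) :
  (\mxdiag_i B i) (tagnat.Rank i p) (tagnat.Rank i q) = B i p q.
Proof. by have /matrixP/(_ p q) := submxblock_diag B i; rewrite mxE. Qed.

Lemma mxdiag_off (a b : 'I_n) : blk a != blk b -> (\mxdiag_i B i) a b = 0.
Proof.
by rewrite /blk => ab; rewrite mxE (negPf ab) mxE.
Qed.

(** A block starts at q exactly when the entry above the diagonal in column q is 0, and passing from
    p to q only loses the start q. *)
Lemma starts_afterS i (p q : 'I_(m i)) : p.+1 = q ->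
  starts_after i p = ((B i p q == 0%R) + starts_after i q)%N.
Proof.
move=> pq; rewrite /starts_after.
have -> : [set l in superdiag_zeros (B i) | (p < l)%N] =
    [set l in superdiag_zeros (B i) | (l == q)] :|: [set l in superdiag_zeros (B i) | (q < l)%N].
  apply/setP => l; rewrite !inE -andb_orr; congr (_ && _).
  by rewrite -pq leq_eqVlt eq_sym -(inj_eq val_inj) /= pq.
rewrite cardsU [X in (_ + _ - X)%N](_ : _ = 0%N) ?subn0; last first.
  apply: eq_card0 => l; rewrite !inE; apply/negP.
  by move=> /andP[/andP[_ /eqP->] /andP[_]]; rewrite ltnn.
congr (_ + _)%N; have <- : (q \in superdiag_zeros (B i)) = (B i p q == 0).
  rewrite inE; apply/existsP/idP => [[p' /andP[/eqP e]]|h].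
    by have -> : p' = p by apply: val_inj; move: e; rewrite /= -pq => -[].
  by exists p; rewrite pq eqxx.
case: (boolP (q \in _)) => qs.
  by apply/eqP/cards1P; exists q; apply/setP => l; rewrite !inE andbC;
    case: eqP => //= ->; move: qs; rewrite inE.
apply: eq_card0 => l; rewrite !inE; apply/negP => /andP[+ /eqP e].
by rewrite e; move: qs; rewrite inE => /negP.
Qed.

Lemma mxdiag_full_jordan a b :
  (\mxdiag_i B i) a b = if weight a == weight b then full_jordan a b else 0.
Proof.
have [ab|ab] := eqVneq (blk a) (blk b); last first.
  by rewrite mxdiag_off // mxE (negPf ab) if_same.
have [i [p ea]] := Rank_surj a; have [j [q eb]] := Rank_surj b.
move: ab; rewrite ea eb !blk_Rank => e; subst j.
rewrite mxdiag_Rank mxE /weight !blk_Rank !pos_Rank eqxx.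
have := (BJ i).1 p q; rewrite -(inj_eq val_inj) /=.
case: eqP => [pq|_]; first by rewrite pq eqxx.
case: eqP => [pq|_ ->]; last by rewrite if_same.
move=> h; rewrite (starts_afterS pq); have [->|b0] := eqVneq (B i p q) 0.
  by rewrite add1n gtn_eqF.
by rewrite add0n eqxx; case: h => // e; rewrite e eqxx in b0.
Qed.

(** This keeps the exponents weight a - weight b of the rescaled matrix nonnegative where its
    entries are nonzero. *)
Lemma full_jordan_weight a b : full_jordan a b != 0 -> (weight b <= weight a)%N.
Proof.
have [i [p ->]] := Rank_surj a; have [j [q ->]] := Rank_surj b.
rewrite mxE !blk_Rank !pos_Rank; have [e|] := eqVneq i j; last by rewrite eqxx.
subst j; rewrite /weight !blk_Rank !pos_Rank.
have [->//|_] := eqVneq (p : nat) q.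
have [pq _|] := eqVneq p.+1 (q : nat); last by rewrite eqxx.
by rewrite (starts_afterS pq) leq_addl.
Qed.

End ConfluentVandermonde.

Section LocalModel.
Variable F : fieldType.

(* [special_mx] is the Jordan form; [generic_mx] has the same eigenvalues with one
   block each, and is what [special_mx] degenerates from when coordinate a is
   rescaled by (z - alpha) ^ [frame_weight] a.  Coordinate a is the Taylor
   coefficient of order [frame_order] a at eigenvalue number [frame_index] a. *)
Record jordan_frame n s := JordanFrame {
  evaluation_mx : 'M[F]_n; basis_mx : 'M[F]_n;
  generic_mx : 'M[F]_n; special_mx : 'M[F]_n;
  frame_weight : 'I_n -> nat; frame_order : 'I_n -> nat;
  frame_index : 'I_n -> 'I_s }.

Definition frame_of n s (lam : 'I_s -> F) (m : 'I_s -> nat)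
    (B : forall i, 'M[F]_(m i)) (A : 'M[F]_n) (f : jordan_frame n s) :=
  let: JordanFrame E V N J w k i := f in
  [/\ [/\ E \in unitmx, V \in unitmx, A = V *m J *m invmx V
        & char_poly N = char_poly A],
      forall a b, J a b = if w a == w b then N a b else 0,
      forall a b, N a b != 0 -> (w b <= w a)%N,
      forall a, (k a < m (i a))%N /\ jordan_d (B (i a)) (m (i a) - k a) = (w a).+1
    & forall P, P \is monic -> size P = n.+1 -> forall x b : 'I_n,
      (companion n P *m E) x b = (E *m N) x b
        - (x == n.-1 :> nat)%:R * taylor_coef (lam (i b)) (k b) P].

Theorem local_model n (A : 'M[F]_n) s (lam : 'I_s -> F) (m : 'I_s -> nat)
    (B : forall i, 'M[F]_(m i)) : jordan_data A lam B ->
  exists f, frame_of lam B A f.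
Proof.
move=> [lam_inj _ mE BJ [P [Q [PQ QP AE]]]].
(* The sizes are identified once here; a frame lives in size n, free of dependent sums. *)
have e : (\sum_i m i)%N = n.
  by apply/eqP; rewrite eqn_leq (mulmx1_min PQ) (mulmx1_min QP).
move: e A P Q PQ QP AE mE => <- A P Q PQ QP AE mE.
exists (JordanFrame (hermite_mx lam m) P (full_jordan lam m) (\mxdiag_i B i)
  (weight B) (@pos s m) (@blk s m)); split.
- have [Pu _] := mulmx1_unit PQ; split => //; first exact: hermite_mx_unit.
    by rewrite AE -[Q]mul1mx -(mulVmx Pu) -(mulmxA _ P) PQ mulmx1.
  have sA := size_char_poly A; have Am := char_poly_monic A.
  have uE := hermite_mx_unit m lam_inj.
  (* For P = [char_poly A] the rank one correction is 0, as P vanishes to order m i at lam i. So the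
     generic matrix has the characteristic polynomial of A. *)
  have CE : companion _ (char_poly A) *m hermite_mx lam m
      = hermite_mx lam m *m full_jordan lam m.
    apply/matrixP => x b; rewrite companion_hermite // (iffLR (taylor_coef_dvdP _ _ _) _ _ (pos_lt b)) ?mulr0 ?subr0 //.
    by rewrite -mup_geq ?monic_neq0 // -mE.
  by rewrite -[RHS](char_poly_companion Am sA) (char_poly_similar uE (esym CE)).
- exact: mxdiag_full_jordan.
- exact: full_jordan_weight.
- by move=> a; split; [exact: pos_lt | rewrite jordan_dE ?pos_lt].
- by move=> p pm sp x b; rewrite companion_hermite.
Qed.

End LocalModel.

(** * Sufficiency *)

Section DerivableMatrix.
Variable R : realType.
Local Notation C := (CC R).

Lemma derivable_entries m n (M : C -> 'M[C]_(m, n)) (t : C) :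
  derivable M t 1 <-> forall i j, derivable (fun z => M z i j : C) t 1.
Proof.
split.
  move=> /cvg_ex[l Ml] i j; apply/cvg_ex; exists (l i j).
  apply/cvg_entourageP => A eA.
  have := Ml; move/cvg_mx_entourageP/(_ A eA); rewrite !near_map.
  apply: (@filterS _ (dnbhs (0 : C))) => h /(_ i j).
  by rewrite !mxE inE.

move=> h.
have l i j : {l : C | h^-1 *: ((fun z => M z i j : C) (h *: (1 : C) + t) - M t i j)
   @[h --> (0 : C)^'] --> l}.
  by apply: cid; apply/cvg_ex; exact: h.
apply/cvg_ex; exists (\matrix_(i, j) sval (l i j)).
apply/cvg_mx_entourageP => A eA; rewrite near_map.
apply: filter_forall => i; apply: filter_forall => j.
have := svalP (l i j); move/cvg_entourageP/(_ A eA); rewrite near_map.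
by apply: (@filterS _ (dnbhs (0 : C))) => x; rewrite !mxE inE.
Qed.

End DerivableMatrix.

Section MatrixDerivability.
Variable R : realType.
Local Notation C := (CC R).

Lemma Cderivable_ext (f g : C -> C) z : (forall y, f y = g y) ->
  derivable f z 1 -> derivable g z 1.
Proof. by move=> /funext ->. Qed.

Lemma Cderivable_sum (I : Type) (r : seq I) (P : pred I) (f : I -> C -> C) z :
  (forall i, derivable (f i) z 1) ->
  derivable (fun y => \sum_(i <- r | P i) f i y) z 1.
Proof.
move=> fd; elim: r => [|i r IH].
  apply: (@Cderivable_ext (fun=> 0)) => [y|]; first by rewrite big_nil.
  exact: Cderivable_cst.
case Pi : (P i); last first.
  by apply: Cderivable_ext IH => y; rewrite big_cons Pi.
apply: Cderivable_ext (CderivableD (fd i) IH) => y.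
by rewrite big_cons Pi.
Qed.

Lemma Cderivable_prod (I : Type) (r : seq I) (P : pred I) (f : I -> C -> C) z :
  (forall i, derivable (f i) z 1) ->
  derivable (fun y => \prod_(i <- r | P i) f i y) z 1.
Proof.
move=> fd; elim: r => [|i r IH].
  apply: (@Cderivable_ext (fun=> 1)) => [y|]; first by rewrite big_nil.
  exact: Cderivable_cst.
case Pi : (P i); last first.
  by apply: Cderivable_ext IH => y; rewrite big_cons Pi.
apply: Cderivable_ext (CderivableM (fd i) IH) => y.
by rewrite big_cons Pi.
Qed.

Lemma Cderivable_horner (p : {poly C}) z : derivable (fun y => p.[y]) z 1.
Proof.
elim/poly_ind: p => [|p c IH].
  by apply: Cderivable_ext (@Cderivable_cst R 0 z) => y; rewrite horner0.
have h := CderivableD (CderivableM IH (@Cderivable_id R z)) (@Cderivable_cst R c z).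
by apply: Cderivable_ext h => y; rewrite hornerMXaddC.
Qed.

Definition mx_derivable m n (M : C -> 'M[C]_(m, n)) (z : C) :=
  forall i j, derivable (fun y => M y i j : C) z 1.

Lemma mx_derivableM m n p (M : C -> 'M[C]_(m, n)) (M' : C -> 'M[C]_(n, p)) z :
  mx_derivable M z -> mx_derivable M' z -> mx_derivable (fun y => M y *m M' y) z.
Proof.
move=> dM dM' i j.
have h : derivable (fun y => \sum_k M y i k * M' y k j : C) z 1.
  by apply: Cderivable_sum => k; apply: (CderivableM (dM i k) (dM' k j)).
by apply: Cderivable_ext h => y; rewrite mxE.
Qed.

Lemma det_derivable n (M : C -> 'M[C]_n) z :
  mx_derivable M z -> derivable (fun y => \det (M y) : C) z 1.
Proof.
move=> dM; apply: Cderivable_sum => s.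
apply: (CderivableM (@Cderivable_cst R _ z)).
by apply: Cderivable_prod => i; apply: dM.
Qed.

(** Adjugate over determinant. The formula describes [invmx] only where the determinant is nonzero,
    which holds near z. *)
Lemma invmx_derivable n (M : C -> 'M[C]_n) z : M z \in unitmx ->
  mx_derivable M z -> mx_derivable (fun y => invmx (M y)) z.
Proof.
move=> uM dM i j.
have dz : \det (M z) != 0 by rewrite -unitfE -unitmxE.
have [d d0 hd] := derivable_near_neq0 (det_derivable dM) dz.
have ad : derivable (fun y => \adj (M y) i j : C) z 1.
  have h : derivable (fun y => (-1) ^+ (j + i) * \det (row' j (col' i (M y))) : C) z 1.
    apply: (CderivableM (@Cderivable_cst R _ z)).
    apply: (@det_derivable _ (fun y => row' j (col' i (M y)))) => k l.
    by apply: Cderivable_ext (dM (lift j k) (lift i l)) => y; rewrite !mxE.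
  by apply: Cderivable_ext h => y; rewrite mxE.
have h := CderivableM (CderivableV (f := fun y => \det (M y) : C) dz (det_derivable dM)) ad.
apply: (derivable_near_eq d0 _ h) => y /hd dy.
by rewrite /invmx unitmxE unitfE dy [RHS]mxE.
Qed.

Lemma horner_mx_derivable m n (G : 'M[{poly C}]_(m, n)) z :
  mx_derivable (fun y => map_mx (horner_eval y) G) z.
Proof.
move=> i j; have h := @Cderivable_horner (G i j) z. apply: Cderivable_ext h => y.
by rewrite mxE.
Qed.

End MatrixDerivability.

Section LiftingCore.
Variable R : realType.
Local Notation C := (CC R).
Local Notation ev := (fun z => map_mx (horner_eval z)).

(** Brings an invertible matrix into SL_n, where interpolation is available; [conj_scale] discards
    the scalar later. *)
Lemma scale_det1 n (T : 'M[C]_n.+1) : T \in unitmx ->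
  exists2 c : C, c != 0 & \det (c *: T) = 1.
Proof.
rewrite unitmxE unitfE => dT; exists (n.+1.-root (\det T)^-1).
  by rewrite rootC_eq0 // invr_eq0.
by rewrite detZ rootCK // mulVf.
Qed.

Lemma map_horner_lin m n z (A B : 'M[{poly C}]_(m, n)) p :
  ev z (A + p *: B) = ev z A + p.[z] *: ev z B.
Proof. by apply/matrixP => i j; rewrite !mxE /horner_eval hornerD hornerM. Qed.

Lemma map_hornerM m n p z (A : 'M[{poly C}]_(m, n)) (B : 'M[{poly C}]_(n, p)) :
  ev z (A *m B) = ev z A *m ev z B.
Proof. exact: map_mxM. Qed.

Lemma map_hornerC m n z (A : 'M[C]_(m, n)) : ev z (map_mx polyC A) = A.
Proof. by apply/matrixP => i j; rewrite !mxE /horner_eval hornerC. Qed.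

Lemma companion_horner n (p : C -> {poly C}) z :
  (forall i, derivable (fun y => (p y)`_i : C) z 1) ->
  mx_derivable (fun y => companion n (p y)) z.
Proof.
move=> dp i j.
case ei : (i == n.-1 :> nat).
  apply: (@Cderivable_ext R (fun y => 0 - (p y)`_j)) => [y|].
    by rewrite mxE ei sub0r.
  exact: (CderivableB (@Cderivable_cst R 0 z) (dp j)).
apply: (@Cderivable_ext R (fun y => (i.+1 == j)%:R)) => [y|].
  by rewrite mxE ei.
exact: Cderivable_cst.
Qed.

Variables (n N : nat) (alpha : 'I_N -> C).
Hypothesis alpha_inj : injective alpha.
Variables (E S T J : 'I_N -> 'M[C]_n.+1) (w : 'I_N -> 'I_n.+1 -> nat).
Hypothesis Eu : forall j, E j \in unitmx.
Hypothesis Su : forall j, S j \in unitmx.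
Hypothesis JE : forall j a b, J j a b = if w j a == w j b then T j a b else 0.
Hypothesis wT : forall j a b, T j a b != 0 -> (w j b <= w j a)%N.

Let delta j a : {poly C} :=
  \prod_(k | k != j) ('X - (alpha k)%:P) ^+ w k a.
Let Delta : 'M[{poly C}]_n.+1 :=
  diag_mx (\row_a \prod_k ('X - (alpha k)%:P) ^+ w k a).

Let delta_neq0 j a : (delta j a).[alpha j] != 0.
Proof.
rewrite horner_prod; apply/prodf_neq0 => k kj.
by rewrite horner_exp expf_neq0 // hornerXsubC subr_eq0 eq_sym (inj_eq alpha_inj).
Qed.

(* Near alpha_j, the rows of G are a basis of the lattice of rows f such that
   coordinate a of f E_j is divisible by (z - alpha_j) ^ w_j a. *)
Lemma frame : exists G : 'M[{poly C}]_n.+1,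
  (forall z, (forall j, z != alpha j) -> ev z G \in unitmx) /\
  forall j, exists (U : 'M[{poly C}]_n.+1) (c : C),
    [/\ c != 0, ev (alpha j) U = c *: S j &
      forall z, ev z G *m E j = ev z U *m diag_mx (\row_a (z - alpha j) ^+ w j a)].
Proof.
(* Larger than every weight: Q approximates c_j E_j^-1 modulo x ^ M, so the error survives division
   by x ^ (w j b) and still vanishes at alpha_j. *)
pose M := (\sum_j \sum_a w j a).+1.
have wM j a : (w j a < M)%N.
  by rewrite ltnS (bigD1 j) //= (bigD1 a) //= -addnA leq_addr.
have hT j : {c : C | c != 0 & \det (c *: invmx (E j)) = 1}.
  by apply: cid2; apply: scale_det1; rewrite unitmx_inv.
pose c j := s2val (hT j).
have [Q dQ hQ] := sl_interpolation M alpha_inj (fun j => s2valP' (hT j)).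
(* The inverse of the value at alpha_j of [U0] below. Q' is S_j D_j there up to a scalar, so Q' U0
   takes a multiple of S_j as its value; first order interpolation is enough for Q'. *)
pose D j : 'M[C]_n.+1 := diag_mx (\row_a (c j * (delta j a).[alpha j])^-1).
have uD j : D j \in unitmx.
  rewrite unitmxE unitfE det_diag; apply/prodf_neq0 => a _.
  by rewrite mxE invr_eq0 mulf_neq0 // (s2valP (hT j)).
have hS j : {k : C | k != 0 & \det (k *: (S j *m D j)) = 1}.
  by apply: cid2; apply: scale_det1; rewrite unitmx_mul Su uD.
have [Q' dQ' hQ'] := sl_interpolation 1 alpha_inj (fun j => s2valP' (hS j)).
exists (Q' *m Delta *m Q); split.
  move=> z hz; rewrite unitmxE unitfE det_map_mx !det_mulmx dQ dQ' mulr1 mul1r.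
  rewrite det_diag rmorph_prod; apply/prodf_neq0 => a _.
  rewrite mxE rmorph_prod; apply/prodf_neq0 => k _.
  by rewrite /= /horner_eval horner_exp expf_neq0 // hornerXsubC subr_eq0.
move=> j; have [Z QZ] := hQ j; have [Z' QZ'] := hQ' j.
pose Y := Z *m map_mx polyC (E j).
pose U0 : 'M[{poly C}]_n.+1 := \matrix_(a, b) (delta j a *
   (((a == b)%:R * c j)%:P + ('X - (alpha j)%:P) ^+ (M + w j a - w j b) * Y a b)).
exists (Q' *m U0), (s2val (hS j)); split.
- exact: (s2valP (hS j)).
- have U0E : ev (alpha j) U0 = invmx (D j).
    apply/matrixP => a b.
    rewrite -[RHS](_ : diag_mx (\row_a (c j * (delta j a).[alpha j])) a b = _); last first.
      congr (fun_of_matrix _ a b).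
      apply: (can_inj (mulKmx (uD j))); rewrite mulmxV // mulmx_diag.
      apply/matrixP => x y; rewrite !mxE; case: eqP => // _.
      by rewrite mulVf // mulf_neq0 // (s2valP (hT j)).
    rewrite !mxE /horner_eval hornerM hornerD hornerM horner_exp hornerXsubC subrr hornerC.
    have -> : 0 ^+ (M + w j a - w j b) = 0 :> C.
      by rewrite expr0n subn_eq0 leqNgt ltn_addr.
    rewrite mul0r addr0; case: eqP => _; last by rewrite mul0r mulr0 mulr0n.
    by rewrite mul1r mulrC mulr1n.
  rewrite map_mxM U0E QZ' expr1 map_horner_lin map_hornerC hornerXsubC subrr.
  by rewrite scale0r addr0 -scalemxAl mulmxK.
- move=> z; rewrite (map_hornerM z _ Q) (map_hornerM z _ Delta) (map_hornerM z _ U0).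
  rewrite -!mulmxA; congr (_ *m _).
  have QE : ev z Q *m E j = (c j)%:M + (z - alpha j) ^+ M *: ev z Y.
    rewrite QZ map_horner_lin map_hornerC mulmxDl.
    rewrite -!scalemxAl (mulVmx (Eu j)) scalemx1.
    by rewrite horner_exp hornerXsubC map_hornerM map_hornerC.
  have DE : ev z Delta
      = diag_mx (\row_a ((delta j a).[z] * (z - alpha j) ^+ w j a)).
    rewrite map_diag_mx; congr diag_mx; apply/rowP => a; rewrite !mxE.
    rewrite /= /horner_eval (bigD1 j) //= hornerM horner_exp hornerXsubC mulrC.
    by [].
  rewrite QE DE; clearbody Y; apply/matrixP => a b.
  rewrite mul_diag_mx mul_mx_diag [LHS]mxE [RHS]mxE.
  set x := z - alpha j.
  have -> : (ev z U0) a b = (delta j a).[z]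
      * ((a == b)%:R * c j + x ^+ (M + w j a - w j b) * (Y a b).[z]).
    by rewrite 2!mxE /horner_eval hornerM hornerD hornerC hornerM horner_exp hornerXsubC.
  rewrite !mxE /horner_eval -/x.
  move: (delta j a).[z] (Y a b).[z] => d y.
  have xx : x ^+ w j a * x ^+ M = x ^+ (M + w j a - w j b) * x ^+ w j b.
    by rewrite -!exprD subnK ?[(M + _)%N]addnC // -[w j b]add0n leq_add // ltnW.
  case: (eqVneq a b) xx => [-> _|_ xx].
    by rewrite mul1r mulr1n addnK; ring.
  rewrite mul0r mulr0n !add0r.
  transitivity (d * y * (x ^+ w j a * x ^+ M)); first by ring.
  by rewrite xx; ring.
Qed.

Lemma alpha_isolated z : exists2 d : C, 0 < d &
  forall y, `|y - z| < d -> forall k, alpha k != z -> y != alpha k.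
Proof.
apply/near_nbhs_ball.
apply: (@filter_forall C 'I_N (fun k y => alpha k != z -> y != alpha k) (nbhs z)) => k.
apply/near_nbhs_ball.
have [->|kz] := eqVneq (alpha k) z; first by exists 1.
exists `|alpha k - z|; first by rewrite normr_gt0 subr_eq0.
by move=> y yz _; apply/eqP => yk; move: yz; rewrite yk ltxx.
Qed.

Variables (p : C -> {poly C}) (r rho : 'I_N -> 'I_n.+1 -> C -> C).
Hypothesis p_monic : forall z, p z \is monic.
Hypothesis p_size : forall z, size (p z) = n.+2.
Hypothesis p_hol : forall z, unit_disc z ->
  forall i, derivable (fun y => (p y)`_i : C) z 1.
Hypothesis companionE : forall j z x b, (companion n.+1 (p z) *m E j) x b
  = (E j *m T j) x b - (x == n :> nat)%:R * r j b z.
Hypothesis rE : forall j b z, r j b z = (z - alpha j) ^+ (w j b).+1 * rho j b z.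
Hypothesis rho_hol : forall j b z, unit_disc z -> derivable (rho j b) z 1.
Hypothesis charT : forall j, char_poly (T j) = char_poly (J j).

(** The conjugate by diag (x ^ w) of the companion matrix in Taylor coordinates, negative powers of
    x being cancelled in advance. The last column of E_j^-1 is the constant column of the rank one
    term. *)
Let lift j z : 'M[C]_n.+1 := \matrix_(a, b)
  ((z - alpha j) ^+ (w j a - w j b) * T j a b
   - (z - alpha j) ^+ (w j a).+1 * invmx (E j) a ord_max * rho j b z).

(** 0 ^ (w a - w b) is 1 only if w a <= w b, and [wT] gives the opposite inequality wherever T has a
    nonzero entry. *)
Lemma lift_alpha j : lift j (alpha j) = J j.
Proof.
apply/matrixP => a b; rewrite mxE JE subrr [0 ^+ (w j a).+1]expr0n !mul0r subr0.
rewrite expr0n subn_eq0; have [Tab|/wT ba] := eqVneq (T j a b) 0.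
  by rewrite Tab mulr0 if_same.
by rewrite eqn_leq ba andbT; case: leqP => _; rewrite ?mul1r ?mul0r.
Qed.

Lemma liftE j z : lift j z *m diag_mx (\row_a (z - alpha j) ^+ w j a)
  = diag_mx (\row_a (z - alpha j) ^+ w j a) *m
    (invmx (E j) *m companion n.+1 (p z) *m E j).
Proof.
rewrite -mulmxA.
have -> : companion n.+1 (p z) *m E j = E j *m T j - \matrix_(x, b) ((x == n :> nat)%:R * r j b z).
  by apply/matrixP => x b; rewrite companionE [RHS]mxE [X in _ = _ + X]mxE [X in _ = _ - X]mxE.
rewrite mulmxBr mulKmx //; apply/matrixP => a b.
rewrite mul_diag_mx mul_mx_diag [LHS]mxE [RHS]mxE [lift j z a b]mxE.
have mxB (X Y : 'M[C]_n.+1) : (X - Y) a b = X a b - Y a b by rewrite !mxE.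
rewrite [(\row_a0 _) 0 a]mxE [(\row_a0 _) 0 b]mxE mxB.
set x := z - alpha j.
have -> : (invmx (E j) *m \matrix_(x0, b0) ((x0 == n :> nat)%:R * r j b0 z)) a b
    = invmx (E j) a ord_max * r j b z.
  rewrite mxE (bigD1 ord_max) //= [X in _ + X]big1 => [|y yn].
    by rewrite mxE eqxx mul1r addr0.
  by rewrite mxE -(inj_eq val_inj) /= in yn *; rewrite (negPf yn) mul0r mulr0.
have E1 : x ^+ (w j a - w j b) * T j a b * x ^+ w j b = x ^+ w j a * T j a b.
  have [->|/wT ba] := eqVneq (T j a b) 0; first by rewrite !mulr0 mul0r.
  by rewrite mulrAC -exprD subnK.
rewrite mulrBl E1 rE -/x !exprS; ring.
Qed.

Lemma lift_derivable j z : unit_disc z -> mx_derivable (lift j) z.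
Proof.
move=> zD a b.
have xd k : derivable (fun y => (y - alpha j) ^+ k : C) z 1.
  apply: Cderivable_ext (@Cderivable_horner R (('X - (alpha j)%:P) ^+ k) z) => y.
  by rewrite horner_exp hornerXsubC.
have d1 := CderivableM (xd (w j a - w j b)%N) (@Cderivable_cst R (T j a b) z).
have d2 := CderivableM (xd (w j a).+1) (@Cderivable_cst R (invmx (E j) a ord_max) z).
have h := CderivableB d1 (CderivableM d2 (@rho_hol j b z zD)).
by apply: Cderivable_ext h => y; rewrite mxE.
Qed.

(** Phi is G C G^-1 off the nodes and S_j J_j S_j^-1 at alpha_j. Near alpha_j both are given by U
    [lift] U^-1, which is differentiable there. *)
Theorem lifting : exists Phi : C -> 'M[C]_n.+1,
  [/\ forall z, unit_disc z -> mx_derivable Phi z,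
      forall z, char_poly (Phi z) = p z,
      forall j, Phi (alpha j) = S j *m J j *m invmx (S j)
    & forall z, (forall j, z != alpha j) -> exists2 G, G \in unitmx &
        Phi z = G *m companion n.+1 (p z) *m invmx G].
Proof.
have [G [Gu hG]] := frame.
pose A j := S j *m J j *m invmx (S j).
pose Phi z := if [pick j | z == alpha j] is Some j then A j
  else ev z G *m companion n.+1 (p z) *m invmx (ev z G).
have PhiA j : Phi (alpha j) = A j.
  rewrite /Phi; case: pickP => [k /eqP/alpha_inj -> //|/(_ j)].
  by rewrite eqxx.
have PhiG z : (forall j, z != alpha j) ->
    Phi z = ev z G *m companion n.+1 (p z) *m invmx (ev z G).
  by move=> hz; rewrite /Phi; case: pickP => // k /eqP zk; have := hz k; rewrite zk eqxx.
have ndisj z : (forall j, z != alpha j) \/ exists j, z = alpha j.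
  have [/existsP[j /eqP ->]|/existsPn h] := boolP [exists j, z == alpha j].
    by right; exists j.
  by left.
exists Phi; split.
- move=> z zD; have [d d0 hd] := alpha_isolated z.
  case: (ndisj z) => [hz|[j zj]].
    have hy y : `|y - z| < d -> forall k, y != alpha k.
      by move=> /hd h k; apply: h; rewrite eq_sym.
    have dG : mx_derivable (fun y => ev y G *m companion n.+1 (p y) *m invmx (ev y G)) z.
      apply: mx_derivableM; last first.
        by apply: invmx_derivable; [exact: Gu|exact: horner_mx_derivable].
      apply: mx_derivableM; first exact: horner_mx_derivable.
      exact/companion_horner/p_hol.
    move=> a b; apply: (derivable_near_eq d0 _ (dG a b)) => y yz.
    by rewrite (PhiG y (hy y yz)).
  have [U [c [c0 Ualpha GE]]] := hG j.
  have Uz : ev z U \in unitmx.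
    by rewrite zj Ualpha unitmxZ ?unitfE.
  have dz : \det (ev z U) != 0 by rewrite -unitfE -unitmxE.
  have [d1 d10 hd1] := derivable_near_neq0 (det_derivable (@horner_mx_derivable R _ _ U z)) dz.
  have [e e0 [ed ed1]] := pos_min2 d0 d10.
  have dU : mx_derivable (fun y => ev y U *m lift j y *m invmx (ev y U)) z.
    apply: mx_derivableM; last first.
      by apply: invmx_derivable; [exact: Uz|exact: horner_mx_derivable].
    apply: mx_derivableM; first exact: horner_mx_derivable.
    exact: lift_derivable.
  move=> a b; apply: (derivable_near_eq e0 _ (dU a b)) => y yz.
  have Uy : ev y U \in unitmx.
    by rewrite unitmxE unitfE; apply: hd1; apply: lt_le_trans yz ed1.
  have [->|yzn] := eqVneq y z.
    by rewrite zj PhiA lift_alpha Ualpha (conj_scale _ c0 (Su j)).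
  have hy k : y != alpha k.
    have [kz|] := eqVneq (alpha k) z; first by rewrite kz.
    by apply: hd; apply: lt_le_trans yz ed.
  rewrite (PhiG y hy); congr (fun_of_matrix _ a b).
  exact: (conj_factor (Gu y hy) Uy (Eu j) (GE y) (liftE j y)).
- move=> z; case: (ndisj z) => [hz|[j ->]].
    rewrite PhiG // -[RHS](char_poly_companion (p_monic z) (p_size z)).
    by symmetry; apply: (char_poly_similar (Gu z hz)); rewrite mulmxKV // Gu.
  (* At a node the row r is 0, so E_j makes the companion matrix similar to T_j. *)
  rewrite PhiA -[RHS](char_poly_companion (p_monic _) (p_size _)).
  rewrite (_ : char_poly (A j) = char_poly (T j)); last first.
    rewrite charT; symmetry; apply: (char_poly_similar (Su j)).
    by rewrite /A mulmxKV.
  apply: (char_poly_similar (Eu j)); apply/matrixP => x b.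
  by rewrite companionE rE subrr expr0n mul0r mulr0 subr0.
- exact: PhiA.
- by move=> z hz; exists (ev z G); [exact: Gu | exact: PhiG].
Qed.

End LiftingCore.

(** * Necessity *)

Section BlockCounting.
Implicit Types (K Z : pred nat) (L : seq nat).

Let widths a L := pairmap (fun x y => y - x)%N a L.

Lemma path_leq_last a L : path leq a L -> (a <= last a L)%N.
Proof. by elim: L a => //= x L IH a /andP[ax /IH]; apply: leq_trans. Qed.

Lemma path_leq_last_take a L t : path leq a L ->
  all (leq^~ (last a (take t L))) (take t L).
Proof.
elim: L a t => [|x L IH] a [|t] //= /andP[ax pL].
by rewrite IH // path_leq_last // take_path.
Qed.

Lemma last_take_widths a L t : path leq a L ->
  last a (take t L) = (a + sumn (take t (widths a L)))%N.
Proof.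
elim: L a t => [|x L IH] a [|t] //=; rewrite ?addn0 // => /andP[ax pL].
by rewrite IH // addnA subnKC.
Qed.

(** If the head is not selected, shifting the initial segment by one can only increase its sum, by
    sortedness. This is where the non-decreasing order of block sizes enters. *)
Lemma sumn_take_mask (b : bitseq) L : sorted leq L -> size b = size L ->
  (sumn (take (count id b) L) <= sumn (mask b L))%N.
Proof.
elim: b L => [|[] b IH] [|x L] //= sL [sb].
  by rewrite leq_add2l IH // (path_sorted sL).
apply: leq_trans (IH L (path_sorted sL) sb).
have : (count id b <= size L)%N by rewrite -sb count_size.
elim: (count id b) x L sL {IH sb} => [|c IH] x L sL //.
case: L sL => // y L /= /andP[xy sL] cL; apply: leq_add => //.
exact: IH.
Qed.

Let full K a L := pairmap (fun x y => all K (iota x (y - x))) a L.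

Lemma sumn_mask_full K a L : path leq a L ->
  (sumn (mask (full K a L) (widths a L)) <= count K (iota a (last a L - a)))%N.
Proof.
elim: L a => [|x L IH] a //= /andP[ax pL].
have xl := path_leq_last pL.
rewrite (_ : last x L - a = (x - a) + (last x L - x))%N; last by lia.
rewrite iotaD count_cat subnKC //; case: ifP => h /=.
  rewrite leq_add ?IH //.
  by move: h; rewrite all_count size_iota => /eqP->.
by rewrite (leq_trans (IH x pL)) // leq_addl.
Qed.

(* The places outside K whose successor is in K or starts a new block: there is one
   in each block not contained in K. *)
Let bad K Z (p : nat) := ~~ K p && (K p.+1 || Z p.+1).

(** The last place of the block outside K is bad: its successor is in K or starts the next block. *)
Lemma bad_in_block K Z a c : Z (a + c)%N -> ~~ all K (iota a c) ->
  (0 < count (bad K Z) (iota a c))%N.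
Proof.
elim: c a => [|c IH] a Zc //=; rewrite negb_and -has_predC.
case: (boolP (all K (iota a.+1 c))) => [ok|no _]; last first.
  by rewrite addn_gt0 IH ?orbT // addSnnS.
rewrite has_predC ok orbF => Ka; rewrite addn_gt0 /bad Ka /=.
case: c IH Zc ok => [|c] IH Zc /=; first by rewrite addn1 in Zc; rewrite Zc orbT.
by move=> /andP[-> _].
Qed.

Lemma count_not_full_bad K Z a L : path leq a L -> all Z L ->
  (count negb (full K a L) <= count (bad K Z) (iota a (last a L - a)))%N.
Proof.
elim: L a => [|x L IH] a //= /andP[ax pL] /andP[Zx ZL].
have xl := path_leq_last pL.
rewrite (_ : last x L - a = (x - a) + (last x L - x))%N; last by lia.
rewrite iotaD count_cat subnKC // leq_add ?IH //.
case: (boolP (all K _)) => //= h; rewrite bad_in_block //.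
by rewrite subnKC.
Qed.

(* Since widths increase, the blocks contained in K are at most as many as the
   leading blocks of total width <= k, whose right ends are all <= k. *)
Lemma bad_count K Z L k : path leq 0%N L -> sorted leq (widths 0 L) ->
  all Z L -> (count K (iota 0 (last 0%N L)) <= k)%N ->
  (count (fun l => (k < l)%N) L <= count (bad K Z) (iota 0 (last 0%N L)))%N.
Proof.
move=> pL sW ZL Kk; have := count_not_full_bad K pL ZL; rewrite subn0.
apply: leq_trans; set b := full K 0 L; pose f := count id b.
have sb : size b = size (widths 0 L) by rewrite !size_pairmap.
have fk : (last 0%N (take f L) <= k)%N.
  rewrite last_take_widths // add0n; apply: leq_trans Kk.
  apply: leq_trans (sumn_take_mask sW sb) _.
  by have := sumn_mask_full K pL; rewrite subn0.
have h : count (fun l => (k < l)%N) (take f L) = 0%N.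
  apply/eqP; rewrite -leqn0 leqNgt -has_count -all_predC.
  apply: sub_all (path_leq_last_take f pL) => l /= lf.
  by rewrite -leqNgt (leq_trans lf).
rewrite -[L in X in (X <= _)%N](cat_take_drop f) count_cat h add0n.
apply: leq_trans (count_size _ _) _; rewrite size_drop.
have := count_predC id b; rewrite /f sb size_pairmap => <-.
by rewrite addKn; apply: eq_leq; apply: eq_count.
Qed.

End BlockCounting.

Section JordanDefect.
Variable F : fieldType.

(** [bad_count] for the list of right ends of blocks, that is, the later block starts followed by m.
    Since k < m, the final m accounts for the 1 in [jordan_d]. *)
Lemma jordan_d_count m (lam : F) (B : 'M[F]_m) (k : nat) (K : pred nat) :
  single_jordan_form lam B -> (k < m)%N -> (count K (iota 0 m) <= k)%N ->
  (jordan_d B (m - k) <= #|[pred p : 'I_m | ~~ K p &&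
     [|| K p.+1, p.+1 == m | [exists q : 'I_m, (p.+1 == q :> nat) && (B p q == 0%R)]]]|)%N.
Proof.
move=> [Bform Bsort] km Kk; rewrite /jordan_d (subKn (ltnW km)).
pose L := rcons [seq val l | l <- enum (superdiag_zeros B)] m.
pose Z l := l \in L.
have Lm : last 0%N L = m by rewrite last_rcons.
have pL : path leq 0%N L.
  rewrite /L rcons_path; apply/andP; split.
    rewrite path_min_sorted; last by apply/allP.
    have : subseq [seq val l | l <- enum (superdiag_zeros B)] (iota 0 m).
      rewrite -val_enum_ord; apply: map_subseq.
      by rewrite [enum 'I_m]enumT; apply: filter_subseq.
    by move=> /(subseq_sorted leq_trans); apply; exact: iota_sorted.
  have := mem_last 0%N [seq val l | l <- enum (superdiag_zeros B)].
  rewrite inE => /orP[/eqP-> //|/mapP[l _ ->]].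
  by apply: ltnW; apply: (valP l).
have ZL : all Z L by apply/allP.
have := @bad_count K Z L k pL Bsort ZL; rewrite Lm => /(_ Kk).
rewrite /L -cats1 count_cat /= km addn0 addn1 => h.
rewrite add1n; apply: leq_trans (leq_trans _ h) _.
  rewrite ltnS count_map -sum1_card -sum1_count big_enum_cond /=.
  by apply: eq_leq; apply: eq_bigl => l; rewrite inE.
rewrite -val_enum_ord count_map -sum1_count big_enum_cond sum1_card /=.
apply/subset_leq_card/fintype.subsetP => p; rewrite unfold_in => /andP[Kp {}h].
apply/andP; split; first exact: Kp.
suff -> : [|| K p.+1, p.+1 == m
    | [exists q : 'I_m, (p.+1 == q :> nat) && (B p q == 0%R)]] by [].
case/orP: h => [->//|]; rewrite /Z /L mem_rcons inE => /orP[->|]; first by rewrite orbT.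
move=> /mapP[l]; rewrite mem_enum inE => /existsP[p' /andP[/eqP pl Bl]] pl'.
apply/orP; right; apply/orP; right; apply/existsP; exists l; rewrite pl' eqxx /=.
by have -> : p = p' by apply: val_inj; move: pl; rewrite -pl' => -[].
Qed.

End JordanDefect.

Section PermutationExpansion.
Variable F : fieldType.

Lemma taylor_coef_XsubX (x : F) k q :
  taylor_coef x k (('X - x%:P) ^+ q) = (q == k)%:R.
Proof.
elim: q k => [|q IH] k; last by rewrite exprSr taylor_coefMXsub; case: k => [|k].
case: k => [|k]; first by rewrite expr0 /taylor_coef nderivn0 hornerC.
by rewrite expr0 /taylor_coef nderivn_poly0 ?horner0 // size_poly1.
Qed.

(** On the diagonal X - M a a = (X - x) + (x - M a a). K is the set of rows where X - x is chosen;
    the permutation must fix it, and only |K| = k contributes to order k. *)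
Lemma taylor_coef_char_poly n (M : 'M[F]_n) x k :
  taylor_coef x k (char_poly M) = \sum_(s : 'S_n) \sum_(K : {set 'I_n})
    ((-1) ^+ s * ([forall a in K, s a == a] && (#|K| == k))%:R)
    * \prod_(a | a \notin K) (x *+ (a == s a) - M a (s a)).
Proof.
have E : char_poly M = \sum_(s : 'S_n) \sum_(K : {set 'I_n})
    ((-1) ^+ s * ([forall a in K, s a == a])%:R
    * \prod_(a | a \notin K) (x *+ (a == s a) - M a (s a))) *: ('X - x%:P) ^+ #|K|.
  apply: eq_bigr => s _.
  rewrite (eq_bigr (fun a => (('X - x%:P) *+ (a == s a))
      + (x *+ (a == s a) - M a (s a))%:P)) => [|a _]; last first.
    rewrite !mxE polyCB rmorphMn /=; case: (_ == _); rewrite ?mulr1n ?mulr0n; ring.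
  rewrite bigA_distr mulr_sumr; apply: eq_bigr => K _.
  rewrite (bigID (mem K)) /=.
  rewrite (eq_bigr (fun a => ('X - x%:P) *+ (a == s a))) => [|a ->] //.
  rewrite [X in _ * (_ * X)](eq_bigr (fun a => (x *+ (a == s a) - M a (s a))%:P)) => [|a /negPf ->] //.
  rewrite -rmorph_prod /=; set c := \prod_(a | a \notin K) _.
  have -> : \prod_(a in K) (('X - x%:P) *+ (a == s a))
      = ([forall a in K, s a == a])%:R * ('X - x%:P) ^+ #|K|.
    case: (boolP [forall a in K, s a == a]) => [/forall_inP h|/forall_inPn[a aK sa]].
      rewrite mul1r -prodr_const; apply: eq_bigr => a aK.
      by rewrite eq_sym h.
    by rewrite (bigD1 a) //= eq_sym (negPf sa) mulr0n !mul0r.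
  rewrite -mul_polyC 2!polyCM polyC_natr.
  have -> : ((-1) ^+ s)%:P = (-1) ^+ s :> {poly F} by rewrite rmorph_sign.
  by rewrite -!mulrA [c%:P * _]mulrC.
rewrite E /taylor_coef; transitivity (\sum_(s : 'S_n) taylor_coef x k (\sum_(K : {set 'I_n})
    ((-1) ^+ s * ([forall a in K, s a == a])%:R
    * \prod_(a | a \notin K) (x *+ (a == s a) - M a (s a))) *: ('X - x%:P) ^+ #|K|)).
  have := taylor_coef_sum (index_enum 'S_n) (fun=> 1) (fun s => \sum_(K : {set 'I_n})
    ((-1) ^+ s * ([forall a in K, s a == a])%:R
    * \prod_(a | a \notin K) (x *+ (a == s a) - M a (s a))) *: ('X - x%:P) ^+ #|K|) x k.
  rewrite (eq_bigr _ (fun s _ => scale1r _)) /taylor_coef => ->.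
  by apply: eq_bigr => s _; rewrite mul1r.
apply: eq_bigr => s _; rewrite taylor_coef_sum; apply: eq_bigr => K _.
by rewrite taylor_coef_XsubX -mulnb natrM mulrAC mulrA.
Qed.

End PermutationExpansion.

Section Vanishing.
Variable R : realType.
Local Notation C := (CC R).
Implicit Types (f g : C -> C) (a : C).

Lemma vanishes_toP m a f : vanishes_to m a f -> exists M d,
  [/\ 0 <= M, 0 < d & forall z, `|z - a| < d -> z != a -> `|f z| <= M * `|z - a| ^+ m].
Proof.
move=> [M [d [d0 h]]]; exists `|M|, d; split=> // z zd za.
have h1 := h z zd za.
have r : 0 <= M * `|z - a| ^+ m by apply: le_trans h1.
have z0 : 0 < `|z - a| ^+ m by rewrite exprn_gt0 // normr_gt0 subr_eq0.
have M0 : 0 <= M by rewrite -(pmulr_lge0 _ z0).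
by rewrite (ger0_norm M0).
Qed.

Lemma vanishes_toD m a f g : vanishes_to m a f -> vanishes_to m a g ->
  vanishes_to m a (fun z => f z + g z).
Proof.
move=> [M [d [d0 h]]] [M' [d' [d0' h']]].
have [e e0 [ed ed']] := pos_min2 d0 d0'.
exists (M + M'), e; split=> // z ze za; rewrite mulrDl.
apply: le_trans (ler_normD _ _) (lerD _ _).
  exact: h (lt_le_trans ze ed) za.
exact: h' (lt_le_trans ze ed') za.
Qed.

Lemma vanishes_toM m m' a f g : vanishes_to m a f -> vanishes_to m' a g ->
  vanishes_to (m + m') a (fun z => f z * g z).
Proof.
move=> /vanishes_toP[M [d [M0 d0 h]]] /vanishes_toP[M' [d' [M0' d0' h']]].
have [e e0 [ed ed']] := pos_min2 d0 d0'.
exists (M * M'), e; split=> // z ze za; rewrite normrM exprD mulrACA.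
by apply: ler_pM => //; [exact: h (lt_le_trans ze ed) za | exact: h' (lt_le_trans ze ed') za].
Qed.

Lemma vanishes_to_eq m a f g d : 0 < d ->
  (forall z, `|z - a| < d -> f z = g z) -> vanishes_to m a f -> vanishes_to m a g.
Proof.
move=> d0 fg [M [d' [d0' h]]]; have [e e0 [ed ed']] := pos_min2 d0 d0'.
exists M, e; split=> // z ze za.
by rewrite -fg ?(lt_le_trans ze ed) // h // (lt_le_trans ze ed').
Qed.

Lemma vanishes_to_ext m a f g : (forall z, f z = g z) ->
  vanishes_to m a f -> vanishes_to m a g.
Proof. by move=> /funext ->. Qed.

Lemma vanishes_to_cst a (c : C) : vanishes_to 0 a (fun=> c).
Proof. by exists `|c|, 1; split=> // z _ _; rewrite expr0 mulr1. Qed.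

Lemma vanishes_to0 m a : vanishes_to m a (fun=> 0 : C).
Proof. by exists 0, 1; split=> // z _ _; rewrite mul0r normr0. Qed.

Lemma vanishes_toZ m a (c : C) f : vanishes_to m a f ->
  vanishes_to m a (fun z => c * f z).
Proof. by move=> h; have := vanishes_toM (vanishes_to_cst a c) h. Qed.

Lemma vanishes_to_sum (I : Type) (r : seq I) m a (f : I -> C -> C) :
  (forall i, vanishes_to m a (f i)) -> vanishes_to m a (fun z => \sum_(i <- r) f i z).
Proof.
move=> h; elim: r => [|i r IH].
  by apply: vanishes_to_ext (vanishes_to0 m a) => z; rewrite big_nil.
by apply: vanishes_to_ext (vanishes_toD (h i) IH) => z; rewrite big_cons.
Qed.

Lemma vanishes_to_prod (I : Type) (r : seq I) (P : pred I) (o : I -> nat) a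
    (f : I -> C -> C) : (forall i, vanishes_to (o i) a (f i)) ->
  vanishes_to (\sum_(i <- r | P i) o i) a (fun z => \prod_(i <- r | P i) f i z).
Proof.
move=> h; elim: r => [|i r IH].
  rewrite big_nil; apply: vanishes_to_ext (vanishes_to_cst a 1) => z.
  by rewrite big_nil.
rewrite big_cons; case Pi : (P i); last first.
  by apply: vanishes_to_ext IH => z; rewrite big_cons Pi.
by apply: vanishes_to_ext (vanishes_toM (h i) IH) => z; rewrite big_cons Pi.
Qed.

Lemma derivable_vanishes f a : derivable f a 1 -> vanishes_to 1 a (fun z => f z - f a).
Proof.
move=> /derivable_lip[M [d [_ d0 h]]]; exists M, d; split=> // z zd _.
by rewrite expr1 h.
Qed.

End Vanishing.

Section Necessity.
Variable R : realType.
Local Notation C := (CC R).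
Variables (s : nat) (lam : 'I_s -> C) (m : 'I_s -> nat).
Variable (B : forall i, 'M[C]_(m i)).
Hypothesis BJ : forall i, single_jordan_form (lam i) (B i).
Local Notation n := (\sum_i m i)%N.
Local Notation J := (\mxdiag_i B i).

Lemma Rank_inj i : injective (@tagnat.Rank s m i).
Proof.
by move=> p q /(congr1 (@pos s m)); rewrite !pos_Rank => e; apply: val_inj.
Qed.

(* At a place of [jordan_d_count], an entry lam - J selected by t is 0: otherwise t
   moves it to the next place of its Jordan block, which is not fixed by t. *)
Lemma zero_entries i k (K : {set 'I_n}) (t : 'S_n) :
  (forall a, a \in K -> t a = a) -> #|K| = k -> (k < m i)%N ->
  (jordan_d (B i) (m i - k)
   <= \sum_(a | a \notin K) (lam i *+ (a == t a) - J a (t a) == 0)%R)%N.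
Proof.
move=> tK cK km.
pose K' := fun p : nat => [exists q : 'I_(m i), (q == p :> nat) && (tagnat.Rank i q \in K)].
have K'K : (count K' (iota 0 (m i)) <= k)%N.
  rewrite -val_enum_ord count_map -sum1_count big_enum_cond sum1_card /=.
  rewrite -cK -(card_imset _ (@Rank_inj i)); apply/subset_leq_card/fintype.subsetP.
  move=> a /imsetP[q]; rewrite unfold_in => /existsP[q' /andP[/eqP qq h]] ->.
  by rewrite (_ : q = q') //; apply: val_inj.
apply: leq_trans (jordan_d_count (BJ i) km K'K) _.
rewrite -(card_imset _ (@Rank_inj i)).
have -> : (\sum_(a | a \notin K) (lam i *+ (a == t a) - J a (t a) == 0)%R =
   #|[pred a | (a \notin K) && (lam i *+ (a == t a) - J a (t a) == 0)%R]|)%N.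
  by rewrite -sum1_card big_mkcondr; apply: eq_bigr => a _; case: (_ == _).
apply/subset_leq_card/fintype.subsetP => a /imsetP[p + ->].
rewrite !inE => /andP[Kp h].
have pK : tagnat.Rank i p \notin K.
  by apply: contra Kp => pK; apply/existsP; exists p; rewrite eqxx pK.
rewrite pK /=; set a0 := tagnat.Rank i p in pK *.
have Bp := (BJ i).1 p.
have [ta|ta] := eqVneq a0 (t a0).
  rewrite -ta mulr1n /a0 mxdiag_Rank; have := Bp p.
  by rewrite eqxx => ->; rewrite subrr.
rewrite mulr0n sub0r oppr_eq0; apply: contraT => Jn.
have [ii|ii] := eqVneq (blk a0) (blk (t a0)); last first.
  by rewrite mxdiag_off ?eqxx in Jn.
have [j [q tq]] := Rank_surj (t a0).
move: ii Jn ta; rewrite tq !blk_Rank => ij; subst j.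
rewrite mxdiag_Rank => Jn pq; have := Bp q.
have pq' : p != q by apply/eqP => e; move: pq; rewrite /a0 e eqxx.
rewrite (negPf pq'); case: eqP => [pq1 _|_ e]; last by rewrite e eqxx in Jn.
case/or3P: h => [/existsP[q' /andP[/eqP q'p q'K]]|/eqP pm|/existsP[q' /andP[/eqP q'p]]].
- have qq : q' = q by apply: val_inj; rewrite /= q'p pq1.
  have := tK _ q'K; rewrite qq -tq => /perm_inj h.
  by move: pq; rewrite -tq h eqxx.
- by have := ltn_ord q; rewrite -pq1 pm ltnn.
- have qq : q' = q by apply: val_inj; rewrite /= -q'p pq1.
  by rewrite qq (negPf Jn).
Qed.

(** Every factor of the expansion is its value for J plus a term vanishing at al, so its order is at
    least 1 when that value is 0; [zero_entries] counts such factors. *)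
Lemma char_poly_vanishes (M : C -> 'M[C]_n) (al : C) i k :
  (forall a b, vanishes_to 1 al (fun z => M z a b - J a b)) -> (k < m i)%N ->
  vanishes_to (jordan_d (B i) (m i - k)) al
    (fun z => taylor_coef (lam i) k (char_poly (M z))).
Proof.
move=> MJ km.
apply: (vanishes_to_ext (fun z => esym (taylor_coef_char_poly (M z) (lam i) k))).
apply: vanishes_to_sum => t; apply: vanishes_to_sum => K.
case: (boolP ([forall a in K, t a == a] && (#|K| == k))); last first.
  by move=> _; apply: vanishes_to_ext (vanishes_to0 _ _) => z; rewrite mulr0 mul0r.
move=> /andP[/forall_inP tK /eqP cK].
apply: vanishes_toZ; have := zero_entries (fun a aK => eqP (tK a aK)) cK km.
move=> /vanishes_to_le; apply; apply: vanishes_to_prod => a.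
set c := lam i *+ (a == t a).
have h : vanishes_to (c - J a (t a) == 0) al (fun z => c - J a (t a)).
  case: eqP => [->|_]; [exact: vanishes_to0 | exact: vanishes_to_cst].
have h' : vanishes_to (c - J a (t a) == 0) al (fun z => -1 * (M z a (t a) - J a (t a))).
  by apply: vanishes_to_le (vanishes_toZ (-1) (MJ a (t a))); case: (_ == _).
by apply: vanishes_to_ext (vanishes_toD h h') => z; ring.
Qed.

End Necessity.

(** * Cyclicity of conjugates of companion matrices *)

Section CyclicMatrices.
Variable R : realType.
Local Notation C := (CC R).

Lemma conj_exp n (G A : 'M[C]_n) k : G \in unitmx ->
  (G *m A *m invmx G) ^+ k *m G = G *m A ^+ k.
Proof.
move=> Gu; elim: k => [|k IH]; first by rewrite !expr0 mul1mx mulmx1.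
rewrite !exprS -[(_ * _) *m G]/((G *m A *m invmx G) *m _ *m G) -mulmxA IH.
by rewrite mulmxA mulmxKV // -mulmxA.
Qed.

Lemma cyclic_conj n (G A : 'M[C]_n) : G \in unitmx ->
  cyclic_mx A -> cyclic_mx (G *m A *m invmx G).
Proof.
move=> Gu [v hv]; exists (G *m v) => x.
have [p [c xE]] := hv (invmx G *m x); exists p, c.
rewrite -[LHS](mulKVmx Gu) xE mulmx_sumr; apply: eq_bigr => k _.
by rewrite -scalemxAr; congr (_ *: _); rewrite [LHS]mulmxA -conj_exp // [RHS]mulmxA.
Qed.

(** The last basis column v is a cyclic vector: A e_j = e_(j-1) - P_j v, so the basis is reached by
    descending induction from v. *)
Lemma companion_cyclic n (P : {poly C}) : cyclic_mx (companion n.+1 P).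
Proof.
set A := companion _ _; pose v : 'cV[C]_n.+1 := delta_mx ord_max 0.
have gen k : (k <= n)%N -> exists q : {poly C},
    delta_mx (inord (n - k)) 0 = horner_mx A q *m v.
  elim: k => [_|k IH kn].
    exists 1; rewrite rmorph1 mul1mx subn0 /v; congr delta_mx.
    by apply: val_inj; rewrite /= inordK.
  have [q qE] := IH (ltnW kn); pose j := (n - k)%N.
  have j0 : (0 < j)%N by rewrite subn_gt0.
  have jn : (j < n.+1)%N by rewrite ltnS leq_subr.
  exists ('X * q + (P`_j)%:P); rewrite rmorphD rmorphM /= horner_mx_X horner_mx_C.
  rewrite mulmxDl mul_scalar_mx -[_ * _ *m v]mulmxA -qE.
  rewrite -colE; apply/matrixP => x y; rewrite !mxE inordK // ord1 eqxx !andbT.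
  rewrite -(inj_eq val_inj) /= inordK; last by rewrite ltnS leq_subr.
  rewrite subnS -/j -[x == ord_max](inj_eq val_inj) /=.
  have [->|xn] := eqVneq (x : nat) n.
    by rewrite mulr1 addNr; have -> : (n == j.-1) = false by move: j0 jn; clear; lia.
  rewrite mulr0 addr0; congr (_%:R).
  by have -> : (x == j.-1 :> nat) = (x.+1 == j) by move: j0; clear; lia.
pose q j := sval (cid (gen (n - j)%N (leq_subr j n))).
have qE (j : 'I_n.+1) : delta_mx j 0 = horner_mx A (q j) *m v.
  rewrite /q; case: cid => r /= <-; congr delta_mx.
  by apply: val_inj; rewrite /= inordK subKn // -ltnS.
exists v => x; pose r := \sum_j x j 0 *: q j.
have -> : x = horner_mx A r *m v.
  rewrite /r linear_sum mulmx_suml /= [LHS]matrix_sum_delta; apply: eq_bigr => j _.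
  by rewrite big_ord1 linearZ /= -scalemxAl -qE.
exists (size r), (fun k => r`_k).
rewrite -[r in LHS]coefK poly_def linear_sum mulmx_suml; apply: eq_bigr => k _.
by rewrite linearZ /= rmorphXn /= horner_mx_X -scalemxAl.
Qed.

End CyclicMatrices.

Section Pvec.
Variable R : realType.
Local Notation C := (CC R).

Lemma size_Pvec_tail n (v : 'rV[C]_n) :
  (size (\sum_(j < n) ((-1) ^+ j.+1 * v ord0 j) *: 'X^(n - j.+1) : {poly C})%R <= n)%N.
Proof.
apply: leq_trans (size_sum _ _ _) _; apply/bigmax_leqP => j _.
apply: leq_trans (size_scale_leq _ _) _; rewrite size_polyXn.
by have := ltn_ord j; lia.
Qed.

Lemma size_Pvec n (v : 'rV[C]_n) : size (Pvec v) = n.+1.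
Proof. by rewrite size_polyDl size_polyXn // ltnS size_Pvec_tail. Qed.

Lemma Pvec_monic n (v : 'rV[C]_n) : Pvec v \is monic.
Proof.
by rewrite monicE lead_coefDl ?lead_coefXn // size_polyXn ltnS size_Pvec_tail.
Qed.

Lemma coef_Pvec n (v : 'rV[C]_n) i : (Pvec v)`_i = (i == n)%:R
  + \sum_(j < n) ((-1) ^+ j.+1 * (i == n - j.+1)%N%:R) * v ord0 j.
Proof.
rewrite coefD coefXn coef_sum; congr (_ + _); apply: eq_bigr => j _.
by rewrite coefZ coefXn mulrAC.
Qed.

Lemma sym_map_eq n (A : 'M[C]_n) v : char_poly A = Pvec v -> sym_map A = v.
Proof.
move=> AE; apply/rowP => j; rewrite mxE AE coef_Pvec.
have jn := ltn_ord j.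
have -> : (n - j.+1 == n)%N = false by lia.
rewrite add0r (bigD1 j) //= eqxx big1 ?addr0 => [|i ij].
  by rewrite mulr1 mulrA -expr2 sqrr_sign mul1r.
have -> : (n - j.+1 == n - i.+1)%N = false.
  move: ij; rewrite -(inj_eq val_inj) /=; have := ltn_ord i; lia.
by rewrite mulr0 mul0r.
Qed.

Lemma coef_Pvec_derivable n (phi : C -> 'rV[C]_n) z i : derivable phi z 1 ->
  derivable (fun y => (Pvec (phi y))`_i : C) z 1.
Proof.
move=> /derivable_entries dphi.
have h : derivable (fun y => \sum_(j < n) ((-1) ^+ j.+1 * (i == n - j.+1)%N%:R) * phi y ord0 j : C) z 1.
  by apply: Cderivable_sum => j; apply: (CderivableM (@Cderivable_cst R _ z)).
apply: Cderivable_ext (CderivableD (@Cderivable_cst R (i == n)%:R z) h) => y.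
by rewrite coef_Pvec.
Qed.

Lemma taylor_coef_derivable (p : C -> {poly C}) x k z N :
  (forall y, size (p y) = N) ->
  (forall i, derivable (fun y => (p y)`_i : C) z 1) ->
  derivable (fun y => taylor_coef x k (p y) : C) z 1.
Proof.
move=> sp dp.
have h : derivable (fun y => \sum_(i < N) (p y)`_i * taylor_coef x k 'X^i : C) z 1.
  by apply: Cderivable_sum => i; apply: (CderivableM (dp i) (@Cderivable_cst R _ z)).
apply: Cderivable_ext h => y.
by rewrite -[p y in RHS]coefK poly_def sp taylor_coef_sum.
Qed.

End Pvec.

(** * Transfer of the growth conditions and proof of the equivalence *)

Lemma jordan_mult_gt0 (F : fieldType) n (A : 'M[F]_n) s (lam : 'I_s -> F)
    (m : 'I_s -> nat) (B : forall i, 'M[F]_(m i)) :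
  jordan_data A lam B -> forall i, (0 < m i)%N.
Proof.
move=> [_ eigA mE _ _] i.
rewrite mE mup_geq ?monic_neq0 ?char_poly_monic // expr1 dvdp_XsubCl.
by rewrite -eigenvalue_root_char; apply/eigA; exists i.
Qed.

(** In the Jordan basis of A the matrix Phi z becomes Q (Phi z) P, with the same characteristic
    polynomial. Its entries differ from those of the Jordan form by fixed linear combinations of
    entries of Phi z - A, each vanishing at al. *)
Lemma local_necessity (R : realType) n (A : 'M[CC R]_n) s (lam : 'I_s -> CC R)
    (m : 'I_s -> nat) (B : forall i, 'M[CC R]_(m i)) (Phi : CC R -> 'M[CC R]_n)
    (al : CC R) i k : jordan_data A lam B ->
  derivable Phi al 1 -> Phi al = A -> (k < m i)%N ->
  vanishes_to (jordan_d (B i) (m i - k)) al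
    (fun z => taylor_coef (lam i) k (char_poly (Phi z))).
Proof.
move=> [_ _ _ BJ [P [Q [PQ QP AE]]]] /derivable_entries dPhi PhiA km.
have e : (\sum_i m i)%N = n.
  by apply/eqP; rewrite eqn_leq (mulmx1_min PQ) (mulmx1_min QP).
subst n.
have [Pu _] := mulmx1_unit PQ.
pose M z := Q *m Phi z *m P.
have ME z : char_poly (M z) = char_poly (Phi z).
  by apply: (char_poly_similar Pu); rewrite /M !mulmxA PQ mul1mx.
apply: (vanishes_to_ext (fun z => congr1 (taylor_coef (lam i) k) (ME z))).
apply: char_poly_vanishes => // a b.
have JE : \mxdiag_i B i = Q *m A *m P.
  by rewrite AE !mulmxA QP mul1mx -mulmxA QP mulmx1.
have E z : \sum_c (\sum_d Q a d * (Phi z d c - A d c)) * P c b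
    = M z a b - (\mxdiag_i B i) a b.
  rewrite JE /M; have -> (X Y : 'M[CC R]_(\sum_i m i)) :
      X a b - Y a b = (X - Y) a b by rewrite !mxE.
  rewrite -mulmxBl -mulmxBr mxE; apply: eq_bigr => c _; congr (_ * _).
  by rewrite mxE; apply: eq_bigr => d _; rewrite !mxE.
apply: (vanishes_to_ext E); apply: vanishes_to_sum => c.
have h : vanishes_to 1 al (fun z => \sum_d Q a d * (Phi z d c - A d c)).
  apply: vanishes_to_sum => d; apply: vanishes_toZ; rewrite -PhiA.
  exact: derivable_vanishes.
by apply: vanishes_to_ext (vanishes_toZ (P c b) h) => z; rewrite mulrC.
Qed.

Lemma growth_vanishes (R : realType) n (phi : CC R -> 'rV[CC R]_n) (al x : CC R) k d :
  ((fun z : CC R => ((Pvec (phi z))^`(k)).[x]) =O_ (al^')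
     (fun z : CC R => (z - al) ^+ d))
  <-> vanishes_to d al (fun z => taylor_coef x k (Pvec (phi z))).
Proof.
have E z : ((Pvec (phi z))^`(k)).[x] = (k`!)%:R * taylor_coef x k (Pvec (phi z)).
  by rewrite nderivn_def hornerMn mulr_natl.
rewrite bigO_vanishes; split=> h.
  apply: vanishes_to_ext (vanishes_toZ (k`!)%:R^-1 h) => z.
  by rewrite E mulKf // pnatr_eq0 -lt0n fact_gt0.
by apply: vanishes_to_ext (vanishes_toZ (k`!)%:R h) => z; rewrite E.
Qed.

Theorem theorem20 (R : realType) (n N : nat) (hn : (1 <= n <= 5)%N)
    (A : 'I_N -> 'M[CC R]_n)
    (alpha : 'I_N -> CC R) (halpha : forall j, unit_disc (alpha j))
    (alpha_inj : injective alpha)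
    (phi : CC R -> 'rV[CC R]_n) (hphi : Hol_disc (@sym_polydisc R n) phi)
    (s : 'I_N -> nat)
    (lam : forall j, 'I_(s j) -> CC R)
    (m : forall j, 'I_(s j) -> nat)
    (B : forall j (i : 'I_(s j)), 'M[CC R]_(m j i))
    (hB : forall j, jordan_data (A j) (lam j) (B j)) :
  let interpolates (Phi : CC R -> 'M[CC R]_n) :=
    [/\ Hol_disc (@spectral_ball R n) Phi,
        forall z, unit_disc z -> phi z = sym_map (Phi z)
      & forall j, Phi (alpha j) = A j] in
  let growth_conditions :=
    forall (j : 'I_N) (i : 'I_(s j)) (k : nat), (k <= m j i - 1)%N ->
      (fun z : CC R => ((Pvec (phi z))^`(k)).[lam j i])
        =O_ ((alpha j)^')
          (fun z : CC R => (z - alpha j) ^+ jordan_d (B j i) (m j i - k)) in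
  ((exists Phi, interpolates Phi) <-> growth_conditions)
  /\ (growth_conditions ->
      exists Phi, interpolates Phi /\
        forall z, unit_disc z -> (forall j, z <> alpha j) -> cyclic_mx (Phi z)).
Proof.
move=> interpolates growth.
have gE : growth <-> forall (j : 'I_N) (i : 'I_(s j)) k, (k < m j i)%N ->
    vanishes_to (jordan_d (B j i) (m j i - k)) (alpha j)
      (fun z => taylor_coef (lam j i) k (Pvec (phi z))).
  split=> h j i k km.
    apply/growth_vanishes/h.
    (* Positivity of m matters for the truncated subtraction: k <= m - 1 means k < m only if m >
       0. *)
    by have := jordan_mult_gt0 (hB j) i; move: km; clear; lia.
  apply/growth_vanishes/h.
  by have := jordan_mult_gt0 (hB j) i; move: km; clear; lia.
suff suf : growth -> exists Phi, interpolates Phi /\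
    forall z, unit_disc z -> (forall j, z <> alpha j) -> cyclic_mx (Phi z).
  split=> //; split; last by move=> /suf[Phi [h _]]; exists Phi.
  move=> [Phi [hPhi phiE PhiA]]; apply/gE => j i k km.
  have d0 : 0 < 1 - `|alpha j| by rewrite subr_gt0; exact: halpha.
  have h := local_necessity (hB j) (hPhi _ (halpha j)).1 (PhiA j) km.
  (* phi and Phi are related only on the disc, so the comparison is made within distance 1 -
     |alpha_j| of alpha_j. *)
  apply: (vanishes_to_eq d0 _ h) => z zd.
  rewrite char_poly_sym_map -phiE // /unit_disc /=.
  rewrite -(subrK (alpha j) z); apply: le_lt_trans (ler_normD _ _) _.
  by rewrite -ltrBrDr.
move=> /gE gr; rewrite /interpolates; clear interpolates growth gE.
case: n hn A phi hphi hB gr => [//|n] _ A phi hphi hB gr.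
have fr j : {f | frame_of (lam j) (B j) (A j) f} by exact: cid (local_model (hB j)).
pose E j := evaluation_mx (sval (fr j)); pose S j := basis_mx (sval (fr j)).
pose T j := generic_mx (sval (fr j)); pose J j := special_mx (sval (fr j)).
pose w j := frame_weight (sval (fr j)); pose k j := frame_order (sval (fr j)).
pose b j := frame_index (sval (fr j)).
have frP j : [/\ [/\ E j \in unitmx, S j \in unitmx, A j = S j *m J j *m invmx (S j)
        & char_poly (T j) = char_poly (A j)],
      forall x y, J j x y = if w j x == w j y then T j x y else 0,
      forall x y, T j x y != 0 -> (w j y <= w j x)%N,
      forall x, (k j x < m j (b j x))%N /\
        jordan_d (B j (b j x)) (m j (b j x) - k j x) = (w j x).+1
    & forall P, P \is monic -> size P = n.+2 -> forall x y : 'I_n.+1,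
      (companion n.+1 P *m E j) x y = (E j *m T j) x y
        - (x == n :> nat)%:R * taylor_coef (lam j (b j y)) (k j y) P].
  by rewrite /E /S /T /J /w /k /b; case: (fr j) => -[].
clearbody E S T J w k b.
pose p z := Pvec (phi z).
pose r j a z := taylor_coef (lam j (b j a)) (k j a) (p z).
have phid z : unit_disc z -> derivable phi z 1 by move=> /hphi[].
have rd j a z : unit_disc z -> derivable (r j a) z 1.
  move=> zD; apply: (@taylor_coef_derivable R p _ _ z n.+2) => [y|i].
    exact: size_Pvec.
  by apply: coef_Pvec_derivable; apply: phid.
(* The growth condition for coordinate a has exponent [w j a] + 1, all of which is divided out. *)
have rho j a : {g : CC R -> CC R | (forall z, unit_disc z -> derivable g z 1) /\
    forall z, r j a z = (z - alpha j) ^+ (w j a).+1 * g z}.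
  apply: cid; apply: hol_factor (halpha j) _ => [z zD|]; first exact: rd.
  by have [_ _ _ /(_ a)[km dE] _] := frP j; rewrite -dE; apply: gr.
have Eu j : E j \in unitmx by have [[]] := frP j.
have Su j : S j \in unitmx by have [[]] := frP j.
have JE j x y : J j x y = if w j x == w j y then T j x y else 0 by have [_ ->] := frP j.
have wT j x y : T j x y != 0 -> (w j y <= w j x)%N by have [_ _ h _ _] := frP j; apply: h.
have charT j : char_poly (T j) = char_poly (J j).
  have [[_ _ AE ->] _ _ _ _] := frP j.
  by symmetry; apply: (char_poly_similar (Su j)); rewrite AE mulmxKV.
have companionE j z x y : (companion n.+1 (p z) *m E j) x y
    = (E j *m T j) x y - (x == n :> nat)%:R * r j y z.
  by have [_ _ _ _ h] := frP j; apply: h; [exact: Pvec_monic | exact: size_Pvec].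
have [Phi [Phid Phichar PhiA Phicyc]] := @lifting R n N alpha alpha_inj E S T J w
  Eu Su JE wT p r (fun j a => sval (rho j a)) (fun z => Pvec_monic (phi z))
  (fun z => size_Pvec (phi z)) (fun z zD i => @coef_Pvec_derivable R n.+1 phi z i (@phid z zD))
  companionE (fun j a => (svalP (rho j a)).2) (fun j a => (svalP (rho j a)).1) charT.
exists Phi; split; last first.
  move=> z zD zn; have [j|G Gu ->] := Phicyc z; first exact/eqP.
  exact/cyclic_conj/companion_cyclic.
have phiE z : phi z = sym_map (Phi z) by rewrite (sym_map_eq (Phichar z)).
split=> [z zD|z _|j]; first split.
- exact/derivable_entries/Phid.
(* As phi z is in the symmetrized polydisc, its polynomial is the characteristic polynomial of some
   A' in the spectral ball, so Phi z has the eigenvalues of A'. *)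
- move=> a; rewrite eigenvalue_root_char Phichar.
  have [_ [A' A'D phiA']] := hphi z zD.
  by rewrite /p -phiA' -char_poly_sym_map -eigenvalue_root_char; apply: A'D.
- exact: phiE.
- by have [[_ _ -> _] _ _ _ _] := frP j; rewrite PhiA.
Qed.
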